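(* Let $\mathcal H$ be a separable Hilbert space and let $F(\cdot)\in R(\mathcal H)$ be strongly holomorphic. Assume in addition that for some $z_0\in\mathbb C_+$ the form $\mathfrak t(z_0)$ is closable and $\mathcal D(F)$ is a core for its closure $\overline{\mathfrak t}(z_0)$. Then: (i) the form $\mathfrak t(z)$ is closable for any $z\in\mathbb C_+$; (ii) $\mathcal D(F)$ is a core for the closure $\overline{\mathfrak t}(z)$ of the form $\mathfrak t(z)$ for each $z\in\mathbb C_+$. Moreover, the corresponding energy spaces $\mathcal H_+(z)$, $z\in\mathbb C_+$, coincide algebraically and topologically: $\mathcal H_+(z)=\mathcal H_+(z_0)$ for $z\in\mathbb C_+$. In particular, $\mathcal D[F]:=\bigcap_{z\in\mathbb C_+}\mathcal H_+(z)=\mathcal H_+(z_0)$; (iii) for any pair $u,v\in\mathcal D[F]$ the function $\overline{\mathfrak t}(\cdot)[u,v]$ is harmonic (hence real analytic) in $\mathbb C_+$.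
   Context: The class $R(\mathcal H)$ consists of functions $F$ on $\mathbb C\setminus\mathbb R$ whose values are closed linear operators in $\mathcal H$ such that: $F(z)$ is maximal dissipative for $z\in\mathbb C_+$ and maximal accumulative for $z\in\mathbb C_-$; $F(z)^*=F(\bar z)$; and for some (hence all) $w\in\mathbb C_+$ ($w\in\mathbb C_-$) the bounded-operator-valued function $(F(z)+w)^{-1}$ is holomorphic in $z\in\mathbb C_+$ ($z\in\mathbb C_-$). (An operator $T$ is dissipative/accumulative if $\operatorname{Im}(Tu,u)\ge0$ / $\le0$ on $\operatorname{dom}T$; maximal means having no proper dissipative/accumulative extension, as a linear relation.) $F\in R(\mathcal H)$ is called strongly holomorphic if (a) $\mathcal D(F):=\bigcap_{z\in\mathbb C_+}\operatorname{dom}F(z)$ is dense in $\mathcal H$, and (b) for each $u\in\mathcal D(F)$ the vector function $F(z)u$ is holomorphic in a domain $\Omega$ with $\mathbb C_+\subset\Omega\subset\mathbb C_+\cup\mathbb R$. For $z\in\mathbb C_+$ the form $\mathfrak t(z)$ with domain $\operatorname{dom}F(z)$ is $\mathfrak t(z)[u,v]=\frac1{2i}\left[(F(z)u,v)-(u,F(z)v)\right]$, so $\mathfrak t(z)[u]:=\mathfrak t(z)[u,u]=\operatorname{Im}(F(z)u,u)\ge0$. Equip $\operatorname{dom}F(z)$ with the inner product $(u,v)_{+,z}=(u,v)_{\mathcal H}+\mathfrak t(z)[u,v]$; the energy space $\mathcal H_+(z)$ is the completion of this pre-Hilbert space. The form $\mathfrak t(z)$ is closable if the norms $\|\cdot\|_{\mathcal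 H}$ and $\|\cdot\|_{+,z}$ are compatible, i.e. the completion is realized within $\mathcal H$, $\mathcal H_+(z)\subset\mathcal H$ (equivalently: $u_n\to0$ in $\mathcal H$ and $\mathfrak t(z)[u_n-u_m]\to0$ imply $\mathfrak t(z)[u_n]\to0$). In that case the closure $\overline{\mathfrak t}(z)$ is the extension of $\mathfrak t(z)$ by continuity to $\mathcal H_+(z)$. A subspace $\mathcal D\subset\mathcal H_+(z)$ is a core for $\overline{\mathfrak t}(z)$ if it is dense in $\mathcal H_+(z)$. *)

(* Defs.v *)
From HB Require Import structures.
From mathcomp Require Import all_boot all_order all_algebra.
From mathcomp Require Import all_classical all_reals all_analysis.
From mathcomp Require Import complex.

Set Implicit Arguments.
Unset Strict Implicit.
Unset Printing Implicit Defensive.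
Import Order.TTheory GRing.Theory Num.Theory.
Import numFieldNormedType.Exports.
Local Open Scope classical_set_scope.
Local Open Scope complex_scope.
Local Open Scope ring_scope.

(* Conventions.  The scalar field is [R[i]] for a real type [R]; [R[i]^o] is the
   same type seen as a normed space over itself, which carries its topology.
   In the order of [R[i]], [0 <= a] means that [a] is real and nonnegative, and
   norms take their values in [R[i]].  A Hilbert space is a complete normed
   module [H] over [R[i]] together with a positive definite hermitian form
   [ip : {dot H for Num.conj}], linear in its first argument, that induces the
   norm. *)

Definition upper_half_plane (R : realType) : set R[i]^o :=
  [set z | 0 < complex.Im z].
Definition lower_half_plane (R : realType) : set R[i]^o :=
  [set z | complex.Im z < 0].
Definition real_line (R : realType) : set R[i]^o :=
  [set z | complex.Im z = 0].
Arguments upper_half_plane : clear implicits.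
Arguments lower_half_plane : clear implicits.
Arguments real_line : clear implicits.

Definition hilbert_norm (R : realType) (H : completeNormedModType R[i])
    (ip : {dot H for Num.conj}) : Prop :=
  forall u : H, `|u| ^+ 2 = ip u u.

Definition separable (T : topologicalType) : Prop :=
  exists2 S : set T, countable S & dense S.

Definition linear_subspace (K : numFieldType) (V : lmodType K) (D : set V) :
    Prop :=
  D 0 /\ forall (a : K) (u v : V), D u -> D v -> D (a *: u + v).

(* A linear operator in H: the values of [lop_fun] outside [dom] are junk, all
   notions below only depend on the graph. *)
Record lin_op (R : realType) (H : lmodType R[i]) := LinOp {
  dom : set H;
  lop_fun :> H -> H;
  dom_subspace : linear_subspace dom;
  lop_linear : forall (a : R[i]) (u v : H), dom u -> dom v ->
    lop_fun (a *: u + v) = a *: lop_fun u + lop_fun v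
}.

Definition graph (R : realType) (H : lmodType R[i]) (T : lin_op H) :
    set (H * H) :=
  [set p | dom T p.1 /\ p.2 = T p.1].

Section Relations.
Variables (R : realType) (H : completeNormedModType R[i]).
Variable ip : {dot H for Num.conj}.
Implicit Types (A B : set (H * H)).

Definition dissipative A : Prop :=
  forall p, A p -> 0 <= complex.Im (ip p.2 p.1).

Definition accumulative A : Prop :=
  forall p, A p -> complex.Im (ip p.2 p.1) <= 0.

Definition maximal_dissipative A : Prop :=
  dissipative A /\
  forall B, linear_subspace B -> dissipative B -> A `<=` B -> B = A.

Definition maximal_accumulative A : Prop :=
  accumulative A /\
  forall B, linear_subspace B -> accumulative B -> A `<=` B -> B = A.

(* The adjoint is a linear relation, which is multivalued when [A] is not
   densely defined. *)
Definition adjoint A : set (H * H) :=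
  [set q | forall p, A p -> ip p.2 q.1 = ip p.1 q.2].

End Relations.

Section Holomorphy.
Variables (R : realType) (H : completeNormedModType R[i]).

Definition holomorphic_on (U : set R[i]^o) (f : R[i]^o -> H) : Prop :=
  forall z, U z -> derivable f z 1.

(* Complex differentiability at [z] with respect to the operator norm. *)
Definition op_derivable (B : R[i]^o -> {linear H -> H}) (z : R[i]^o) : Prop :=
  exists2 B' : {linear H -> H}, continuous B' &
    forall e : R[i], 0 < e ->
      \forall h \near (0 : R[i]^o)^', forall u : H,
        `|h^-1 *: (B (h + z) u - B z u) - B' u| <= e * `|u|.

(* [(F z + w)^-1] is, for each [z] in [U], an everywhere defined bounded
   operator, and it depends holomorphically on [z] in [U]. *)
Definition resolvent_holomorphic (F : R[i]^o -> lin_op H) (w : R[i])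
    (U : set R[i]^o) : Prop :=
  exists B : R[i]^o -> {linear H -> H},
    [/\ forall z, U z -> continuous (B z),
        forall z, U z -> forall f u : H,
          B z f = u <-> (dom (F z) u /\ F z u + w *: u = f)
      & forall z, U z -> op_derivable B z].

End Holomorphy.

Section NevanlinnaFunctions.
Variables (R : realType) (H : completeNormedModType R[i]).
Variable ip : {dot H for Num.conj}.
Local Notation Cp := (upper_half_plane R).
Local Notation Cm := (lower_half_plane R).

(* The class R(H); the values of [F] on the real line are junk. *)
Definition class_R (F : R[i]^o -> lin_op H) : Prop :=
  [/\ forall z, Cp z \/ Cm z -> closed (graph (F z)),
      forall z, Cp z -> maximal_dissipative ip (graph (F z)),
      forall z, Cm z -> maximal_accumulative ip (graph (F z)),
      forall z : R[i], Cp z \/ Cm z ->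
        adjoint ip (graph (F z)) = graph (F (Num.conj z))
    & (exists2 w, Cp w & resolvent_holomorphic F w Cp) /\
      (exists2 w, Cm w & resolvent_holomorphic F w Cm)].

Definition common_domain (F : R[i]^o -> lin_op H) : set H :=
  \bigcap_(z in Cp) dom (F z).

(* Since [F] has no values on the real line, holomorphy of [F z u] in [Omega]
   means that it has a holomorphic extension [g] to [Omega]. *)
Definition strongly_holomorphic (F : R[i]^o -> lin_op H) : Prop :=
  dense (common_domain F) /\
  forall u, common_domain F u ->
    exists Omega : set R[i]^o,
      [/\ open Omega, connected Omega,
          Cp `<=` Omega, Omega `<=` Cp `|` real_line R
        & exists2 g : R[i]^o -> H,
            holomorphic_on Omega g & forall z, Cp z -> g z = F z u].

Definition im_form (T : lin_op H) (u v : H) : R[i]^o :=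
  (2 * 'i%C)^-1 * (ip (T u) v - ip u (T v)).

End NevanlinnaFunctions.

(* Closure theory of a nonnegative sesquilinear form [t] with domain [D]. *)
Section Forms.
Variables (R : realType) (H : completeNormedModType R[i]).
Variable ip : {dot H for Num.conj}.
Variables (D : set H) (t : H -> H -> R[i]^o).

(* [u_] lies in [D], is Cauchy for the norm of H plus [t], and tends to [u]
   in H. *)
Definition form_cvg (u_ : nat -> H) (u : H) : Prop :=
  [/\ forall n, D (u_ n),
      u_ @ \oo --> u
    & (fun p : nat * nat => t (u_ p.1 - u_ p.2) (u_ p.1 - u_ p.2))
        @ (\oo, \oo) --> (0 : R[i]^o)].

Definition closable : Prop :=
  forall u_, form_cvg u_ 0 -> (fun n => t (u_ n) (u_ n)) @ \oo --> (0 : R[i]^o).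

(* For closable [t], the completion of [D] realized within H. *)
Definition energy_space : set H :=
  [set u | exists u_, form_cvg u_ u].

(* For closable [t], the limit [l] below exists on [energy_space] and does not
   depend on the approximating sequences. *)
Definition form_closure (u v : H) : R[i] :=
  xget 0 [set l : R[i]^o | exists u_ v_ : nat -> H,
    [/\ form_cvg u_ u, form_cvg v_ v & (fun n => t (u_ n) (v_ n)) @ \oo --> l]].

Definition energy_ip (u v : H) : R[i] := ip u v + form_closure u v.

Definition energy_norm (u : H) : R[i] := sqrtC (energy_ip u u).

Definition energy_open (A : set H) : Prop :=
  A `<=` energy_space /\
  forall u, A u -> exists2 r : R[i], 0 < r &
    forall v, energy_space v -> energy_norm (v - u) < r -> A v.

Definition is_core (D0 : set H) : Prop :=
  D0 `<=` energy_space /\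
  forall u, energy_space u -> forall e : R[i], 0 < e ->
    exists2 v, D0 v & energy_norm (v - u) < e.

End Forms.

Section FormsOfF.
Variables (R : realType) (H : completeNormedModType R[i]).
Variables (ip : {dot H for Num.conj}) (F : R[i]^o -> lin_op H).

Definition tform_closable (z : R[i]^o) : Prop :=
  closable (dom (F z)) (im_form ip (F z)).

Definition tform_closure (z : R[i]^o) : H -> H -> R[i] :=
  form_closure (dom (F z)) (im_form ip (F z)).

Definition tform_core (D0 : set H) (z : R[i]^o) : Prop :=
  is_core ip (dom (F z)) (im_form ip (F z)) D0.

Definition Hplus (z : R[i]^o) : set H :=
  energy_space (dom (F z)) (im_form ip (F z)).

Definition Hplus_open (z : R[i]^o) : set H -> Prop :=
  energy_open ip (dom (F z)) (im_form ip (F z)).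

Definition form_domain : set H :=
  \bigcap_(z in upper_half_plane R) Hplus z.

End FormsOfF.

Section Harmonicity.
Variable R : realType.

Definition fun_of_plane (f : R[i] -> R) : R * R -> R :=
  fun p => f (p.1 +i* p.2).

Definition ex : R * R := (1, 0).
Definition ey : R * R := (0, 1).

Definition C2_at (g : R * R -> R) (p : R * R) : Prop :=
  {for p, continuous g} /\
  forall v, [set ex; ey] v ->
    [/\ derivable g p v, {for p, continuous ('D_v g)}
      & forall w, [set ex; ey] w ->
          derivable ('D_v g) p w /\ {for p, continuous ('D_w ('D_v g))}].

Definition laplacian (g : R * R -> R) (p : R * R) : R :=
  'D_ex ('D_ex g) p + 'D_ey ('D_ey g) p.

Definition harmonic_on (U : set R[i]^o) (f : R[i] -> R) : Prop :=
  forall x y : R, U (x +i* y) ->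
    C2_at (fun_of_plane f) (x, y) /\ laplacian (fun_of_plane f) (x, y) = 0.

(* Near each point of [U], [f] is the sum of an absolutely convergent power
   series in two real variables, summed here by homogeneous degree. *)
Definition real_analytic_on (U : set R[i]^o) (f : R[i] -> R) : Prop :=
  forall x y : R, U (x +i* y) ->
    exists (r : R) (c : nat -> nat -> R), 0 < r /\
      forall h k : R, `|h| < r -> `|k| < r ->
        cvgn (series (fun n : nat =>
          \sum_(i < n.+1) `|c i (n - i)%N * h ^+ i * k ^+ (n - i)|)) /\
        series (fun n : nat =>
          \sum_(i < n.+1) c i (n - i)%N * h ^+ i * k ^+ (n - i)) @ \oo
            --> f ((x + h) +i* (y + k)).

(* A complex-valued function is harmonic (real analytic) when its real and
   imaginary parts are. *)
Definition charmonic_on (U : set R[i]^o) (f : R[i] -> R[i]) : Prop :=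
  harmonic_on U (fun z => complex.Re (f z)) /\
  harmonic_on U (fun z => complex.Im (f z)).

Definition creal_analytic_on (U : set R[i]^o) (f : R[i] -> R[i]) : Prop :=
  real_analytic_on U (fun z => complex.Re (f z)) /\
  real_analytic_on U (fun z => complex.Im (f z)).

End Harmonicity.

(* Main.v *)
Require Import Defs.
From mathcomp Require Import all_boot all_order all_algebra.
From mathcomp Require Import all_classical all_reals all_analysis.
From mathcomp Require Import complex.
From mathcomp Require Import cyclic ring lra.
From mathcomp Require separable cyclotomic.
Import Order.TTheory GRing.Theory Num.Theory.
Import numFieldNormedType.Exports.
Local Open Scope classical_set_scope.
Local Open Scope complex_scope.
Local Open Scope ring_scope.
Set Implicit Arguments.
Unset Strict Implicit.
Unset Printing Implicit Defensive.
Import Normc.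

(** Fix [w] in the upper half-plane for which [B z = (F z + w)^-1] is holomorphic,
    put [eta = Im w], and let [C z = 1 - 2 i eta B z] be the Cayley transform of
    [F z].  Dissipativity says that [C z] is a contraction, and the identity
    [|f|^2 - |C z f|^2 = 4 eta t(z)[B z f]] ([cayley_defect]) says that the form
    [t(z)], transported by [B z], is the defect of isometry of [C z].  Now [C] is a
    holomorphic contraction-valued function, and for such functions the
    Schwarz-Pick inequality bounds [C z - C z1] by the defects at [z1] alone, with
    a factor that tends to 0 as [z] tends to [z1] and only depends on
    [|z - z1| / Im z1] ([schwarz_pick_defect], [schwarz_pick_norm]).

    In terms of [u = B z f - B z1 f] this bounds the norm of [u] and its pairings
    with [(F z1 + conj w) b], [b] in [dom F(z1)].  The vectors
    [i s (F z1 + w + i s)^-1 u] then tend to [u] with bounded forms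
    ([regularize]), so by lower semicontinuity ([bounded_limit]) [u] lies in the
    energy space of [t(z1)], with an energy norm that is a small multiple of that
    of [B z1 f].  Hence [B z f] is in that space a small perturbation of [B z1 f],
    and comparing the two forms along such pairs gives that [t(z)] is closable
    with the same energy space and an equivalent norm, as soon as [z] lies within
    a fixed fraction of [Im z1] from [z1] ([local_invariance]).  Finitely many such
    steps join [z0] to any [z] ([global_invariance]).  Cores and open sets only
    depend on the space and on the norm up to equivalence, which proves (i) and
    (ii).

    For (iii), when [a] and [b] are in [D(F)], strong holomorphy makes
    [(F z a, b)] holomorphic, and [t(z)[a, b]] is built from this function and the
    conjugate of [(F z b, a)], so its real and imaginary parts are real parts of
    power series.  The local equivalence of norms is uniform, and [D(F)] is a core
    at every point; thus the closed form at arbitrary [u] and [v] is locally a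
    uniform limit of such functions, and the coefficients converge with the
    functions ([harmonic_limit]).  Real parts of power series are harmonic and real
    analytic ([plane_ps_C2], [plane_ps_laplacian], [plane_ps_analytic]).

    Operator functions only enter through their matrix elements, so scalar complex
    analysis suffices: Goursat's theorem on rectangles, Cauchy's expansion over a
    square ([cauchy_series]), and averages over roots of unity in place of
    integrals over circles. *)

(** * Real limits and complex moduli *)

Section SmallReals.
Variable R : realType.
Implicit Types (x y e K r : R).

Lemma le_small x y K : (forall e, 0 < e -> e <= 1 -> x <= y + K * e) -> x <= y.
Proof.
move=> h; apply/ler_addgt0Pr => d d0.
pose e := Num.min 1 (d / (`|K| + 1)).
have K1 : 0 < `|K| + 1 by rewrite ltr_wpDl.
have e0 : 0 < e by rewrite lt_min ltr01 divr_gt0.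
apply: (le_trans (h e e0 _)); first by rewrite ge_min lexx.
rewrite lerD2l; apply: (@le_trans _ _ ((`|K| + 1) * e)).
  by apply: ler_wpM2r; [exact: ltW|have := ler_norm K; lra].
have : e <= d / (`|K| + 1) by rewrite ge_min lexx orbT.
by rewrite ler_pdivlMr // mulrC.
Qed.

Lemma geometric_small K r e : 0 <= r -> r < 1 -> 0 < e ->
  exists N, forall n, (N <= n)%N -> K * r ^+ n <= e.
Proof.
move=> r0 r1 e0; have : (fun n => K * r ^+ n) @ \oo --> (0 : R).
  rewrite -[X in _ --> X](mulr0 K); apply: cvgMr.
  by apply: cvg_expr; rewrite ger0_norm.
move/cvgrPdist_le => /(_ _ e0)[N _ hN]; exists N => n /hN /=.
by rewrite sub0r normrN => h; exact: le_trans (ler_norm _) h.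
Qed.

Lemma half_pow_small K e : 0 < e -> exists N, forall n, (N <= n)%N -> K / 2 ^+ n <= e.
Proof.
have h0 : 0 <= 2^-1 :> R by rewrite invr_ge0.
have h1 : 2^-1 < 1 :> R by rewrite invf_lt1 // ltr1n.
by move=> /(geometric_small K h0 h1)[N hN]; exists N => n /hN; rewrite exprVn.
Qed.

Lemma harmonic_small e : 0 < e -> exists N, forall n, (N <= n)%N -> n.+1%:R^-1 <= e.
Proof.
move=> e0; have /cvgrPdist_le/(_ _ e0)[N _ hN] := @cvg_harmonic R.
by exists N => n /hN /=; rewrite sub0r normrN ger0_norm.
Qed.

Lemma le_pow2 x y K : (forall m, x <= y + K / 2 ^+ m) -> x <= y.
Proof.
move=> h; apply/ler_addgt0Pr => e /(half_pow_small K)[N hN].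
by apply: (le_trans (h N)); rewrite lerD2l hN.
Qed.

Lemma gt0_real (e : R[i]) : 0 < e -> exists2 x : R, 0 < x & e = x%:C.
Proof. by case: e => a b; rewrite ltcE /= => /andP[/eqP-> a0]; exists a. Qed.

End SmallReals.

Section ComplexNorm.
Variable R : realType.
Implicit Types z w : R[i].

Lemma normc_normr z : `|z| = (normc z)%:C.
Proof. by []. Qed.

Lemma normc_ge0 z : 0 <= normc z.
Proof. by case: z => a b; exact: sqrtr_ge0. Qed.

Lemma normc_add z w : normc (z + w) <= normc z + normc w.
Proof. exact: le_normcD. Qed.

Lemma normc_opp z : normc (- z) = normc z.
Proof. exact: normcN. Qed.

Lemma normc_sub z w : normc (z - w) <= normc z + normc w.
Proof. by rewrite -[normc w]normc_opp; exact: normc_add. Qed.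

Lemma normc_distC z w : normc (z - w) = normc (w - z).
Proof. by rewrite -normc_opp opprB. Qed.

Lemma normcRe z : `|complex.Re z| <= normc z.
Proof.
case: z => a b /=; rewrite -sqrtr_sqr ler_sqrt ?addr_ge0 ?sqr_ge0 //.
by rewrite lerDl sqr_ge0.
Qed.

Lemma normcIm z : `|complex.Im z| <= normc z.
Proof.
case: z => a b /=; rewrite -sqrtr_sqr ler_sqrt ?addr_ge0 ?sqr_ge0 //.
by rewrite lerDr sqr_ge0.
Qed.

Lemma normc_real (x : R) : normc x%:C = `|x|.
Proof. by rewrite /= expr0n addr0 sqrtr_sqr. Qed.

Lemma normc_i : normc ('i%C : R[i]) = 1.
Proof. by rewrite /= expr0n add0r expr1n sqrtr1. Qed.

Lemma normc_sqr z : normc z ^+ 2 = complex.Re z ^+ 2 + complex.Im z ^+ 2.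
Proof. by case: z => a b /=; rewrite sqr_sqrtr ?addr_ge0 ?sqr_ge0. Qed.

Lemma normc_le z : normc z <= `|complex.Re z| + `|complex.Im z|.
Proof.
rewrite -(ler_pXn2r (n := 2)) ?nnegrE ?normc_ge0 ?addr_ge0 //.
rewrite normc_sqr sqrrD !real_normK ?num_real //.
by rewrite -addrA lerD2l lerDr mulrn_wge0 ?mulr_ge0.
Qed.

Lemma normcX z n : normc (z ^+ n) = normc z ^+ n.
Proof.
elim: n => [|n IH]; first by rewrite !expr0 normc1.
by rewrite !exprS normcM IH.
Qed.

Lemma normc_conj z : normc z^* = normc z.
Proof. by case: z => a b /=; rewrite sqrrN. Qed.

Lemma normc_eq0 z : (normc z == 0) = (z == 0).
Proof. by apply/eqP/eqP => [/eq0_normc //|->]; exact: normc0. Qed.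

Lemma normc_gt0 z : (0 < normc z) = (z != 0).
Proof. by rewrite lt_def normc_ge0 andbT normc_eq0. Qed.

Lemma normc_sum (I : Type) (r : seq I) (P : pred I) (f : I -> R[i]) :
  normc (\sum_(i <- r | P i) f i) <= \sum_(i <- r | P i) normc (f i).
Proof.
elim/big_rec2: _ => [|i x y _ h]; first by rewrite normc0.
by apply: (le_trans (normc_add _ _)); rewrite lerD2l.
Qed.

Lemma mulJc z : z^* * z = (normc z ^+ 2)%:C.
Proof. by rewrite mulrC -sqr_normc normc_normr -(rmorphXn (real_complex R)). Qed.

Lemma normc_small_eq0 z (C : R) :
  (forall e : R, 0 < e -> normc z <= C * e) -> z = 0.
Proof.
move=> h; apply: eq0_normc; apply/eqP; rewrite eq_le normc_ge0 andbT.
apply/ler_addgt0Pl => e e0; rewrite addr0.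
have C1 : 0 < `|C| + 1 by rewrite ltr_wpDl.
apply: (le_trans (h (e / (`|C| + 1)) _)); first exact: divr_gt0.
rewrite mulrCA ger_pMr // ler_pdivrMr // mul1r.
by rewrite (le_trans (ler_norm _)) // lerDl.
Qed.

End ComplexNorm.

Section RealNorm.
Variables (R : realType) (V : normedModType R[i]).
Implicit Types (u v : V).

(** Norms over [R[i]] take values in [R[i]]; estimates are done in the real
    field [R], where the order is total. *)
Definition rnorm u : R := complex.Re `|u|.

Lemma rnormE u : `|u| = (rnorm u)%:C.
Proof.
by rewrite /rnorm; have := ger0_Im (normr_ge0 u); case: `|u| => a b /= ->.
Qed.

Lemma rnorm_ge0 u : 0 <= rnorm u.
Proof. by rewrite -ler0c -rnormE. Qed.

Lemma rnorm0 : rnorm 0 = 0.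
Proof. by rewrite /rnorm normr0. Qed.

Lemma rnormD u v : rnorm (u + v) <= rnorm u + rnorm v.
Proof. by rewrite -lecR rmorphD /= -!rnormE ler_normD. Qed.

Lemma rnormN u : rnorm (- u) = rnorm u.
Proof. by rewrite /rnorm normrN. Qed.

Lemma rnormB u v : rnorm (u - v) <= rnorm u + rnorm v.
Proof. by rewrite -[rnorm v]rnormN rnormD. Qed.

Lemma rnorm_distC u v : rnorm (u - v) = rnorm (v - u).
Proof. by rewrite /rnorm distrC. Qed.

Lemma rnormZ (a : R[i]) u : rnorm (a *: u) = normc a * rnorm u.
Proof.
apply: (@complexI R); rewrite rmorphM /= -!rnormE normrZ; congr (_ * _).
Qed.

Lemma rnorm_eq0 u : (rnorm u == 0) = (u == 0).
Proof. by rewrite -[u == 0]normr_eq0 rnormE; apply/eqP/eqP => [->|[]]. Qed.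

Lemma nbhs_rnorm u (P : set V) :
  nbhs u P <-> exists2 d : R, 0 < d & forall v, rnorm (v - u) < d -> P v.
Proof.
split.
  move=> /nbhs_ballP[_ /= /gt0_real[d d0 ->] h]; exists d => // v hv.
  by apply: h; rewrite -ball_normE /= -normrN opprB rnormE ltcR.
case=> d d0 h; apply/nbhs_ballP; exists d%:C => /=; first by rewrite ltcR.
move=> v; rewrite -ball_normE /= -normrN opprB rnormE ltcR; exact: h.
Qed.

Lemma cvg_rnorm (T : Type) (F : set_system T) (FF : Filter F) (f : T -> V) u :
  f @ F --> u <-> forall e : R, 0 < e -> \forall t \near F, rnorm (f t - u) <= e.
Proof.
split=> [h e e0|h].
  apply: (h [set v | rnorm (v - u) <= e]).
  by apply/nbhs_rnorm; exists e => // v /ltW.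
move=> P /nbhs_rnorm[d d0 hP]; rewrite /= nbhs_simpl.
have d20 : 0 < d / 2 by rewrite divr_gt0.
apply: filterS (h _ d20) => t ht; apply: hP.
by rewrite (le_lt_trans ht) // ltr_pdivrMr // ltr_pMr // ltr1n.
Qed.

Lemma cvgn_rnorm (f : nat -> V) u :
  f @ \oo --> u <->
  forall e : R, 0 < e -> exists N, forall n, (N <= n)%N -> rnorm (f n - u) <= e.
Proof.
split.
  move=> /cvg_rnorm h e /h [N _ hN]; exists N => n Nn; exact: hN.
move=> h; apply/cvg_rnorm => e /h[N hN]; exists N => // n /=; exact: hN.
Qed.

End RealNorm.

Section ScalarLimits.
Variable R : realType.
Implicit Types (z w : R[i]).

Lemma rnormc (z : R[i]^o) : rnorm z = normc z.
Proof. by []. Qed.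

(** Complex differentiability with an explicit derivative, in terms of real
    moduli; it makes sense for scalar and for vector functions. *)
Definition cderiv (V : normedModType R[i]) (f : R[i]^o -> V) (z : R[i]) (d : V) :=
  forall e : R, 0 < e -> exists2 r : R, 0 < r & forall h : R[i], normc h < r ->
    rnorm (f (h + z) - f z - h *: d) <= e * normc h.

Lemma cderiv_cvg (V : normedModType R[i]) (f : R[i]^o -> V) (z : R[i]^o) (d : V) :
  (fun h : R[i] => h^-1 *: ((f \o shift z) (h *: (1 : R[i]^o)) - f z))
    @ (0 : R[i]^o)^' --> d <->
  cderiv f z d.
Proof.
split.
  move=> hd e e0; move/cvg_rnorm: hd => /(_ _ e0) /nbhs_rnorm[r r0 hr].
  exists r => // h hh; have [->|h0] := eqVneq h 0.
    by rewrite add0r subrr scale0r subrr rnorm0 normc0 mulr0.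
  have := hr h; rewrite subr0 rnormc => /(_ hh h0) /=.
  rewrite -[h%:A]/(h * 1) mulr1 => hle.
  rewrite -[_ - _ - _](scalerKV (a := h)) // rnormZ mulrC.
  by rewrite ler_wpM2r ?normc_ge0 // scalerBr scalerK.
move=> hd; apply/cvg_rnorm => e e0.
have [r r0 hr] := hd e e0; apply/nbhs_rnorm; exists r => // h.
rewrite subr0 rnormc => hh h0 /=; rewrite -[h%:A]/(h * 1) mulr1.
have := hr h hh.
rewrite -[X in rnorm X](scalerKV (a := h)) // rnormZ mulrC ler_pM2r ?normc_gt0 //.
by rewrite scalerBr scalerK.
Qed.

Lemma derivable_cderiv (V : normedModType R[i]) (f : R[i]^o -> V) (z : R[i]^o) :
  derivable f z 1 <-> exists d : V, cderiv f z d.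
Proof.
split=> [/cvg_ex[d /cderiv_cvg]|[d /cderiv_cvg hd]]; first by exists d.
by apply/cvg_ex; exists d.
Qed.

Lemma is_derive_cderiv (V : normedModType R[i]) (f : R[i]^o -> V) (z : R[i]^o)
  (d : V) : is_derive z 1 f d -> cderiv f z d.
Proof. by move=> [/cvg_ex[d' hd] <-]; apply/cderiv_cvg; rewrite /derive (cvg_lim _ hd). Qed.

Lemma derivable_continuous (V : normedModType R[i]) (f : R[i]^o -> V)
    (z : R[i]^o) : derivable f z 1 -> {for z, continuous f}.
Proof. by move/derivable1_diffP/differentiable_continuous. Qed.

Lemma continuous_line_h (y : R) : continuous (fun t : R => (t +i* y : R[i]^o)).
Proof.
move=> t; apply/cvg_rnorm => e e0.
apply/nbhs_ballP; exists e => //= s; rewrite /ball /= => /ltW hs; rewrite rnormc.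
have -> : (s +i* y : R[i]) - (t +i* y) = (s - t)%:C.
  by apply/eqP; rewrite eq_complex /= subrr !eqxx.
by rewrite normc_real distrC.
Qed.

Lemma continuous_line_v (x : R) : continuous (fun t : R => (x +i* t : R[i]^o)).
Proof.
move=> t; apply/cvg_rnorm => e e0.
apply/nbhs_ballP; exists e => //= s; rewrite /ball /= => /ltW hs; rewrite rnormc.
have -> : (x +i* s : R[i]) - (x +i* t) = 'i%C * (s - t)%:C.
  by apply/eqP; rewrite eq_complex /=; simpc; rewrite ?subrr ?eqxx.
by rewrite normcM normc_i mul1r normc_real distrC.
Qed.

Lemma continuous_Re : continuous (fun z : R[i]^o => complex.Re z : R).
Proof.
move=> z P /nbhs_ballP[e /= e0 hP]; apply/(@nbhs_rnorm R R[i]^o); exists e => // w.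
rewrite rnormc => hw; apply: hP; apply: le_lt_trans hw; rewrite /ball /= normc_distC -raddfB.
exact: normcRe.
Qed.

Lemma continuous_Im : continuous (fun z : R[i]^o => complex.Im z : R).
Proof.
move=> z P /nbhs_ballP[e /= e0 hP]; apply/(@nbhs_rnorm R R[i]^o); exists e => // w.
rewrite rnormc => hw; apply: hP; apply: le_lt_trans hw; rewrite /ball /= normc_distC -raddfB.
exact: normcIm.
Qed.

End ScalarLimits.

(** * Integrals along segments and rectangles *)

Section RealDerivative.
Variable R : realType.

Lemma is_derive_dir (V : normedModType R) (F : V -> R) (p v : V) (l : R) :
  (forall e : R, 0 < e -> exists2 r : R, 0 < r & forall h, `|h| < r ->
    `|F (h *: v + p) - F p - h * l| <= e * `|h|) -> is_derive p v F l.
Proof.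
move=> hF.
have cv : (fun h => h^-1 *: ((F \o shift p) (h *: v) - F p)) @ 0^' --> l.
  apply/cvgrPdist_le => e e0; have [r r0 hr] := hF e e0.
  apply/nbhs_ballP; exists r => //= h; rewrite /ball /= sub0r normrN => hh h0.
  have := hr h hh; rewrite -[h^-1 *: _]/(h^-1 * _).
  have -> : F (h *: v + p) - F p - h * l = h * (h^-1 * (F (h *: v + p) - F p) - l).
    by rewrite mulrBr mulVKf.
  by rewrite normrM mulrC ler_pM2r ?normr_gt0 // distrC.
split; first by apply/cvg_ex; exists l.
by rewrite /derive (cvg_lim _ cv).
Qed.

Lemma is_derive_real (F : R -> R) (t l : R) :
  (forall e : R, 0 < e -> exists2 r : R, 0 < r & forall h, `|h| < r ->
    `|F (h + t) - F t - h * l| <= e * `|h|) -> is_derive t (1 : R) F l.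
Proof.
move=> hF; apply: is_derive_dir => e /hF[r r0 hr]; exists r => // h.
by rewrite -[h%:A]/(h * 1) mulr1; exact: hr.
Qed.

End RealDerivative.

Section RealIntegral.
Variable R : realType.
Implicit Types (f g : R -> R) (a b c : R).
Local Notation mu := (@lebesgue_measure R).

(** Two-sided continuity at the end points too, so that it restricts to
    subsegments and composes without subspace topologies. *)
Definition cont_seg (V : topologicalType) (g : R -> V) a b :=
  forall t, a <= t <= b -> {for t, continuous g}.

Definition rint g a b : R := Rintegral mu `[a, b] g.

Lemma cont_seg_within g a b : cont_seg g a b -> {within `[a, b], continuous g}.
Proof.
move=> h; apply: continuous_in_subspaceT => t.
by rewrite inE /= in_itv /= => ht; apply: h.
Qed.

Lemma rint_integrable g a b :
  cont_seg g a b -> mu.-integrable `[a, b] (EFin \o g).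
Proof.
move=> h; apply: continuous_compact_integrable; first exact: segment_compact.
exact: cont_seg_within.
Qed.

Lemma rintD f g a b : cont_seg f a b -> cont_seg g a b ->
  rint (fun t => f t + g t) a b = rint f a b + rint g a b.
Proof. by move=> hf hg; apply: RintegralD => //; exact: rint_integrable. Qed.

Lemma rintZ (k : R) g a b : cont_seg g a b ->
  rint (fun t => k * g t) a b = k * rint g a b.
Proof. by move=> hg; apply: RintegralZl => //; exact: rint_integrable. Qed.

Lemma eq_rint f g a b : (forall t, a <= t <= b -> f t = g t) ->
  rint f a b = rint g a b.
Proof.
move=> h; apply: eq_Rintegral => t; rewrite inE /= in_itv /=; exact: h.
Qed.

Lemma rint_split g a b c : a <= c -> c <= b -> cont_seg g a b ->
  rint g a b = rint g a c + rint g c b.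
Proof.
move=> ac cb hg; have ig := rint_integrable hg.
suff <- : rint g a b - rint g a c = rint g c b by rewrite addrC subrK.
rewrite /rint -[RHS]Rintegral_itv_obnd_cbnd.
  by apply: Rintegral_itvB ig _ _; rewrite bnd_simp.
apply: integrableS ig => //.
by move=> t /=; rewrite !in_itv /= => /andP[/ltW h1 ->]; rewrite (le_trans ac h1).
Qed.

Lemma rint_bound g a b (M : R) : a <= b -> cont_seg g a b ->
  (forall t, a <= t <= b -> `|g t| <= M) -> `|rint g a b| <= M * (b - a).
Proof.
move=> ab hg hM; have ig := rint_integrable hg.
apply: le_trans (le_normr_Rintegral _ ig) _ => //.
have cM : cont_seg (fun=> M : R) a b by move=> t _; exact: cvg_cst.
have le1 : \int[mu]_(t in `[a, b]) `|g t| <= rint (fun=> M) a b.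
  apply: le_Rintegral => //.
  - by apply: rint_integrable => t /hg ht; apply: (cvg_norm ht).
  - exact: rint_integrable.
apply: (le_trans le1).
rewrite /rint Rintegral_cst //= lebesgue_measure_itv /= lte_fin.
by case: ltP => // ba; have -> : b = a; [apply/eqP; rewrite eq_le ab ba|rewrite subrr].
Qed.

Lemma rint_FTC g F a b : a <= b -> cont_seg g a b ->
  (forall t, a <= t <= b -> is_derive t (1 : R) F (g t)) ->
  rint g a b = F b - F a.
Proof.
rewrite le_eqVlt => /predU1P[<- _ _|ab hg hF].
  by rewrite subrr /rint set_itv1 Rintegral_set1.
have cF t : a <= t <= b -> {for t, continuous F}.
  move=> /hF[dF _]; apply/differentiable_continuous; exact/derivable1_diffP.
rewrite /rint /Rintegral (@continuous_FTC2 R g F) //.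
- exact: cont_seg_within.
- split.
  + by move=> t; rewrite in_itv /= => /andP[/ltW h1 /ltW h2]; case: (hF t); rewrite ?h1.
  + by apply: cvg_at_right_filter; apply: cF; rewrite lexx ltW.
  + by apply: cvg_at_left_filter; apply: cF; rewrite lexx ltW.
- move=> t; rewrite in_itv /= => /andP[/ltW h1 /ltW h2].
  by rewrite derive1E; have [|_ ->] := hF t; rewrite ?h1.
Qed.

End RealIntegral.

Section ComplexIntegral.
Variable R : realType.
Implicit Types (f g : R -> R[i]^o) (a b c : R) (k : R[i]).
Local Notation rRe f := (fun t => complex.Re (f t)).
Local Notation rIm f := (fun t => complex.Im (f t)).

Definition cint f a b : R[i] :=
  rint (fun t => complex.Re (f t)) a b +i* rint (fun t => complex.Im (f t)) a b.

Lemma cont_segRe f a b : cont_seg f a b -> cont_seg (rRe f) a b.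
Proof. by move=> h t /h ht; apply: continuous_comp ht _; exact: continuous_Re. Qed.

Lemma cont_segIm f a b : cont_seg f a b -> cont_seg (rIm f) a b.
Proof. by move=> h t /h ht; apply: continuous_comp ht _; exact: continuous_Im. Qed.

Lemma cont_segZ k f a b : cont_seg f a b -> cont_seg (fun t => k * f t : R[i]^o) a b.
Proof. by move=> h t /h ht; apply: cvgM ht; exact: cvg_cst. Qed.

Lemma cintD f g a b : cont_seg f a b -> cont_seg g a b ->
  cint (fun t => f t + g t) a b = cint f a b + cint g a b.
Proof.
move=> hf hg; rewrite /cint; apply/eqP; rewrite eq_complex /=.
rewrite -!rintD; try exact: cont_segRe; try exact: cont_segIm.
by apply/andP; split; apply/eqP/eq_rint => t _; rewrite raddfD.
Qed.

Lemma cintZ k f a b : cont_seg f a b ->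
  cint (fun t => k * f t) a b = k * cint f a b.
Proof.
move=> hf; have hr := cont_segRe hf; have hi := cont_segIm hf.
have hz r (h : R -> R) : cont_seg h a b -> cont_seg (fun t => r * h t) a b.
  by move=> hh t /hh ht; apply: cvgM ht; exact: cvg_cst.
case: k => p q; rewrite /cint; apply/eqP; rewrite eq_complex /=.
rewrite -!rintZ // -mulN1r -rintZ -?rintD; try (by apply: hz); try (by apply: (hz (-1)); apply: hz).
apply/andP; split; apply/eqP/eq_rint => t _; case: (f t) => x y /=; first by ring.
by [].
Qed.

Lemma eq_cint f g a b : (forall t, a <= t <= b -> f t = g t) ->
  cint f a b = cint g a b.
Proof. by move=> h; congr (_ +i* _); apply: eq_rint => t /h ->. Qed.

Lemma cint_split f a b c : a <= c -> c <= b -> cont_seg f a b ->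
  cint f a b = cint f a c + cint f c b.
Proof.
move=> ac cb hf; rewrite /cint (rint_split ac cb (cont_segRe hf)).
by rewrite (rint_split ac cb (cont_segIm hf)).
Qed.

Lemma cint_bound f a b (M : R) : a <= b -> cont_seg f a b ->
  (forall t, a <= t <= b -> normc (f t) <= M) ->
  normc (cint f a b) <= 2 * M * (b - a).
Proof.
move=> ab hf hM; apply: (le_trans (normc_le _)); rewrite -mulrA mulr_natl mulr2n.
apply: lerD; apply: rint_bound => //; try exact: cont_segRe; try exact: cont_segIm.
  by move=> t /hM; apply: le_trans; exact: normcRe.
by move=> t /hM; apply: le_trans; exact: normcIm.
Qed.

(** The derivative is taken along the real parameter only, which is what
    composing a holomorphic primitive with a path provides. *)
Lemma cint_FTC f (F : R -> R[i]) a b : a <= b -> cont_seg f a b ->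
  (forall t, a <= t <= b -> forall e : R, 0 < e -> exists2 r : R, 0 < r & forall h : R,
     `|h| < r -> normc (F (h + t) - F t - h%:C * f t) <= e * `|h|) ->
  cint f a b = F b - F a.
Proof.
move=> ab hf hF.
have part (L : R[i] -> R) : (forall x y, L (x - y) = L x - L y) ->
    (forall x, `|L x| <= normc x) -> (forall (r : R) x, L (r%:C * x) = r * L x) ->
    cont_seg (fun t => L (f t)) a b -> rint (fun t => L (f t)) a b = L (F b) - L (F a).
  move=> LB Ln LZ cL; apply: (@rint_FTC _ _ (fun t => L (F t))) => // t ht.
  apply: is_derive_real => e e0; have [r r0 hr] := hF t ht e e0; exists r => // h hh.
  by rewrite -LZ -!LB; exact: le_trans (Ln _) (hr h hh).
apply/eqP; rewrite eq_complex !raddfB /=; apply/andP; split; apply/eqP; apply: part.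
- exact: raddfB.
- exact: normcRe.
- by move=> r [x y] /=; ring.
- exact: cont_segRe.
- exact: raddfB.
- exact: normcIm.
- by move=> r [x y] /=; ring.
- exact: cont_segIm.
Qed.

End ComplexIntegral.

Section Rectangle.
Variable R : realType.
Implicit Types (f g : R[i]^o -> R[i]^o) (a b c d : R) (k z : R[i]).

(** The integral over the boundary of the rectangle [a, b] x [c, d], run
    counterclockwise. *)
Definition oint f a b c d : R[i] :=
  cint (fun t => f (t +i* c)) a b + 'i%C * cint (fun t => f (b +i* t)) c d
  - cint (fun t => f (t +i* d)) a b - 'i%C * cint (fun t => f (a +i* t)) c d.

Definition inrect a b c d z : Prop :=
  a <= complex.Re z <= b /\ c <= complex.Im z <= d.

(** Continuity is required on the boundary only, because Cauchy kernels are
    singular inside. *)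
Definition onbd a b c d z : Prop := inrect a b c d z /\
  ((complex.Re z = a \/ complex.Re z = b) \/ (complex.Im z = c \/ complex.Im z = d)).

Definition bd_cont f a b c d := forall z, onbd a b c d z ->
  {for z : R[i]^o, continuous f}.

Lemma inrect_sub a b c d a' b' c' d' z : a <= a' -> b' <= b -> c <= c' -> d' <= d ->
  inrect a' b' c' d' z -> inrect a b c d z.
Proof.
move=> ha hb hc hd [/andP[h1 h2] /andP[h3 h4]]; split.
  by rewrite (le_trans ha h1) (le_trans h2 hb).
by rewrite (le_trans hc h3) (le_trans h4 hd).
Qed.

Lemma bd_cont_h f a b c d y : c <= d -> bd_cont f a b c d -> y = c \/ y = d ->
  cont_seg (fun t => f (t +i* y)) a b.
Proof.
move=> cd h hy t ht.
apply: (@continuous_comp _ R[i]^o _ (fun t : R => t +i* y) f).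
  exact: continuous_line_h.
by apply: h; split; [split=> //=; case: hy => ->; rewrite lexx cd|right].
Qed.

Lemma bd_cont_v f a b c d x : a <= b -> bd_cont f a b c d -> x = a \/ x = b ->
  cont_seg (fun t => f (x +i* t)) c d.
Proof.
move=> ab h hx t ht.
apply: (@continuous_comp _ R[i]^o _ (fun t : R => x +i* t) f).
  exact: continuous_line_v.
by apply: h; split; [split=> //=; case: hx => ->; rewrite lexx ab|left].
Qed.

Lemma eq_oint f g a b c d : a <= b -> c <= d ->
  (forall z, onbd a b c d z -> f z = g z) -> oint f a b c d = oint g a b c d.
Proof.
move=> ab cd h; rewrite /oint.
by congr (_ + _ * _ - _ - _ * _); apply: eq_cint => t ht; apply: h;
  (split; first (by split; rewrite //= ?lexx ?ab ?cd)); tauto.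
Qed.

Lemma ointD f g a b c d : a <= b -> c <= d ->
  bd_cont f a b c d -> bd_cont g a b c d ->
  oint (fun z => f z + g z) a b c d = oint f a b c d + oint g a b c d.
Proof.
move=> ab cd hf hg.
have hc : c = c \/ c = d by left.
have hd : d = c \/ d = d by right.
have ha : a = a \/ a = b by left.
have hb : b = a \/ b = b by right.
rewrite /oint (cintD (bd_cont_h cd hf hc) (bd_cont_h cd hg hc)).
rewrite (cintD (bd_cont_h cd hf hd) (bd_cont_h cd hg hd)).
rewrite (cintD (bd_cont_v ab hf ha) (bd_cont_v ab hg ha)).
rewrite (cintD (bd_cont_v ab hf hb) (bd_cont_v ab hg hb)).
by ring.
Qed.

Lemma ointZ k f a b c d : a <= b -> c <= d -> bd_cont f a b c d ->
  oint (fun z => k * f z) a b c d = k * oint f a b c d.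
Proof.
move=> ab cd hf.
have hc : c = c \/ c = d by left.
have hd : d = c \/ d = d by right.
have ha : a = a \/ a = b by left.
have hb : b = a \/ b = b by right.
rewrite /oint (cintZ k (bd_cont_h cd hf hc)) (cintZ k (bd_cont_h cd hf hd)).
rewrite (cintZ k (bd_cont_v ab hf ha)) (cintZ k (bd_cont_v ab hf hb)).
by ring.
Qed.

Lemma oint_splitx f a b c d m : a <= m -> m <= b -> c <= d ->
  bd_cont f a b c d -> oint f a b c d = oint f a m c d + oint f m b c d.
Proof.
move=> am mb cd hf; rewrite /oint.
rewrite (cint_split am mb (bd_cont_h cd hf (or_introl (erefl c)))).
rewrite (cint_split am mb (bd_cont_h cd hf (or_intror (erefl d)))).
by ring.
Qed.

Lemma oint_splity f a b c d m : c <= m -> m <= d -> a <= b ->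
  bd_cont f a b c d -> oint f a b c d = oint f a b c m + oint f a b m d.
Proof.
move=> cm md ab hf; rewrite /oint.
rewrite (cint_split cm md (bd_cont_v ab hf (or_introl (erefl a)))).
rewrite (cint_split cm md (bd_cont_v ab hf (or_intror (erefl b)))).
by ring.
Qed.

Lemma oint_bound f a b c d (M : R) : a <= b -> c <= d -> bd_cont f a b c d ->
  (forall z, onbd a b c d z -> normc (f z) <= M) ->
  normc (oint f a b c d) <= 4 * M * ((b - a) + (d - c)).
Proof.
move=> ab cd hf hM.
have h1 y : y = c \/ y = d -> normc (cint (fun t => f (t +i* y)) a b) <= 2 * M * (b - a).
  move=> hy; apply: cint_bound => //; first exact: bd_cont_h hf hy.
  move=> t ht; apply: hM; split; last by right.
  by split=> //=; case: hy => ->; rewrite lexx cd.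
have h2 x : x = a \/ x = b -> normc (cint (fun t => f (x +i* t)) c d) <= 2 * M * (d - c).
  move=> hx; apply: cint_bound => //; first exact: bd_cont_v hf hx.
  move=> t ht; apply: hM; split; last by left.
  by split=> //=; case: hx => ->; rewrite lexx ab.
apply: (@le_trans _ _ (2 * M * (b - a) + 2 * M * (d - c) + 2 * M * (b - a)
  + 2 * M * (d - c))); last by lra.
apply: (le_trans (normc_sub _ _)); apply: lerD; last first.
  by rewrite normcM normc_i mul1r h2 //; auto.
apply: (le_trans (normc_sub _ _)); apply: lerD; last by rewrite h1 //; auto.
apply: (le_trans (normc_add _ _)); apply: lerD; first by rewrite h1 //; auto.
by rewrite normcM normc_i mul1r h2 //; auto.
Qed.

Lemma oint_FTC f g a b c d : a <= b -> c <= d -> bd_cont g a b c d ->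
  (forall z, onbd a b c d z -> cderiv f z (g z)) -> oint g a b c d = 0.
Proof.
move=> ab cd hg hf.
have hor y : y = c \/ y = d ->
    cint (fun t => g (t +i* y)) a b = f (b +i* y) - f (a +i* y).
  move=> hy; apply: (@cint_FTC _ _ (fun t => f (t +i* y))) => // [|t ht e e0].
    exact: bd_cont_h cd hg hy.
  have hb : onbd a b c d (t +i* y).
    split; last by right.
    by split=> //=; case: hy => ->; rewrite lexx cd.
  have [r r0 hr] := hf _ hb e e0; exists r => // h hh.
  have := hr h%:C; rewrite rnormc normc_real -[_ *: g _]/(_ * g _) => /(_ hh).
  suff -> : h%:C + (t +i* y) = (h + t) +i* y :> R[i] by [].
  by apply/eqP; rewrite eq_complex /= add0r !eqxx.
have ver x : x = a \/ x = b ->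
    'i%C * cint (fun t => g (x +i* t)) c d = f (x +i* d) - f (x +i* c).
  move=> hx; have hc := bd_cont_v ab hg hx; rewrite -(cintZ 'i%C hc).
  apply: (@cint_FTC _ _ (fun t => f (x +i* t)) c d cd (cont_segZ hc)) => t ht e e0.
  have hb : onbd a b c d (x +i* t).
    split; last by left.
    by split=> //=; case: hx => ->; rewrite lexx ab.
  have [r r0 hr] := hf _ hb e e0; exists r => // h hh.
  have := hr (h%:C * 'i%C); rewrite rnormc normcM normc_real normc_i mulr1.
  rewrite -[_ *: g _]/(_ * g _) -mulrA => /(_ hh).
  suff -> : h%:C * 'i%C + (x +i* t) = x +i* (h + t) :> R[i] by [].
  by apply/eqP; rewrite eq_complex /=; simpc.
rewrite /oint !hor ?ver; auto.
by ring.
Qed.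

End Rectangle.

(** * Goursat's theorem *)

Section Goursat.
Variable R : realType.
Implicit Types (f g : R[i]^o -> R[i]^o) (a b c d : R) (k z p : R[i]).

Lemma rect_bd_cont f a b c d a' b' c' d' :
  a <= a' -> b' <= b -> c <= c' -> d' <= d ->
  (forall z, inrect a b c d z -> {for z : R[i]^o, continuous f}) ->
  bd_cont f a' b' c' d'.
Proof. by move=> h1 h2 h3 h4 h z [hz _]; apply: h; exact: inrect_sub hz. Qed.

Lemma continuous_forD f g z : {for z : R[i]^o, continuous f} ->
  {for z : R[i]^o, continuous g} ->
  {for z : R[i]^o, continuous ((fun y => f y + g y) : R[i]^o -> R[i]^o)}.
Proof. by move=> hf hg; exact: (cvgD hf hg). Qed.

Lemma continuous_forM f g z : {for z : R[i]^o, continuous f} ->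
  {for z : R[i]^o, continuous g} ->
  {for z : R[i]^o, continuous ((fun y => f y * g y) : R[i]^o -> R[i]^o)}.
Proof. by move=> hf hg; exact: (cvgM hf hg). Qed.

Lemma continuous_affine k0 k1 p :
  continuous ((fun z => k0 + (z - p) * k1) : R[i]^o -> R[i]^o).
Proof.
move=> z; apply/derivable_continuous/derivable_cderiv; exists k1 => e e0.
exists 1 => // h _; rewrite -[h *: _]/(h * _).
have -> : k0 + (h + z - p) * k1 - (k0 + (z - p) * k1) - h * k1 = 0 by ring.
by rewrite rnorm0 mulr_ge0 ?normc_ge0 // ltW.
Qed.

Lemma oint_affine k0 k1 p a b c d : a <= b -> c <= d ->
  oint (fun z => k0 + (z - p) * k1) a b c d = 0.
Proof.
move=> ab cd.
apply: (@oint_FTC _ (fun z => z * k0 + (z - p) ^+ 2 * (k1 / 2))) => //.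
  by move=> z _; exact: continuous_affine.
move=> z _ e e0; exists (e / (normc (k1 / 2) + 1)).
  by rewrite divr_gt0 // ltr_wpDl // normc_ge0.
move=> h hh; rewrite rnormc -[h *: _]/(h * _).
have -> : (h + z) * k0 + (h + z - p) ^+ 2 * (k1 / 2) -
  (z * k0 + (z - p) ^+ 2 * (k1 / 2)) - h * (k0 + (z - p) * k1) = h * (h * (k1 / 2)).
  by field.
rewrite !normcM mulrC ler_wpM2r ?normc_ge0 // -!normcM.
move: hh; rewrite ltr_pdivlMr ?ltr_wpDl ?normc_ge0 // => /ltW; apply: le_trans.
by rewrite normcM ler_wpM2l ?normc_ge0 // lerDl.
Qed.

(** The left ends increase and stay below every right end; their supremum is
    the point. *)
Lemma nested_point (l u : nat -> R) :
  (forall n, l n <= l n.+1) -> (forall n, u n.+1 <= u n) ->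
  (forall n, l n <= u n) -> exists p : R, forall n, l n <= p <= u n.
Proof.
move=> hl hu hlu.
have ml m n : (m <= n)%N -> l m <= l n.
  elim: n => [|n IH]; first by rewrite leqn0 => /eqP ->.
  by rewrite leq_eqVlt ltnS => /predU1P[->//|/IH /le_trans]; apply.
have mu m n : (m <= n)%N -> u n <= u m.
  elim: n => [|n IH]; first by rewrite leqn0 => /eqP ->.
  by rewrite leq_eqVlt ltnS => /predU1P[->//|/IH]; apply: le_trans.
have lu m n : l m <= u n.
  have [/ml h|/ltnW/mu h] := leqP m n; first exact: le_trans h (hlu n).
  exact: le_trans (hlu m) h.
exists (sup (range l)) => n; apply/andP; split.
  apply: ub_le_sup; last by exists n.
  by exists (u 0%N) => _ [m _ <-].
apply: ge_sup; first by exists (l 0%N); exists 0%N.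
by move=> _ [m _ <-].
Qed.

(** The integrals over the four quarters add up, so they cannot all be small. *)
Lemma goursat_quarter f a b c d : a <= b -> c <= d ->
  (forall z, inrect a b c d z -> {for z : R[i]^o, continuous f}) ->
  exists a' b' c' d', [/\ a <= a', b' <= b, c <= c' & d' <= d] /\
    [/\ a' <= b', c' <= d', b' - a' = (b - a) / 2, d' - c' = (d - c) / 2 &
      normc (oint f a b c d) <= 4 * normc (oint f a' b' c' d')].
Proof.
move=> ab cd hf; pose m := (a + b) / 2; pose n := (c + d) / 2.
have am : a <= m by rewrite /m; lra.
have mb : m <= b by rewrite /m; lra.
have cn : c <= n by rewrite /n; lra.
have nd : n <= d by rewrite /n; lra.
have w1 : m - a = (b - a) / 2 by rewrite /m; field.
have w2 : b - m = (b - a) / 2 by rewrite /m; field.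
have w3 : n - c = (d - c) / 2 by rewrite /n; field.
have w4 : d - n = (d - c) / 2 by rewrite /n; field.
have E : oint f a b c d = oint f a m c n + oint f a m n d
    + (oint f m b c n + oint f m b n d).
  rewrite (oint_splitx am mb cd); last exact: rect_bd_cont hf.
  rewrite (oint_splity cn nd am); last exact: rect_bd_cont hf.
  by rewrite (oint_splity cn nd mb) //; exact: rect_bd_cont hf.
have : normc (oint f a b c d) <= normc (oint f a m c n) + normc (oint f a m n d)
    + (normc (oint f m b c n) + normc (oint f m b n d)).
  rewrite E; apply: (le_trans (normc_add _ _)).
  by apply: lerD; exact: normc_add.
set N := normc (oint f a b c d) => hN.
have [h1|h1] := leP N (4 * normc (oint f a m c n)).
  by exists a, m, c, n; split; split; rewrite ?lexx.
have [h2|h2] := leP N (4 * normc (oint f a m n d)).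
  by exists a, m, n, d; split; split; rewrite ?lexx.
have [h3|h3] := leP N (4 * normc (oint f m b c n)).
  by exists m, b, c, n; split; split; rewrite ?lexx.
exists m, b, n, d; split; split; rewrite ?lexx //.
by move: N hN h1 h2 h3 => N; clear; lra.
Qed.

Lemma normc_inrect a b c d p z : inrect a b c d z -> inrect a b c d p ->
  normc (z - p) <= (b - a) + (d - c).
Proof.
move=> [/andP[h1 h2] /andP[h3 h4]] [/andP[h5 h6] /andP[h7 h8]].
apply: (le_trans (normc_le _)); rewrite !raddfB /=.
by apply: lerD; rewrite ler_norml; apply/andP; split; lra.
Qed.

(** Bisection produces nested rectangles of size [2^-n] whose integrals decay
    at most like [4^-n].  At their common point the affine part of [f] has a
    primitive, and the remainder is [o(2^-n)] on a boundary of length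
    [O(2^-n)]. *)
Theorem goursat f a b c d : a <= b -> c <= d ->
  (forall z, inrect a b c d z -> derivable f z 1) -> oint f a b c d = 0.
Proof.
move=> ab cd hf.
have cf z : inrect a b c d z -> {for z : R[i]^o, continuous f}.
  by move=> /hf /derivable_continuous.
pose good (q : (R * R) * (R * R)) :=
  [/\ a <= q.1.1, q.1.2 <= b, c <= q.2.1 & q.2.2 <= d] /\
  q.1.1 <= q.1.2 /\ q.2.1 <= q.2.2.
pose I (q : (R * R) * (R * R)) := normc (oint f q.1.1 q.1.2 q.2.1 q.2.2).
pose sub (q q' : (R * R) * (R * R)) := good q ->
   [/\ q.1.1 <= q'.1.1, q'.1.2 <= q.1.2,
       q.2.1 <= q'.2.1 & q'.2.2 <= q.2.2] /\
   [/\ good q', q'.1.2 - q'.1.1 = (q.1.2 - q.1.1) / 2,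
    q'.2.2 - q'.2.1 = (q.2.2 - q.2.1) / 2 & I q <= 4 * I q'].
have /choice[next hnext] : forall q, exists q', sub q q'.
  move=> q.
  have [hq|nq] := pselect (good q); last by exists q.
  have [[h1 h2 h3 h4] [h5 h6]] := hq.
  have [|a' [b' [c' [d' [[k1 k2 k3 k4] [k5 k6 k7 k8 k9]]]]]] := @goursat_quarter f _ _ _ _ h5 h6.
    by move=> z hz; apply: cf; exact: inrect_sub hz.
  exists ((a', b'), (c', d')) => _; split; split => //; split => //.
  split; [exact: le_trans k1|exact: le_trans h2|exact: le_trans k3|exact: le_trans h4].
pose q0 := ((a, b), (c, d)); pose q n := iter n next q0.
have gq n : good (q n).
  elim: n => [|n IH]; first by do !split => /=; rewrite ?lexx.
  by have [_ []] := hnext _ IH.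
have wx n : (q n).1.2 - (q n).1.1 = (b - a) / 2 ^+ n.
  elim: n => [|n IH]; first by rewrite divr1.
  by have [_ [_ /= -> _ _]] := hnext _ (gq n); rewrite IH exprSr invfM mulrA.
have wy n : (q n).2.2 - (q n).2.1 = (d - c) / 2 ^+ n.
  elim: n => [|n IH]; first by rewrite divr1.
  by have [_ [_ _ /= -> _]] := hnext _ (gq n); rewrite IH exprSr invfM mulrA.
have hI n : I q0 <= 4 ^+ n * I (q n).
  elim: n => [|n IH]; first by rewrite mul1r.
  have [_ [_ _ _ h]] := hnext _ (gq n); apply: (le_trans IH).
  by rewrite exprSr -mulrA ler_wpM2l // exprn_ge0.
have [px hpx] : exists p : R, forall n, (q n).1.1 <= p <= (q n).1.2.
  by apply: nested_point => n; have [[? ? ? ?] _] := hnext _ (gq n); have [_ []] := gq n.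
have [py hpy] : exists p : R, forall n, (q n).2.1 <= p <= (q n).2.2.
  by apply: nested_point => n; have [[? ? ? ?] _] := hnext _ (gq n); have [_ []] := gq n.
pose p := px +i* py.
have hp : inrect a b c d p by split; [exact: (hpx 0%N)|exact: (hpy 0%N)].
have /derivable_cderiv[l hl] := hf p hp.
pose S := (b - a) + (d - c).
have S0 : 0 <= S by rewrite /S; lra.
apply: (@normc_small_eq0 _ _ (4 * S ^+ 2)) => e e0.
have [r r0 hr] := hl e e0.
have [n hn] : exists n, S / 2 ^+ n < r.
  have r2 : 0 < r / 2 by rewrite divr_gt0.
  have [n /(_ n (leqnn n)) h] := half_pow_small S r2.
  by exists n; apply: (le_lt_trans h); lra.
have [[h1 h2 h3 h4] [h5 h6]] := gq n.
have bdc g : (forall z, inrect a b c d z -> {for z : R[i]^o, continuous g}) ->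
    bd_cont g (q n).1.1 (q n).1.2 (q n).2.1 (q n).2.2.
  by move=> hg; exact: rect_bd_cont hg.
pose rem := (fun z : R[i]^o => f z + (- f p + (z - p) * - l)) : R[i]^o -> R[i]^o.
have crem z : inrect a b c d z -> {for z : R[i]^o, continuous rem}.
  by move=> hz; apply: continuous_forD; [exact: cf|exact: continuous_affine].
(* Only the first order remainder of [f] at [p] contributes to the integral. *)
have Erem : oint f (q n).1.1 (q n).1.2 (q n).2.1 (q n).2.2
  = oint rem (q n).1.1 (q n).1.2 (q n).2.1 (q n).2.2.
  rewrite /rem ointD ?oint_affine ?addr0 //; first exact: bdc.
  by apply: bdc => z _; exact: continuous_affine.
have brem : normc (oint rem (q n).1.1 (q n).1.2 (q n).2.1 (q n).2.2)
   <= 4 * (e * (S / 2 ^+ n)) * (S / 2 ^+ n).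
  have -> : S / 2 ^+ n = ((q n).1.2 - (q n).1.1) + ((q n).2.2 - (q n).2.1).
    by rewrite wx wy -mulrDl.
  apply: oint_bound => //; first exact: bdc.
  move=> z [hz _]; have pq : inrect (q n).1.1 (q n).1.2 (q n).2.1 (q n).2.2 p by [].
  have := normc_inrect hz pq; set w := _ + (_ - _) => hw.
  have wE : w = S / 2 ^+ n by rewrite /w wx wy -mulrDl.
  have := hr (z - p); rewrite subrK => /(_ _) hle.
  have -> : rem z = f z - f p - (z - p) *: (l : R[i]^o).
    by rewrite /rem -[_ *: _]/(_ * _); ring.
  apply: le_trans (hle _) _; first by rewrite (le_lt_trans hw) // wE.
  by rewrite ler_wpM2l // ltW.
apply: (le_trans (hI n)); rewrite /I Erem.
apply: (le_trans (ler_wpM2l _ brem)); first exact: exprn_ge0.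
have -> : (4 : R) ^+ n = 2 ^+ n * 2 ^+ n by rewrite -exprMn -natrM.
have t0 : (2 : R) ^+ n != 0 by rewrite expf_neq0.
by rewrite le_eqVlt; apply/orP; left; apply/eqP; field; exact: t0.
Qed.

End Goursat.

Section GoursatPunctured.
Variable R : realType.
Implicit Types (f g : R[i]^o -> R[i]^o) (a b c d : R) (k z p : R[i]).

(** The rectangles left and right of a small square around [p], then those
    below and above it, contribute nothing by Goursat's theorem.  The square
    itself contributes at most the bound [M] times its perimeter.  This is how
    difference quotients, which are singular at one point, get integrated. *)
Lemma goursat_punctured f a b c d p (M r : R) :
  a < complex.Re p -> complex.Re p < b -> c < complex.Im p -> complex.Im p < d ->
  (forall z, inrect a b c d z -> z != p -> derivable f z 1) ->
  0 < r -> (forall z, z != p -> normc (z - p) < r -> normc (f z) <= M) ->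
  oint f a b c d = 0.
Proof.
move=> ax xb cy yd hf r0 hM; set x := complex.Re p; set y := complex.Im p.
have cf z : inrect a b c d z -> z != p -> {for z : R[i]^o, continuous f}.
  by move=> h1 h2; exact/derivable_continuous/hf.
have cfb a' b' c' d' : a <= a' -> b' <= b -> c <= c' -> d' <= d ->
    ~ onbd a' b' c' d' p -> bd_cont f a' b' c' d'.
  move=> h1 h2 h3 h4 hp z hz; apply: cf; first by case: hz => hz _; exact: inrect_sub hz.
  by apply/eqP => zp; apply: hp; rewrite -zp.
have gz a' b' c' d' : a <= a' -> a' <= b' -> b' <= b -> c <= c' -> c' <= d' ->
    d' <= d -> ~ inrect a' b' c' d' p -> oint f a' b' c' d' = 0.
  move=> h1 h2 h3 h4 h5 h6 hp; apply: goursat => // z hz.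
  apply: hf; first exact: inrect_sub hz.
  by apply/eqP => zp; apply: hp; rewrite -zp.
have M0 : 0 <= M.
  apply: le_trans (normc_ge0 (f (p + (r / 2)%:C))) (hM _ _ _).
    by rewrite -subr_eq0 addrAC subrr add0r -normc_gt0 normc_real normr_gt0 gt_eqF ?divr_gt0.
  rewrite addrAC subrr add0r normc_real gtr0_norm ?divr_gt0 //.
  by rewrite ltr_pdivrMr // ltr_pMr // ltr1n.
apply: (@normc_small_eq0 _ _ (16 * M)) => e e0.
pose s := Num.min e (Num.min (r / 5) (Num.min (Num.min (x - a) (b - x)) (Num.min (y - c) (d - y)))).
have s0 : 0 < s by rewrite /s !lt_min e0 divr_gt0 // !subr_gt0 ax xb cy yd.
have [se sr [sa sb] [sc sd]] : [/\ s <= e, s <= r / 5, s <= x - a /\ s <= b - x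
   & s <= y - c /\ s <= d - y].
  by have := lexx s; rewrite {2}/s !le_min => /andP[-> /andP[-> /andP[/andP[-> ->] /andP[-> ->]]]].
have Re1 : x = complex.Re p by []. have Im1 : y = complex.Im p by [].
have E : oint f a b c d = oint f (x - s) (x + s) (y - s) (y + s).
  rewrite (@oint_splitx _ f a b c d (x - s)); [|lra|lra|lra|]; last first.
    by apply: cfb => // -[_ [] []]; rewrite -?Re1 -?Im1; lra.
  rewrite (gz a (x - s)); [|lra|lra|lra|lra|lra|lra|]; last first.
    by case; rewrite -?Re1 => /andP[_]; lra.
  rewrite add0r (@oint_splitx _ f (x - s) b c d (x + s)); [|lra|lra|lra|]; last first.
    by apply: cfb => // [|[_ [] []]]; rewrite -?Re1 -?Im1; lra.
  rewrite (gz (x + s) b); [|lra|lra|lra|lra|lra|lra|]; last first.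
    by case; rewrite -?Re1 => /andP[]; lra.
  rewrite addr0 (@oint_splity _ f _ _ c d (y - s)); [|lra|lra|lra|]; last first.
    by apply: cfb => // [||[_ [] []]]; rewrite -?Re1 -?Im1; lra.
  rewrite (gz (x - s) (x + s) c (y - s)); [|lra|lra|lra|lra|lra|lra|]; last first.
    by case; rewrite -?Re1 -?Im1 => _ /andP[_]; lra.
  rewrite add0r (@oint_splity _ f _ _ (y - s) d (y + s)); [|lra|lra|lra|]; last first.
    by apply: cfb => // [|||[_ [] []]]; rewrite -?Re1 -?Im1; lra.
  rewrite (gz (x - s) (x + s) (y + s) d); [|lra|lra|lra|lra|lra|lra|]; last first.
    by case; rewrite -?Re1 -?Im1 => _ /andP[]; lra.
  by rewrite addr0.
have np : ~ onbd (x - s) (x + s) (y - s) (y + s) p.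
  by case=> _ [] []; rewrite -?Re1 -?Im1; lra.
rewrite E; apply: le_trans (@oint_bound _ _ _ _ _ _ M _ _ _ _) _; [lra|lra| | |].
- by apply: cfb => //; lra.
- move=> z hz; apply: hM; first by apply/eqP => zp; apply: np; rewrite -zp.
  case: hz => hz _; have hp : inrect (x - s) (x + s) (y - s) (y + s) p.
    by split; rewrite -?Re1 -?Im1; lra.
  by have := normc_inrect hz hp; lra.
- have -> : 4 * M * (x + s - (x - s) + (y + s - (y - s))) = 16 * M * s by ring.
  by rewrite ler_wpM2l // mulr_ge0.
Qed.

End GoursatPunctured.


(** * Cauchy's power series expansion *)

Section CauchySeries.
Variable R : realType.
Implicit Types (f g : R[i]^o -> R[i]^o) (k z w : R[i]).
Local Notation sq f := (oint f (-2) 2 (-2) 2).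
Local Notation bd := (@onbd R (-2) 2 (-2) 2).

Lemma bd_normc w : bd w -> 2 <= normc w.
Proof.
have h t : t = -2 \/ t = 2 -> `|t| = 2 :> R.
  by case=> ->; rewrite ?normrN ger0_norm.
case=> _ [] /h <-; [exact: normcRe|exact: normcIm].
Qed.

Lemma sq_normc w : inrect (-2) 2 (-2) 2 w -> normc w < 3.
Proof.
move=> [/andP[h1 h2] /andP[h3 h4]].
rewrite -(ltr_pXn2r (n := 2)) ?nnegrE ?normc_ge0 // normc_sqr; nra.
Qed.

Lemma continuous_normc : continuous (fun z : R[i]^o => normc z : R).
Proof.
move=> z P /nbhs_ballP[e /= e0 hP]; apply/(@nbhs_rnorm R R[i]^o); exists e => // w.
rewrite rnormc => hw; apply: hP; apply: le_lt_trans hw; rewrite /ball /=.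
have h (x y : R[i]) : normc x - normc y <= normc (x - y).
  by rewrite lerBlDr -{1}(subrK y x) normc_add.
by rewrite ler_norml lerNl opprB h normc_distC h.
Qed.

Lemma bd_bounded f : bd_cont f (-2) 2 (-2) 2 ->
  exists2 M : R, 0 <= M & forall w, bd w -> normc (f w) <= M.
Proof.
move=> hf; have h22 : (-2 : R) <= 2 by lra.
have side (u : R -> R[i]) : cont_seg (fun t => f (u t)) (-2) 2 ->
    exists M : R, forall t, -2 <= t <= 2 -> normc (f (u t)) <= M.
  move=> hu; have [|c _ hc] := @EVT_max R (fun t => normc (f (u t))) (-2) 2 h22.
    apply: cont_seg_within => t /hu ht.
    by apply: continuous_comp ht _; exact: continuous_normc.
  by exists (normc (f (u c))) => t ht; apply: hc; rewrite in_itv.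
have [M1 h1] := side _ (bd_cont_h h22 hf (or_introl (erefl _))).
have [M2 h2] := side _ (bd_cont_h h22 hf (or_intror (erefl _))).
have [M3 h3] := side _ (bd_cont_v h22 hf (or_introl (erefl _))).
have [M4 h4] := side _ (bd_cont_v h22 hf (or_intror (erefl _))).
have le0 M (u : R -> R[i]) : (forall t, -2 <= t <= 2 -> normc (f (u t)) <= M) -> 0 <= M.
  move=> h; apply: le_trans (normc_ge0 _) (h 0 _); lra.
have M10 := le0 _ _ h1; have M20 := le0 _ _ h2.
have M30 := le0 _ _ h3; have M40 := le0 _ _ h4.
exists (M1 + M2 + M3 + M4); first by rewrite !addr_ge0.
case=> x y [[hx hy]] /= [] [] e; rewrite e in hx hy *.
- by have := h3 y hy; lra.
- by have := h4 y hy; lra.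
- by have := h1 x hx; lra.
- by have := h2 x hx; lra.
Qed.

Lemma rint_lbound (g : R -> R) (a b M : R) : a <= b -> cont_seg g a b ->
  (forall t, a <= t <= b -> M <= g t) -> M * (b - a) <= rint g a b.
Proof.
move=> ab hg hM.
have cM : cont_seg (fun=> M : R) a b by move=> t _; exact: cvg_cst.
have -> : M * (b - a) = rint (fun=> M) a b.
  rewrite /rint Rintegral_cst //= lebesgue_measure_itv /= lte_fin.
  by case: ltP => // ba; have -> : b = a; [apply/eqP; rewrite eq_le ab ba|rewrite subrr].
apply: le_Rintegral => //; try exact: rint_integrable.
Qed.

(** The powers [w^-k] with [k >= 2] have primitives; this leaves [1 / w] as the
    only one whose integral around the origin may be nonzero. *)
Lemma derivable_invX n w : w != 0 ->
  cderiv (fun z : R[i]^o => - (n.+1%:R)^-1 * (z^-1) ^+ n.+1 : R[i]^o) w (w^-1 ^+ n.+2).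
Proof.
move=> w0; apply: is_derive_cderiv.
have dV : is_derive (w : R[i]^o) (1 : R[i]^o) ((fun z : R[i]^o => z^-1) : R[i]^o -> R[i]^o) (- w ^- 2).
  have hd : derivable (id : R[i]^o -> R[i]^o) w 1 by exact: derivable_id.
  split; first exact: (derivableV (f := (id : R[i]^o -> R[i]^o))).
  rewrite (deriveV (f := (id : R[i]^o -> R[i]^o))) // derive_id.
  by rewrite -[_ *: _]/(_ * _) mulr1.
have -> : (fun z : R[i]^o => - (n.+1%:R)^-1 * (z^-1) ^+ n.+1 : R[i]^o) =
   (- (n.+1%:R)^-1 : R[i]) \*: ((fun z : R[i]^o => z^-1 : R[i]^o) ^+ n.+1).
  by apply/funext => z; rewrite /= exprfctE.
apply: is_derive_eq; rewrite /= -![_ *: _]/(_ * _).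
have n0 : n.+1%:R != 0 :> R[i] by rewrite pnatr_eq0.
rewrite !exprS exprVn; move: (n.+1%:R : R[i]) n0 => k k0; field.
by rewrite w0 expf_neq0 // k0.
Qed.

End CauchySeries.

Section CauchySeriesMain.
Variable R : realType.
Implicit Types (f g : R[i]^o -> R[i]^o) (k z w : R[i]).
Local Notation sq f := (@oint R f (-2) 2 (-2) 2).
Local Notation bd := (@onbd R (-2) 2 (-2) 2).
Local Notation bdc f := (@bd_cont R f (-2) 2 (-2) 2).

Let h22 : (-2 : R) <= 2. Proof. by lra. Qed.

Lemma bd_neq0 w : bd w -> w != 0.
Proof. by move=> /bd_normc h; rewrite -normc_gt0 (lt_le_trans _ h). Qed.

Lemma bd_sub z w : normc z <= 1 -> bd w -> 1 <= normc (w - z).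
Proof.
move=> hz /bd_normc hw.
have := normc_add (w - z) z; rewrite subrK => h; lra.
Qed.

Lemma bd_sub_neq0 z w : normc z <= 1 -> bd w -> w - z != 0.
Proof. by move=> hz hw; rewrite -normc_gt0 (lt_le_trans _ (bd_sub hz hw)). Qed.

Lemma bdcM f g : bdc f -> bdc g -> bdc (fun w => f w * g w).
Proof. by move=> hf hg w hw; exact: continuous_forM (hf w hw) (hg w hw). Qed.

Lemma bdcV g : (forall w, bd w -> g w != 0) -> bdc g -> bdc (fun w => (g w)^-1).
Proof. by move=> h0 hg w hw; exact: (cvgV (h0 w hw) (hg w hw)). Qed.

Lemma bdcC k : bdc (fun=> k).
Proof. by move=> w _; exact: (@cst_continuous R[i]^o R[i]^o k w). Qed.

Lemma eq_bdc f g : f =1 g -> bdc f -> bdc g.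
Proof. by move=> /funext ->. Qed.

Lemma bdc_subX z : bdc (fun w => w - z).
Proof.
apply: (@eq_bdc (fun w => 0 + (w - z) * 1)) => [w|]; first by rewrite add0r mulr1.
by move=> w _; exact: continuous_affine.
Qed.

Lemma bdcX g n : bdc g -> bdc (fun w => g w ^+ n).
Proof.
move=> hg; elim: n => [|n IH]; first exact: bdcC.
apply: (@eq_bdc (fun w => g w * g w ^+ n)) => [w|]; first by rewrite exprS.
exact: bdcM.
Qed.

Lemma bdc_inv : bdc (fun w => w^-1).
Proof.
apply: bdcV; first exact: bd_neq0.
by apply: (@eq_bdc (fun w => w - 0)) => [w|]; [rewrite subr0|exact: bdc_subX].
Qed.

Lemma bdc_ker z : normc z <= 1 -> bdc (fun w => (w - z)^-1).
Proof.
by move=> hz; apply: bdcV; [move=> w; exact: bd_sub_neq0|exact: bdc_subX].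
Qed.

(** Up to the factor [winding], the Taylor coefficients of [f] at the origin. *)
Definition laurent f n := sq (fun w => f w * w^-1 ^+ n.+1).

(** Finite geometric sum for the kernel [1 / (w - z)]. *)
Lemma cauchy_expand f z K : bdc f -> normc z <= 1 ->
  sq (fun w => f w * (w - z)^-1) = \sum_(i < K) laurent f i * z ^+ i
    + sq (fun w => f w * ((z * w^-1) ^+ K * (w - z)^-1)).
Proof.
move=> hf hz; elim: K => [|K ->].
  rewrite big_ord0 add0r; apply: eq_oint => // w _.
  by rewrite expr0 mul1r.
rewrite big_ord_recr /= -addrA; congr (_ + _).
have cz : bdc (fun w => z * w^-1) by exact: (bdcM (bdcC (k := z)) bdc_inv).
have c1 : bdc (fun w => f w * w^-1 ^+ K.+1).
  exact: (bdcM hf (bdcX (n := K.+1) bdc_inv)).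
have c2 : bdc (fun w => z ^+ K * (f w * w^-1 ^+ K.+1)).
  exact: (bdcM (bdcC (k := (z ^+ K))) c1).
have c3 : bdc (fun w => f w * ((z * w^-1) ^+ K.+1 * (w - z)^-1)).
  exact: (bdcM hf (bdcM (bdcX (n := K.+1) cz) (bdc_ker hz))).
rewrite /laurent mulrC -(ointZ (z ^+ K) h22 h22 c1) -(ointD h22 h22 c2 c3).
apply: eq_oint => // w hw; have w0 := bd_neq0 hw; have wz := bd_sub_neq0 hz hw.
  rewrite !exprMn !exprS !exprVn; field.
  by rewrite wz w0 expf_neq0.
Qed.

(** On the square of half-side 2 the ratio [z / w] has modulus at most 1/2. *)
Lemma cauchy_remainder f z (M : R) K : bdc f -> normc z <= 1 ->
  (forall w, bd w -> normc (f w) <= M) -> 0 <= M ->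
  normc (sq (fun w => f w * ((z * w^-1) ^+ K * (w - z)^-1))) <= 32 * M / 2 ^+ K.
Proof.
move=> hf hz hM M0.
have cz : bdc (fun w => z * w^-1) by exact: (bdcM (bdcC (k := z)) bdc_inv).
have cc : bdc (fun w => f w * ((z * w^-1) ^+ K * (w - z)^-1)).
  exact: (bdcM hf (bdcM (bdcX (n := K) cz) (bdc_ker hz))).
have hb w : bd w -> normc (f w * ((z * w^-1) ^+ K * (w - z)^-1)) <= M / 2 ^+ K.
  move=> hw; rewrite !normcM normcX normcM !normcV.
  have w2 := bd_normc hw; have wz1 := bd_sub hz hw.
  have w0 : 0 < normc w by lra.
  have q1 : (normc z / normc w) ^+ K <= (2^-1) ^+ K.
    apply: lerXn2r; rewrite ?nnegrE ?divr_ge0 ?normc_ge0 //.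
    by rewrite ler_pdivrMr //; lra.
  have q2 : (normc (w - z))^-1 <= 1 by rewrite invf_le1 // (lt_le_trans _ wz1).
  apply: ler_pM; rewrite ?hM ?mulr_ge0 ?invr_ge0 ?exprn_ge0 ?divr_ge0 ?normc_ge0 //.
  rewrite -[leRHS]mulr1 -exprVn; apply: ler_pM => //.
    by rewrite exprn_ge0 ?divr_ge0 ?normc_ge0.
  by rewrite invr_ge0 normc_ge0.
apply: (le_trans (oint_bound h22 h22 cc hb)).
by rewrite le_eqVlt; apply/orP; left; apply/eqP; ring.
Qed.

(** This is [2 pi i]. *)
Definition winding : R[i] := sq (fun w => w^-1).

Lemma laurent1 n : laurent (fun=> 1) n.+1 = 0.
Proof.
rewrite /laurent; have -> : sq (fun w => 1 * w^-1 ^+ n.+2) = sq (fun w => w^-1 ^+ n.+2).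
  by apply: eq_oint => // w _; rewrite mul1r.
apply: oint_FTC => //; first by apply: bdcX; exact: bdc_inv.
by move=> w hw; exact: derivable_invX (bd_neq0 hw).
Qed.

(** Expanding the kernel, all terms but the first are integrals of powers that
    have primitives. *)
Lemma winding_disc z : normc z <= 1 -> sq (fun w => 1 * (w - z)^-1) = winding.
Proof.
move=> hz; apply/eqP; rewrite -subr_eq0 -normc_eq0.
have hb w : bd w -> normc (1 : R[i]) <= 1 by rewrite normc1.
have l0 : laurent (fun=> 1) 0 = winding.
  by apply: eq_oint => // w _; rewrite mul1r expr1.
rewrite eq_le normc_ge0 andbT; apply: (@le_pow2 R _ _ 32) => K; rewrite add0r.
rewrite (@cauchy_expand _ z K.+1) //; last exact: bdcC.
rewrite big_ord_recl /= l0 expr0 mulr1 big1 ?addr0; last first.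
  by move=> i _; rewrite /= /bump /= laurent1 mul0r.
rewrite addrAC subrr add0r.
apply: le_trans (cauchy_remainder K.+1 _ hz hb _) _ => //; first exact: bdcC.
rewrite mulr1 ler_wpM2l // lef_pV2 ?posrE ?exprn_gt0 //.
by rewrite ler_eXn2l // ltr1n.
Qed.

(** Each side of the square contributes a positive amount to the imaginary
    part. *)
Lemma winding_neq0 : winding != 0.
Proof.
suff h : 0 < complex.Im winding.
  by apply/eqP => w0; move: h; rewrite w0 ltxx.
have cb := bdc_inv.
have c1 := bd_cont_h h22 cb (or_introl (erefl _)).
have c2 := bd_cont_h h22 cb (or_intror (erefl _)).
have c3 := bd_cont_v h22 cb (or_introl (erefl _)).
have c4 := bd_cont_v h22 cb (or_intror (erefl _)).
have low (t s e : R) : -2 <= t <= 2 -> s = 2 \/ s = -2 -> 4^-1 <= 2 / (t ^+ 2 + s ^+ 2).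
  move=> ht hs; have -> : s ^+ 2 = 4 by case: hs => ->; ring.
  have t2 : t ^+ 2 <= 4 by case/andP: ht => h1 h2; nra.
  have t0 := sqr_ge0 t.
  by rewrite ler_pdivlMr; lra.
have e : forall a b : R, (a +i* b)^-1 = (a / (a ^+ 2 + b ^+ 2)) -i* (b / (a ^+ 2 + b ^+ 2)) by [].
have l1 : 4^-1 * (2 - (-2)) <= rint (fun t : R => complex.Im (t +i* (-2))^-1) (-2) 2.
  apply: rint_lbound => //; first exact: cont_segIm c1.
  move=> t ht; rewrite e /= -mulNr opprK; apply: low => //; by right.
have l2 : rint (fun t : R => complex.Im (t +i* 2)^-1) (-2) 2 <= - (4^-1 * (2 - (-2))).
  rewrite lerNr -[- rint _ _ _]mulN1r -rintZ; last exact: cont_segIm c2.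
  apply: rint_lbound => //.
    by move=> t ht; apply: cvgM; [exact: cvg_cst|exact: (cont_segIm c2)].
  move=> t ht; rewrite e /= mulN1r opprK; apply: low => //; by left.
have l3 : 4^-1 * (2 - (-2)) <= rint (fun t : R => complex.Re (2 +i* t)^-1) (-2) 2.
  apply: rint_lbound => //; first exact: cont_segRe c4.
  move=> t ht; rewrite e /= [_ + t ^+ 2]addrC; apply: low => //; by left.
have l4 : rint (fun t : R => complex.Re (-2 +i* t)^-1) (-2) 2 <= - (4^-1 * (2 - (-2))).
  rewrite lerNr -[- rint _ _ _]mulN1r -rintZ; last exact: cont_segRe c3.
  apply: rint_lbound => //.
    by move=> t ht; apply: cvgM; [exact: cvg_cst|exact: (cont_segRe c3)].
  move=> t ht; rewrite e /= mulN1r -mulNr opprK [_ + t ^+ 2]addrC; apply: low => //.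
  by right.
have Im4 (A B C D : R[i]) : complex.Im (A + 'i%C * B - C - 'i%C * D)
    = complex.Im A + complex.Re B - complex.Im C - complex.Re D.
  by case: A B C D => [? ?] [? ?] [? ?] [? ?] /=; ring.
rewrite /winding /oint Im4 /cint [complex.Im (_ +i* _)]/= [complex.Re (_ +i* _)]/=.
rewrite [X in _ + X - _ - _]/= [X in _ - X - _]/= [X in _ - _ - X]/=.
move: l1 l2 l3 l4; set A := rint _ _ _; set B := rint _ _ _; set C := rint _ _ _.
by set D := rint _ _ _; lra.
Qed.

(** Complex differentiability at every point suffices, by Goursat's theorem
    applied to the difference quotient of [f] at [z].  Integrating over the
    square of half-side 2, which lies in the disc of radius 3, makes the
    expansion converge like [2^-n] on the closed unit disc. *)
Theorem cauchy_series f : (forall z, normc z < 3 -> derivable f z 1) ->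
  exists (c : nat -> R[i]) (K : R), 0 <= K /\ forall z, normc z <= 1 ->
    forall n, normc (f z - \sum_(i < n) c i * z ^+ i) <= K / 2 ^+ n.
Proof.
move=> hf.
have cf w : inrect (-2) 2 (-2) 2 w -> {for w : R[i]^o, continuous f}.
  by move=> /sq_normc /hf /derivable_continuous.
have bf : bdc f by move=> w [hw _]; exact: cf.
have [M M0 hM] := bd_bounded bf.
have k0 : 0 < normc winding by rewrite normc_gt0 winding_neq0.
exists (fun n => winding^-1 * laurent f n), (32 * M / normc winding); split.
  by rewrite divr_ge0 ?mulr_ge0 // ltW.
move=> z hz n.
have cauchy : sq (fun w => f w * (w - z)^-1) = f z * winding.
  have z1 : `|complex.Re z| <= 1 := le_trans (normcRe z) hz.
  have z2 : `|complex.Im z| <= 1 := le_trans (normcIm z) hz.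
  move: z1 z2; rewrite !ler_norml => /andP[x1 x2] /andP[y1 y2].
  have zr : inrect (-2) 2 (-2) 2 z by split; apply/andP; split; lra.
  have [d hd] : exists d, cderiv f z d by apply/derivable_cderiv/hf/sq_normc.
  have [r r0 hr] := hd 1 ltr01.
  have q0 : sq (fun w => (f w + (- f z)) * (w - z)^-1) = 0.
    apply: (@goursat_punctured _ _ _ _ _ _ z (1 + normc d) r) => //; try lra.
      move=> w hw wz.
      apply: (derivableM (f := fun w : R[i]^o => f w + - f z : R[i]^o)
                 (g := fun w : R[i]^o => (w - z)^-1 : R[i]^o)).
        by apply: derivableD; [exact/hf/sq_normc|exact: derivable_cst].
      apply: (derivableV (f := fun w : R[i]^o => (w - z) : R[i]^o)).
        by rewrite subr_eq0.
      by apply: derivableB; [exact: derivable_id|exact: derivable_cst].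
    move=> w wz hw; have := hr _ hw; rewrite subrK rnormc mul1r.
    rewrite -[_ *: d]/(_ * d) => h; rewrite normcM normcV.
    have w0 : 0 < normc (w - z) by rewrite normc_gt0 subr_eq0.
    rewrite ler_pdivrMr // mulrDl mul1r -normcM.
    have -> : f w - f z = (f w - f z - (w - z) * d) + d * (w - z) by ring.
    by apply: (le_trans (normc_add _ _)); rewrite lerD2r.
  have c1 : bdc (fun w => 1 * (w - z)^-1).
    exact: (bdcM (bdcC (k := 1)) (bdc_ker hz)).
  have c2 : bdc (fun w => f z * (1 * (w - z)^-1)) by exact: (bdcM (bdcC (k := (f z))) c1).
  have c3 : bdc (fun w => (f w + (- f z)) * (w - z)^-1).
    apply: bdcM; last exact: bdc_ker.
    by move=> w hw; apply: continuous_forD; [exact: bf|exact: bdcC hw].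
  rewrite -(winding_disc hz) -(ointZ (f z) h22 h22 c1) -[RHS]add0r -q0.
  rewrite -(ointD h22 h22 c3 c2).
  by apply: eq_oint => // w _; ring.
have := cauchy_remainder n bf hz hM M0.
move: (cauchy_expand n bf hz); rewrite cauchy; set Q := sq _ => E hQ.
have -> : f z - \sum_(i < n) winding^-1 * laurent f i * z ^+ i = winding^-1 * Q.
  apply: (mulIf winding_neq0); rewrite mulrBl E mulr_suml.
  rewrite addrAC -sumrB big1 ?add0r; last first.
    move=> i _; apply/eqP; rewrite subr_eq0; apply/eqP; field; exact: winding_neq0.
  by rewrite mulrAC mulVf ?winding_neq0 // mul1r.
rewrite normcM normcV mulrC -mulrA [_^-1 / _]mulrC mulrA.
by rewrite ler_wpM2r // invr_ge0 normc_ge0.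
Qed.

End CauchySeriesMain.

(** * Nonnegative sesquilinear forms on a subspace *)

Section Elementary.
Variable R : realType.
Implicit Types (x y A B e : R) (c : R[i]).

(** The discriminant argument behind every inequality of Cauchy-Schwarz type
    below, in a form that also covers degenerate [A] and [B]. *)
Lemma discriminant c A B : 0 <= A -> 0 <= B ->
  (forall d : R[i], 2 * complex.Re (d^* * c) <= A + normc d ^+ 2 * B) ->
  normc c <= Num.sqrt A * Num.sqrt B.
Proof.
move=> A0 B0 h; have [->|c0] := eqVneq c 0.
  by rewrite normc0 mulr_ge0 ?sqrtr_ge0.
have nc : 0 < normc c by rewrite normc_gt0.
set a := Num.sqrt A; set b := Num.sqrt B.
have a0 : 0 <= a := sqrtr_ge0 _; have b0 : 0 <= b := sqrtr_ge0 _.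
have aE : A = a ^+ 2 by rewrite sqr_sqrtr.
have bE : B = b ^+ 2 by rewrite sqr_sqrtr.
apply: (@le_small _ _ _ (a + b + 1)) => e e0 e1.
have ae : 0 < a + e by lra.
have be : 0 < b + e by lra.
pose s := (a + e) / (b + e); have s0 : 0 < s by rewrite divr_gt0.
have := h ((s / normc c)%:C * c).
have -> : ((s / normc c)%:C * c)^* * c = (s * normc c)%:C.
  have E (x : R) : (x%:C * c)^* * c = (x * normc c ^+ 2)%:C.
    rewrite normc_sqr; case: (c) => p q; apply/eqP; rewrite eq_complex /=.
    by apply/andP; split; apply/eqP; ring.
  rewrite E.
  by congr (_%:C); field; rewrite gt_eqF.
rewrite normcM normc_real normrM normfV (gtr0_norm s0) (gtr0_norm nc) divfK ?gt_eqF //=.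
move=> h2; have sb : s * (b + e) = a + e by rewrite /s divfK ?gt_eqF.
have hs : s ^+ 2 * B <= (a + e) ^+ 2.
  have hB : B <= (b + e) ^+ 2 by rewrite bE; clear -b0 e0; nra.
  by have := ler_wpM2l (sqr_ge0 s) hB; rewrite -exprMn sb.
have h3 : s * normc c <= (a + e) ^+ 2 by rewrite aE in h2; clear -h2 hs a0 e0; nra.
have h4 : normc c <= (a + e) * (b + e).
  rewrite -(ler_pM2l s0) (le_trans h3) // le_eqVlt; apply/orP; left; apply/eqP.
  by rewrite [(a + e) * (b + e)]mulrC mulrA sb expr2.
by apply: (le_trans h4); clear -a0 b0 e0 e1; nra.
Qed.

End Elementary.

Section Psd.
Variables (R : realType) (V : lmodType R[i]).
Implicit Types (D : set V) (t : V -> V -> R[i]) (a : R[i]) (u v w : V).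

(** Nothing is asked of [t] outside [D], where the forms of unbounded operators
    have junk values. *)
Record psd D t : Prop := Psd {
  psd_sub : linear_subspace D;
  psd_lin : forall a u v w, D u -> D v -> D w ->
    t (a *: u + v) w = a * t u w + t v w;
  psd_herm : forall u v, D u -> D v -> t v u = (t u v)^*;
  psd_ge0 : forall u, D u -> 0 <= t u u }.

(** [t u u] is real for a nonnegative form; [qf] and [sn] bring it and the
    seminorm it defines down to [R]. *)
Definition qf t u : R := complex.Re (t u u).
Definition sn t u : R := Num.sqrt (qf t u).

Section Sub.
Variable D : set V.
Hypothesis sD : linear_subspace D.

Lemma sub0 : D 0. Proof. by case: sD. Qed.

Lemma subZ a u : D u -> D (a *: u).
Proof. by move=> hu; rewrite -[_ *: _]addr0; apply: sD.2 => //; exact: sub0. Qed.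

Lemma subD u v : D u -> D v -> D (u + v).
Proof. by move=> hu hv; rewrite -[u]scale1r; apply: sD.2. Qed.

Lemma subB u v : D u -> D v -> D (u - v).
Proof. by move=> hu hv; rewrite addrC -scaleN1r; apply: sD.2. Qed.

End Sub.

Section Theory.
Variables (D : set V) (t : V -> V -> R[i]).
Hypothesis pt : psd D t.
Let sD := psd_sub pt.

Lemma psdDl u v w : D u -> D v -> D w -> t (u + v) w = t u w + t v w.
Proof. by move=> hu hv hw; rewrite -[u]scale1r (psd_lin pt) // mul1r scale1r. Qed.

Lemma psd0l w : D w -> t 0 w = 0.
Proof.
move=> hw; have h0 := sub0 sD; have := psdDl h0 h0 hw; rewrite addr0.
by move/eqP; rewrite -subr_eq0 opprD addrA subrr add0r oppr_eq0 => /eqP.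
Qed.

Lemma psdZl a u w : D u -> D w -> t (a *: u) w = a * t u w.
Proof.
move=> hu hw; have h0 := sub0 sD.
by rewrite -[a *: u]addr0 (psd_lin pt) // psd0l // addr0.
Qed.

Lemma psdBl u v w : D u -> D v -> D w -> t (u - v) w = t u w - t v w.
Proof.
by move=> hu hv hw; rewrite addrC -scaleN1r (psd_lin pt) // mulN1r addrC.
Qed.

Lemma psdDr u v w : D u -> D v -> D w -> t w (u + v) = t w u + t w v.
Proof.
move=> hu hv hw; rewrite (psd_herm pt (subD sD hu hv) hw) psdDl // rmorphD /=.
by rewrite -!(psd_herm pt).
Qed.

Lemma psdBr u v w : D u -> D v -> D w -> t w (u - v) = t w u - t w v.
Proof.
move=> hu hv hw; rewrite (psd_herm pt (subB sD hu hv) hw) psdBl // rmorphB /=.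
by rewrite -!(psd_herm pt).
Qed.

Lemma psdZr a u w : D u -> D w -> t w (a *: u) = a^* * t w u.
Proof.
move=> hu hw; rewrite (psd_herm pt (subZ sD a hu) hw) psdZl // rmorphM /=.
by rewrite -(psd_herm pt).
Qed.

Lemma qfE u : D u -> t u u = (qf t u)%:C.
Proof. by move=> /(psd_ge0 pt) h; rewrite /qf; case: (t u u) (ger0_Im h) => x y /= ->. Qed.

Lemma qf_ge0 u : D u -> 0 <= qf t u.
Proof. by move=> hu; rewrite -ler0c -qfE // (psd_ge0 pt). Qed.

Lemma qf0 : qf t 0 = 0.
Proof. by rewrite /qf psd0l //; exact: sub0 sD. Qed.

Lemma qfD u v : D u -> D v -> qf t (u + v) = qf t u + qf t v + 2 * complex.Re (t u v).
Proof.
move=> hu hv; have huv := subD sD hu hv.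
rewrite /qf psdDl // !psdDr // (psd_herm pt hu hv) !raddfD /=.
by case: (t u v) => x y /=; ring.
Qed.

Lemma qfZ a u : D u -> qf t (a *: u) = normc a ^+ 2 * qf t u.
Proof.
move=> hu; rewrite /qf psdZl ?psdZr //; last exact: subZ.
rewrite mulrA [a * _]mulrC mulJc (qfE hu) -(rmorphM (real_complex R)) /=.
by rewrite -/(qf t u) ?(qfE hu).
Qed.

Lemma qfN u : D u -> qf t (- u) = qf t u.
Proof.
by move=> hu; rewrite -scaleN1r qfZ // normc_opp normc1 expr1n mul1r.
Qed.

Lemma qfB u v : D u -> D v -> qf t (u - v) = qf t u + qf t v - 2 * complex.Re (t u v).
Proof.
move=> hu hv; have hv' := subZ sD (-1) hv.
rewrite -scaleN1r qfD // scaleN1r qfN // -scaleN1r psdZr //.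
by rewrite rmorphN rmorph1 mulN1r raddfN mulrN.
Qed.

Lemma qf_distC u v : D u -> D v -> qf t (u - v) = qf t (v - u).
Proof. by move=> hu hv; rewrite -opprB qfN //; exact: (subB sD). Qed.

Lemma sn_ge0 u : 0 <= sn t u.
Proof. exact: sqrtr_ge0. Qed.

Lemma sn_sqr u : D u -> sn t u ^+ 2 = qf t u.
Proof. by move=> hu; rewrite sqr_sqrtr // qf_ge0. Qed.

Lemma psd_CS u v : D u -> D v -> normc (t u v) <= sn t u * sn t v.
Proof.
move=> hu hv; apply: discriminant; rewrite ?qf_ge0 // => d.
have hd := subZ sD d hv; have := qf_ge0 (subB sD hu hd).
by rewrite qfB // qfZ // psdZr //; lra.
Qed.

Lemma snD u v : D u -> D v -> sn t (u + v) <= sn t u + sn t v.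
Proof.
move=> hu hv; rewrite -(ler_pXn2r (n := 2)) ?nnegrE ?addr_ge0 ?sn_ge0 //.
rewrite sqrrD !sn_sqr //; last exact: (subD sD).
rewrite qfD //.
have := le_trans (ler_norm _) (le_trans (normcRe _) (psd_CS hu hv)).
by rewrite -mulr_natl; lra.
Qed.

Lemma snN u : D u -> sn t (- u) = sn t u.
Proof. by move=> hu; rewrite /sn qfN. Qed.

Lemma snB u v : D u -> D v -> sn t (u - v) <= sn t u + sn t v.
Proof.
by move=> hu hv; rewrite -[X in _ <= _ + X]snN // snD // -scaleN1r; exact: (subZ sD).
Qed.

Lemma sn_distC u v : D u -> D v -> sn t (u - v) = sn t (v - u).
Proof. by move=> hu hv; rewrite /sn qf_distC. Qed.

Lemma snZ a u : D u -> sn t (a *: u) = normc a * sn t u.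
Proof.
by move=> hu; rewrite /sn qfZ // sqrtrM ?sqr_ge0 // sqrtr_sqr ger0_norm ?normc_ge0.
Qed.

Lemma parallelogram u v : D u -> D v ->
  qf t (u + v) + qf t (u - v) = 2 * (qf t u + qf t v).
Proof. by move=> hu hv; rewrite qfD // qfB //; ring. Qed.

End Theory.
End Psd.

Section InnerProduct.
Variables (R : realType) (H : completeNormedModType R[i]).
Variable ip : {dot H for Num.conj}.
Hypothesis norm_ip : hilbert_norm ip.
Implicit Types (u v : H) (a : R[i]).

Lemma ip_psd : psd setT (fun u v : H => ip u v).
Proof.
split=> //.
- by move=> a u v w _ _ _; rewrite linearDl /= linearZl_LR.
- by move=> u v _ _; rewrite hermC expr0 mul1r.
Qed.

Lemma ip_rnorm u : ip u u = (rnorm u ^+ 2)%:C.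
Proof. by rewrite -norm_ip rnormE rmorphXn. Qed.

Lemma ip_qf u : qf (fun u v : H => ip u v) u = rnorm u ^+ 2.
Proof. by rewrite /qf ip_rnorm. Qed.

Lemma ip_sn u : sn (fun u v : H => ip u v) u = rnorm u.
Proof. by rewrite /sn ip_qf sqrtr_sqr ger0_norm ?rnorm_ge0. Qed.

Lemma ip_CS u v : normc (ip u v) <= rnorm u * rnorm v.
Proof. by have := psd_CS ip_psd (I : setT u) (I : setT v); rewrite !ip_sn. Qed.

Lemma ipC u v : ip v u = (ip u v)^*.
Proof. exact: (psd_herm ip_psd). Qed.

Lemma ipDl u v w : ip (u + v) w = ip u w + ip v w.
Proof. exact: (psdDl ip_psd). Qed.

Lemma ipBl u v w : ip (u - v) w = ip u w - ip v w.
Proof. exact: (psdBl ip_psd). Qed.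

Lemma ipZl a u w : ip (a *: u) w = a * ip u w.
Proof. exact: (psdZl ip_psd). Qed.

Lemma ipDr u v w : ip w (u + v) = ip w u + ip w v.
Proof. exact: (psdDr ip_psd). Qed.

Lemma ipBr u v w : ip w (u - v) = ip w u - ip w v.
Proof. exact: (psdBr ip_psd). Qed.

Lemma ipZr a u w : ip w (a *: u) = a^* * ip w u.
Proof. exact: (psdZr ip_psd). Qed.

Lemma rnorm_sqrD u v :
  rnorm (u + v) ^+ 2 = rnorm u ^+ 2 + rnorm v ^+ 2 + 2 * complex.Re (ip u v).
Proof. by have := qfD ip_psd (I : setT u) (I : setT v); rewrite !ip_qf. Qed.

End InnerProduct.

(** * Averages over roots of unity *)

Section RootAverages.
Variable R : realType.
Implicit Types (f g : R[i] -> R[i]) (c : nat -> R[i]) (z k : R[i]) (K : R).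

(** [X^N - 1] splits and is separable, so it has [N] distinct roots, which form
    a cyclic group. *)
Lemma ex_prim_root N : (0 < N)%N -> exists z, N.-primitive_root z.
Proof.
pose p : {poly R[i]} := 'X^N - 1; have [r Dp] := closed_field_poly_normal p.
move=> n_gt0; rewrite (monicP _) ?monicXnsubC // scale1r in Dp.
have rn1 : all N.-unity_root r by apply/allP=> z; rewrite -root_prod_XsubC -Dp.
have sz_r : (N < (size r).+1)%N.
  by rewrite -(size_prod_XsubC r id) -Dp size_XnsubC.
have [|z] := hasP (has_prim_root n_gt0 rn1 _ sz_r); last by exists z.
by rewrite -separable.separable_prod_XsubC -Dp cyclotomic.separable_Xn_sub_1 // pnatr_eq0 -lt0n.
Qed.

Definition prim N : R[i] := xget 1 [set z | N.-primitive_root z].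

Lemma primP N : (0 < N)%N -> N.-primitive_root (prim N).
Proof. by move=> /ex_prim_root h; exact: (@xgetPex R[i] 1 [set z | N.-primitive_root z] h). Qed.

Lemma prim_norm N (k : nat) : (0 < N)%N -> normc (prim N ^+ k) = 1.
Proof.
move=> N0; have h : normc (prim N) ^+ N = 1.
  by rewrite -normcX (prim_expr_order (primP N0)) normc1.
have -> : normc (prim N ^+ k) = normc (prim N) ^+ k by exact: normcX.
suff -> : normc (prim N) = 1 by rewrite expr1n.
by apply/eqP; rewrite -(pexpr_eq1 N0 (normc_ge0 _)) h.
Qed.

(** A substitute for integration over the unit circle: it computes Taylor
    coefficients up to an error that vanishes as [N] grows. *)
Definition mean N f : R[i] := (N%:R)^-1 * \sum_(k < N) f (prim N ^+ k).

Lemma eq_mean N f g : (0 < N)%N -> (forall z, normc z = 1 -> f z = g z) ->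
  mean N f = mean N g.
Proof.
by move=> N0 h; congr (_ * _); apply: eq_bigr => k _; apply: h; exact: prim_norm.
Qed.

Lemma meanD N f g : mean N (fun z => f z + g z) = mean N f + mean N g.
Proof. by rewrite /mean big_split mulrDr. Qed.

Lemma meanZ N k f : mean N (fun z => k * f z) = k * mean N f.
Proof. by rewrite /mean -mulr_sumr mulrCA. Qed.

Lemma mean_cst N k : (0 < N)%N -> mean N (fun=> k) = k.
Proof.
move=> N0; rewrite /mean sumr_const card_ord -[k *+ N]mulr_natl mulKf //.
by rewrite pnatr_eq0 -lt0n.
Qed.

Lemma mean_sum N n (F : nat -> R[i] -> R[i]) :
  mean N (fun z => \sum_(i < n) F i z) = \sum_(i < n) mean N (F i).
Proof. by rewrite /mean exchange_big mulr_sumr. Qed.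

Lemma mean_conj N f : mean N (fun z => (f z)^*) = (mean N f)^*.
Proof.
rewrite /mean rmorphM rmorph_sum; congr (_ * _).
by rewrite fmorphV rmorph_nat.
Qed.

Lemma meanX N j : (0 < j)%N -> (j < N)%N -> mean N (fun z => z ^+ j) = 0.
Proof.
move=> j0 jN; have N0 : (0 < N)%N by exact: leq_trans jN.
rewrite /mean; have pN := primP N0; set w := prim N in pN *.
have E : \sum_(k < N) w ^+ k ^+ j = \sum_(k < N) (w ^+ j) ^+ k.
  by apply: eq_bigr => k _; rewrite -!exprM mulnC.
have x1 : w ^+ j - 1 != 0.
  rewrite subr_eq0 -(prim_order_dvd pN); apply/negP => /dvdn_leq.
  by move=> /(_ j0); rewrite leqNgt jN.
have : (w ^+ j - 1) * \sum_(k < N) (w ^+ j) ^+ k = 0.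
  by rewrite -subrX1 exprAC (prim_expr_order pN) expr1n subrr.
by move/eqP; rewrite mulf_eq0 (negPf x1) /= => /eqP h; rewrite E h mulr0.
Qed.

Lemma mean_bound N f (B : R) : (0 < N)%N ->
  (forall z, normc z = 1 -> normc (f z) <= B) -> normc (mean N f) <= B.
Proof.
move=> N0 h; have n0 : 0 < N%:R :> R by rewrite ltr0n.
rewrite /mean normcM normcV.
have -> : normc (N%:R : R[i]) = N%:R.
  by rewrite -(rmorph_nat (real_complex R)) normc_real ger0_norm.
rewrite mulrC ler_pdivrMr //; apply: (le_trans (normc_sum _ _ _)).
apply: (@le_trans _ _ (\sum_(k < N) B)).
  by apply: ler_sum => k _; apply: h; exact: prim_norm.
by rewrite sumr_const card_ord mulr_natr.
Qed.

Lemma mean_Re_le N f g : (0 < N)%N ->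
  (forall z, normc z = 1 -> complex.Re (f z) <= complex.Re (g z)) ->
  complex.Re (mean N f) <= complex.Re (mean N g).
Proof.
move=> N0 h; have n0 : 0 < (N%:R)^-1 :> R by rewrite invr_gt0 ltr0n.
have E f' : complex.Re (mean N f') = (N%:R)^-1 * \sum_(k < N) complex.Re (f' (prim N ^+ k)).
  rewrite /mean -(rmorph_nat (real_complex R)) -(fmorphV (real_complex R)).
  rewrite -(raddf_sum (@complex.Re R : Rcomplex R -> R)).
  by case: (\sum_(k < N) _) => x y /=; rewrite mul0r subr0.
rewrite !E ler_pM2l //; apply: ler_sum => k _; apply: h; exact: prim_norm.
Qed.

Lemma mulJc1 z : normc z = 1 -> z^* * z = 1.
Proof. by move=> h; rewrite mulJc h expr1n. Qed.

(** The explicit rate of convergence is what bounds the error made when averages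
    over roots of unity replace integrals over the circle. *)
Definition pexp f c K := 0 <= K /\ forall z, normc z <= 1 ->
  forall n, normc (f z - \sum_(i < n) c i * z ^+ i) <= K / 2 ^+ n.

(** Truncating the series at order [N], the roots of unity kill every monomial
    of degree less than [N] except the one of degree [n]. *)
Lemma mean_coef f c K n N : pexp f c K -> (n < N)%N ->
  normc (mean N (fun z => f z * z^* ^+ n) - c n) <= K / 2 ^+ N.
Proof.
move=> [K0 hf] nN; have N0 : (0 < N)%N by exact: leq_ltn_trans nN.
have E : c n = mean N (fun z => (\sum_(i < N) c i * z ^+ i) * z^* ^+ n).
  have -> : mean N (fun z => (\sum_(i < N) c i * z ^+ i) * z^* ^+ n) =
    mean N (fun z => \sum_(i < N) c i * (z ^+ i * z^* ^+ n)).
    by apply: eq_mean => // z _; rewrite mulr_suml; apply: eq_bigr => i _; rewrite mulrA.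
  rewrite (mean_sum N N (fun i z => c i * (z ^+ i * z^* ^+ n))) (bigD1 (Ordinal nN)) //= big1 ?addr0.
    rewrite meanZ (@eq_mean _ _ (fun=> 1)) ?mean_cst ?mulr1 // => z hz.
    by rewrite -exprMn mulrC mulJc1 // expr1n.
  move=> i; rewrite -val_eqE /= => ni; rewrite meanZ; apply/eqP.
  rewrite mulf_eq0; apply/orP; right; apply/eqP.
  have [lt|ge] := ltnP i n.
    rewrite (@eq_mean _ _ (fun z => (z ^+ (n - i))^*)) //.
      have nj : (n - i < N)%N := leq_ltn_trans (leq_subr _ _) nN.
      rewrite mean_conj meanX ?subn_gt0 //. exact: (rmorph0 (@conjc R)).
    move=> z hz; rewrite -{1}(subnKC (ltnW lt)) exprD mulrA -exprMn.
    by rewrite [z * _]mulrC mulJc1 // expr1n mul1r rmorphXn.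
  rewrite (@eq_mean _ _ (fun z => z ^+ (i - n))) //.
    have nj : (i - n < N)%N := leq_ltn_trans (leq_subr _ _) (ltn_ord i).
    by rewrite meanX // subn_gt0 ltn_neqAle eq_sym ni.
  move=> z hz; rewrite -{1}(subnKC ge) exprD mulrAC -exprMn.
  by rewrite [z * _]mulrC mulJc1 // expr1n mul1r.
rewrite E -[- mean _ _]mulN1r -meanZ -meanD; apply: mean_bound => // z hz.
have -> : f z * z^* ^+ n + -1 * ((\sum_(i < N) c i * z ^+ i) * z^* ^+ n)
  = (f z - \sum_(i < N) c i * z ^+ i) * z^* ^+ n by ring.
by rewrite normcM normcX normc_conj hz expr1n mulr1 hf // hz.
Qed.

(** Once the series is truncated at order [N - n], only monomials of degrees [n]
    to [N - 1] are left, and the roots of unity kill them all. *)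
Lemma mean_shift f c K n N : pexp f c K -> (0 < n)%N -> (n < N)%N ->
  normc (mean N (fun z => f z * z ^+ n)) <= K / 2 ^+ (N - n).
Proof.
move=> [K0 hf] n0 nN; have N0 : (0 < N)%N by exact: leq_ltn_trans nN.
have E : mean N (fun z => (\sum_(i < N - n) c i * z ^+ i) * z ^+ n) = 0.
  have -> : mean N (fun z => (\sum_(i < N - n) c i * z ^+ i) * z ^+ n) =
    mean N (fun z => \sum_(i < N - n) c i * z ^+ (i + n)).
    apply: eq_mean => // z _; rewrite mulr_suml; apply: eq_bigr => i _.
    by rewrite exprD mulrA.
  rewrite (mean_sum N (N - n) (fun i z => c i * z ^+ (i + n))) big1 // => i _.
  have iN : (i + n < N)%N by rewrite addnC -ltn_subRL.
  by rewrite meanZ meanX ?mulr0 // addn_gt0 n0 orbT.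
rewrite -[mean _ _]subr0 -E -[- mean _ _]mulN1r -meanZ -meanD.
apply: mean_bound => // z hz.
have -> : f z * z ^+ n + -1 * ((\sum_(i < N - n) c i * z ^+ i) * z ^+ n)
  = (f z - \sum_(i < N - n) c i * z ^+ i) * z ^+ n by ring.
by rewrite normcM normcX hz expr1n mulr1 hf // hz.
Qed.

Lemma pexp0 f c K : pexp f c K -> f 0 = c 0%N.
Proof.
move=> [K0 hf]; apply/eqP; rewrite -subr_eq0 -normc_eq0 eq_le normc_ge0 andbT.
apply: (@le_pow2 _ _ _ K) => m; rewrite add0r.
have := hf 0; rewrite normc0 => /(_ ler01 m.+1); rewrite big_ord_recl expr0 mulr1.
rewrite big1 ?addr0 => [|i _]; last by rewrite /= exprS mul0r mulr0.
move/le_trans; apply; rewrite ler_wpM2l // lef_pV2 ?posrE ?exprn_gt0 //.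
by rewrite ler_eXn2l // ltr1n.
Qed.

Lemma pexpZ f c K k : pexp f c K ->
  pexp (fun z => k * f z) (fun n => k * c n) (normc k * K).
Proof.
move=> [K0 hf]; split=> [|z hz n]; first by rewrite mulr_ge0 ?normc_ge0.
have -> : k * f z - \sum_(i < n) k * c i * z ^+ i = k * (f z - \sum_(i < n) c i * z ^+ i).
  by rewrite mulrBr mulr_sumr; congr (_ - _); apply: eq_bigr => i _; rewrite mulrA.
by rewrite normcM -mulrA ler_wpM2l ?normc_ge0 // hf.
Qed.

Lemma geom_sum_le (x : R) n : 0 <= x -> x < 1 -> \sum_(i < n) x ^+ i.+1 <= x / (1 - x).
Proof.
move=> x0 x1; have h : 0 < 1 - x by rewrite subr_gt0.
rewrite ler_pdivlMr //; under eq_bigr do rewrite exprS.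
rewrite -mulr_sumr -mulrA; have := subrX1 x n; rewrite mulrC.
move: (\sum_(i < n) _) => S e.
have -> : S * (1 - x) = 1 - x ^+ n by rewrite -[1 - x ^+ n]opprB e; ring.
have := exprn_ge0 n x0; nra.
Qed.

Lemma pexp_bound f c K (B : R) z : pexp f c K -> 0 <= B ->
  (forall n, (0 < n)%N -> normc (c n) <= B) -> normc z < 1 ->
  normc (f z - f 0) <= B * (normc z / (1 - normc z)).
Proof.
move=> hf B0 hB z1; apply: (@le_pow2 _ _ _ K) => m.
have [K0 hK] := hf; have := hK z (ltW z1) m.+1.
rewrite big_ord_recl expr0 mulr1 -(pexp0 hf) opprD addrA => h.
set S := \sum_(i < m) _ in h.
have -> : f z - f 0 = (f z - f 0 - S) + S by ring.
apply: (le_trans (normc_add _ _)); rewrite addrC; apply: lerD; last first.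
  apply: (le_trans h); rewrite ler_wpM2l // lef_pV2 ?posrE ?exprn_gt0 //.
  by rewrite ler_eXn2l // ltr1n.
apply: (le_trans (normc_sum _ _ _)).
apply: (@le_trans _ _ (\sum_(i < m) B * normc z ^+ i.+1)).
  by apply: ler_sum => i _; rewrite normcM normcX ler_wpM2r ?exprn_ge0 ?normc_ge0 // hB.
by rewrite -mulr_sumr ler_wpM2l // geom_sum_le ?normc_ge0.
Qed.

End RootAverages.

(** * The Schwarz-Pick inequality for operator functions *)

Section SchwarzPick.
Variables (R : realType) (H : completeNormedModType R[i]).
Variable ip : {dot H for Num.conj}.
Hypothesis norm_ip : hilbert_norm ip.
Variable C : R[i] -> H -> H.
Hypothesis Clin : forall z a u v, normc z <= 1 ->
  C z (a *: u + v) = a *: C z u + C z v.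
Hypothesis Ccontr : forall z u, normc z <= 1 -> rnorm (C z u) <= rnorm u.
Hypothesis Cexp : forall f g, exists c K, pexp (fun z => ip (C z f) g) c K.
Implicit Types (f g h : H) (z : R[i]).

Definition defect f : R := rnorm f ^+ 2 - rnorm (C 0 f) ^+ 2.

Let n0 : normc (0 : R[i]) <= 1. Proof. by rewrite normc0. Qed.

Lemma defect_ge0 f : 0 <= defect f.
Proof.
by rewrite subr_ge0 ler_pXn2r ?nnegrE ?rnorm_ge0 // Ccontr.
Qed.

Lemma C_zero z : normc z <= 1 -> C z 0 = 0.
Proof.
by move=> hz; apply/eqP; rewrite -rnorm_eq0 eq_le rnorm_ge0 andbT -[leRHS](rnorm0 H) Ccontr.
Qed.

Lemma C_scale z a u : normc z <= 1 -> C z (a *: u) = a *: C z u.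
Proof. by move=> hz; rewrite -[a *: u]addr0 Clin // C_zero // addr0. Qed.

(** Pairing [C z] with [f + z^n f'] and [g + z^n g'] and averaging over the
    circle only leaves the entries of the lower triangular Toeplitz matrix with
    rows (C_0, 0) and (C_n, C_0), which is therefore a contraction. *)
Lemma toeplitz n f f' g g' c1 K1 c2 K2 c3 K3 c4 K4 : (0 < n)%N ->
  pexp (fun z => ip (C z f) g) c1 K1 -> pexp (fun z => ip (C z f) g') c2 K2 ->
  pexp (fun z => ip (C z f') g) c3 K3 -> pexp (fun z => ip (C z f') g') c4 K4 ->
  2 * complex.Re (c1 0%N + c2 n + c4 0%N) <=
    rnorm f ^+ 2 + rnorm f' ^+ 2 + rnorm g ^+ 2 + rnorm g' ^+ 2.
Proof.
move=> n_gt0 h1 h2 h3 h4.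
apply: (@le_pow2 _ _ _ (2 * (K1 + K2 + K3 + K4))) => m.
pose N := (n + m.+1)%N.
have nN : (n < N)%N by rewrite /N addnS ltnS leq_addr.
have N0 : (0 < N)%N by exact: leq_ltn_trans nN.
have dom (a b : R) k : (m <= k)%N -> a <= b / 2 ^+ k -> 0 <= b -> a <= b / 2 ^+ m.
  move=> mk ha b0; apply: (le_trans ha); rewrite ler_wpM2l //.
  by rewrite lef_pV2 ?posrE ?exprn_gt0 // ler_weXn2l // ler1n.
have mN : (m <= N)%N by rewrite /N addnS (leq_trans (leq_addl n m)).
have e1 := dom _ _ _ mN (mean_coef h1 N0) h1.1.
have e2 := dom _ _ _ mN (mean_coef h2 nN) h2.1.
have mNn : (m <= N - n)%N by rewrite /N addKn.
have e3 := dom _ _ _ mNn (mean_shift h3 n_gt0 nN) h3.1.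
have e4 := dom _ _ _ mN (mean_coef h4 N0) h4.1.
pose u z := C z (z ^+ n *: f' + f); pose v z := z ^+ n *: g' + g.
pose X := mean N (fun z => ip (u z) (v z)).
have XE : X = mean N (fun z => ip (C z f) g * z^* ^+ 0)
    + mean N (fun z => ip (C z f) g' * z^* ^+ n)
    + mean N (fun z => ip (C z f') g * z ^+ n)
    + mean N (fun z => ip (C z f') g' * z^* ^+ 0).
  rewrite -!meanD; apply: eq_mean => // z hz.
  have hz1 : normc z <= 1 by rewrite hz.
  rewrite /u /v Clin // ipDl !ipDr !ipZl !ipZr rmorphXn /=.
  have zz : z ^+ n * z^* ^+ n = 1 by rewrite -exprMn mulrC mulJc1 // expr1n.
  rewrite [z^* ^+ n * ip (C z f') g']mulrC [z ^+ n * (_ * _)]mulrCA zz !expr0 !mulr1.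
  by ring.
have half : 2 * complex.Re X <= rnorm f ^+ 2 + rnorm f' ^+ 2 + rnorm g ^+ 2 + rnorm g' ^+ 2.
  have sq (a a' : H) : mean N (fun z => ip (z ^+ n *: a' + a) (z ^+ n *: a' + a))
      = (rnorm a ^+ 2 + rnorm a' ^+ 2)%:C.
    have -> : mean N (fun z => ip (z ^+ n *: a' + a) (z ^+ n *: a' + a)) =
      mean N (fun z => ip a a + ip a' a' + ip a' a * z ^+ n + ip a a' * (z ^+ n)^*).
      apply: eq_mean => // z hz; rewrite ipDl !ipDr !ipZl !ipZr.
      have zz : z ^+ n * (z ^+ n)^* = 1 by rewrite mulrC mulJc1 // normcX hz expr1n.
      by rewrite mulrA zz mul1r; ring.
    rewrite !meanD !mean_cst // !meanZ mean_conj meanX // (rmorph0 (@conjc R)) !mulr0 !addr0.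
    by rewrite !(ip_rnorm norm_ip) -rmorphD.
  have := @mean_Re_le _ N (fun z => 2 * ip (u z) (v z)) (fun z =>
     ip (z ^+ n *: f' + f) (z ^+ n *: f' + f) + ip (v z) (v z)) N0.
  rewrite meanZ meanD !sq /= => h.
  have E (x : R[i]) : complex.Re (2 * x) = 2 * complex.Re x.
    by rewrite !mulr_natl raddfMn.
  rewrite -E -!addrA [rnorm f' ^+ 2 + _]addrA addrA; apply: (le_trans (h _)); last by rewrite -!addrA.
  move=> z hz; rewrite E !(ip_rnorm norm_ip) /=.
  have hz1 : normc z <= 1 by rewrite hz.
  have k1 := le_trans (ler_norm _) (le_trans (normcRe _) (ip_CS norm_ip (u z) (v z))).
  have k2 := Ccontr (z ^+ n *: f' + f) hz1; rewrite -/(u z) in k2.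
  have k3 := rnorm_ge0 (u z); have k4 := rnorm_ge0 (v z).
  move: k1 k2 k3 k4; set p := rnorm (u z); set q := rnorm (v z); set r := rnorm _ => k1 k2 k3 k4.
  have k5 : p ^+ 2 <= r ^+ 2 by rewrite ler_pXn2r ?nnegrE // (le_trans k3).
  have k6 := sqr_ge0 (p - q); rewrite sqrrB in k6.
  by lra.
have err : normc (c1 0%N + c2 n + c4 0%N - X) <= (K1 + K2 + K3 + K4) / 2 ^+ m.
  rewrite XE; move: e1 e2 e3 e4; set M1 := mean _ _; set M2 := mean _ _.
  set M3 := mean _ _; set M4 := mean _ _ => e1 e2 e3 e4.
  have -> : c1 0%N + c2 n + c4 0%N - (M1 + M2 + M3 + M4) =
    - ((M1 - c1 0%N) + (M2 - c2 n) + M3 + (M4 - c4 0%N)) by ring.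
  rewrite normc_opp !mulrDl.
  by do 3 (apply: (le_trans (normc_add _ _)); apply: lerD => //).
have := le_trans (ler_norm _) (le_trans (normcRe _) err).
rewrite raddfB /= => h.
by rewrite -[2 * (K1 + _ + _ + _) / _]mulrA; lra.
Qed.

Lemma pexp_zero f g c K : pexp (fun z => ip (C z f) g) c K -> c 0%N = ip (C 0 f) g.
Proof. by move/pexp0 => <-. Qed.

(** In [toeplitz], take [g = C 0 f], [f' = d h] and [g' = d C 0 h]: the diagonal
    entries turn the right-hand side into defects, and [d] is free. *)
Lemma coef_defect n f h c K : (0 < n)%N ->
  pexp (fun z => ip (C z f) (C 0 h)) c K ->
  normc (c n) <= Num.sqrt (defect f) * Num.sqrt (defect h).
Proof.
move=> n_gt0 hc; apply: discriminant; rewrite ?defect_ge0 // => d.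
have [c1 [K1 h1]] := Cexp f (C 0 f).
have h2 : pexp (fun z => ip (C z f) (d *: C 0 h)) (fun n => d^* * c n) (normc d^* * K).
  have -> : (fun z => ip (C z f) (d *: C 0 h)) = (fun z => d^* * ip (C z f) (C 0 h)).
    by apply/funext => z; rewrite ipZr.
  exact: pexpZ.
have [c3 [K3 h3]] := Cexp (d *: h) (C 0 f).
have [c4 [K4 h4]] := Cexp (d *: h) (d *: C 0 h).
have := toeplitz n_gt0 h1 h2 h3 h4.
rewrite (pexp_zero h1) (pexp_zero h4) (C_scale _ _ n0) !(ip_rnorm norm_ip) !rnormZ !exprMn.
rewrite !raddfD /= /defect; lra.
Qed.

(** The same with [f' = 0] and [g' = d g]. *)
Lemma coef_defect_norm n f g c K : (0 < n)%N ->
  pexp (fun z => ip (C z f) g) c K ->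
  normc (c n) <= Num.sqrt (defect f) * rnorm g.
Proof.
move=> n_gt0 hc.
rewrite -[rnorm g]ger0_norm ?rnorm_ge0 // -sqrtr_sqr.
apply: discriminant; rewrite ?defect_ge0 ?sqr_ge0 // => d.
have [c1 [K1 h1]] := Cexp f (C 0 f).
have h2 : pexp (fun z => ip (C z f) (d *: g)) (fun n => d^* * c n) (normc d^* * K).
  have -> : (fun z => ip (C z f) (d *: g)) = (fun z => d^* * ip (C z f) g).
    by apply/funext => z; rewrite ipZr.
  exact: pexpZ.
have [c3 [K3 h3]] := Cexp 0 (C 0 f).
have [c4 [K4 h4]] := Cexp 0 (d *: g).
have := toeplitz n_gt0 h1 h2 h3 h4.
rewrite (pexp_zero h1) (pexp_zero h4) (C_zero n0) (ip_rnorm norm_ip) !rnormZ !exprMn rnorm0.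
rewrite linear0l !raddfD /= /defect; lra.
Qed.

(** Summing the coefficient bounds over [n >= 1] produces the geometric factor.
    Both this bound and the next vanish with the defect, that is, where [C 0] is
    isometric: this uniformity is what relative form bounds require. *)
Lemma schwarz_pick_defect z f h : normc z < 1 ->
  normc (ip (C z f - C 0 f) (C 0 h)) <=
    Num.sqrt (defect f) * Num.sqrt (defect h) * (normc z / (1 - normc z)).
Proof.
move=> hz; have [c [K hc]] := Cexp f (C 0 h).
have B0 : 0 <= Num.sqrt (defect f) * Num.sqrt (defect h) by rewrite mulr_ge0 ?sqrtr_ge0.
by rewrite ipBl; apply: (pexp_bound hc B0 _ hz) => n n_gt0; exact: coef_defect hc.
Qed.

Lemma schwarz_pick_norm z f : normc z < 1 ->
  rnorm (C z f - C 0 f) <= Num.sqrt (defect f) * (normc z / (1 - normc z)).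
Proof.
move=> hz; set x := C z f - C 0 f.
have [->|x0] := eqVneq x 0.
  by rewrite rnorm0 mulr_ge0 ?sqrtr_ge0 // divr_ge0 ?normc_ge0 // subr_ge0 ltW.
have nx : 0 < rnorm x by rewrite lt_def rnorm_eq0 x0 rnorm_ge0.
have [c [K hc]] := Cexp f x.
have : normc (ip x x) <= Num.sqrt (defect f) * rnorm x * (normc z / (1 - normc z)).
  have B0 : 0 <= Num.sqrt (defect f) * rnorm x by rewrite mulr_ge0 ?sqrtr_ge0 ?rnorm_ge0.
  by rewrite {1}/x ipBl; apply: (pexp_bound hc B0 _ hz) => n n_gt0; exact: coef_defect_norm hc.
by rewrite (ip_rnorm norm_ip) normc_real ger0_norm ?sqr_ge0 // mulrAC expr2 ler_pM2r.
Qed.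

End SchwarzPick.

(** * Closure of a nonnegative form *)

Section Sequences.
Variable R : realType.

Lemma real_cauchy (a : nat -> R) :
  (forall e : R, 0 < e -> exists N, forall n m, (N <= n)%N -> (N <= m)%N ->
     `|a n - a m| <= e) -> exists l : R, a @ \oo --> l.
Proof.
move=> h; apply/cvg_ex/cauchy_cvgP; apply: cauchy_exP => e e0.
have e2 : 0 < e / 2 by rewrite divr_gt0.
have [N hN] := h _ e2; exists (a N); exists N => // m /= hm; rewrite /ball /=.
by rewrite (le_lt_trans (hN _ _ (leqnn N) hm)) // ltr_pdivrMr // ltr_pMr // ltr1n.
Qed.

Lemma complex_cvg (a : nat -> R[i]^o) (l : R[i]^o) :
  (fun n => complex.Re (a n)) @ \oo --> complex.Re l ->
  (fun n => complex.Im (a n)) @ \oo --> complex.Im l -> a @ \oo --> l.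
Proof.
move=> /cvgrPdist_le h1 /cvgrPdist_le h2; apply/cvgn_rnorm => e e0.
have e2 : 0 < e / 2 by rewrite divr_gt0.
have [N1 _ H1] := h1 _ e2; have [N2 _ H2] := h2 _ e2.
exists (maxn N1 N2) => n; rewrite geq_max => /andP[n1 n2].
rewrite rnormc; apply: (le_trans (normc_le _)); rewrite !raddfB /=.
have q1 := H1 n n1; have q2 := H2 n n2; rewrite /= distrC in q1; rewrite /= distrC in q2.
by rewrite [e]splitr lerD.
Qed.

Lemma complex_cauchy (a : nat -> R[i]^o) :
  (forall e : R, 0 < e -> exists N, forall n m, (N <= n)%N -> (N <= m)%N ->
     normc (a n - a m) <= e) -> exists l : R[i]^o, a @ \oo --> l.
Proof.
move=> h.
have [x hx] : exists l : R, (fun n => complex.Re (a n)) @ \oo --> l.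
  apply: real_cauchy => e /h[N hN]; exists N => n m n1 n2.
  by rewrite -raddfB (le_trans (normcRe _)) // hN.
have [y hy] : exists l : R, (fun n => complex.Im (a n)) @ \oo --> l.
  apply: real_cauchy => e /h[N hN]; exists N => n m n1 n2.
  by rewrite -raddfB (le_trans (normcIm _)) // hN.
by exists (x +i* y); apply: complex_cvg.
Qed.

Lemma cvg_Re (a : nat -> R[i]^o) (l : R[i]^o) : a @ \oo --> l ->
  (fun n => complex.Re (a n)) @ \oo --> complex.Re l.
Proof. by move=> h; apply: continuous_cvg h; exact: continuous_Re. Qed.

Lemma cvg_Im (a : nat -> R[i]^o) (l : R[i]^o) : a @ \oo --> l ->
  (fun n => complex.Im (a n)) @ \oo --> complex.Im l.
Proof. by move=> h; apply: continuous_cvg h; exact: continuous_Im. Qed.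

Lemma near_oo2 (P : nat * nat -> Prop) :
  (\forall p \near (\oo, \oo), P p) <->
  exists N, forall n m, (N <= n)%N -> (N <= m)%N -> P (n, m).
Proof.
split.
  case=> -[A B] /= [[N1 _ h1] [N2 _ h2]] h; exists (maxn N1 N2) => n m.
  rewrite !geq_max => /andP[n1 _] /andP[_ m2]; apply: (h (n, m)); split => /=.
    exact: h1.
  exact: h2.
case=> N h; exists ([set n | (N <= n)%N], [set n | (N <= n)%N]).
  by split; exists N.
by move=> [n m] [/= hn hm]; exact: h.
Qed.

End Sequences.

Section Closure.
Variables (R : realType) (H : completeNormedModType R[i]).
Variables (D : set H) (t : H -> H -> R[i]^o).
Hypothesis pt : psd D t.
Let sD := psd_sub pt.
Implicit Types (u v w : H) (us vs : nat -> H).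

(** Convergence for the form, phrased with real seminorms. *)
Definition fcvg (us : nat -> H) (u : H) := [/\ forall n, D (us n),
  forall e : R, 0 < e -> exists N, forall n, (N <= n)%N -> rnorm (us n - u) <= e
  & forall e : R, 0 < e -> exists N, forall n m, (N <= n)%N -> (N <= m)%N ->
      sn t (us n - us m) <= e].

Lemma normc_qf u : D u -> normc (t u u) = qf t u.
Proof. by move=> hu; rewrite (qfE pt hu) normc_real ger0_norm // (qf_ge0 pt hu). Qed.

Lemma sn_le u (e : R) : D u -> 0 <= e -> (sn t u <= e) = (qf t u <= e ^+ 2).
Proof.
by move=> hu e0; rewrite -(sn_sqr pt hu) ler_pXn2r ?nnegrE ?sn_ge0.
Qed.

Lemma form_cvgP us u : form_cvg D t us u <-> fcvg us u.
Proof.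
split=> -[h1 h2 h3]; split => //.
- by move/cvgn_rnorm: h2.
- move=> e e0; have e2 : 0 < e ^+ 2 by rewrite exprn_gt0.
  move/cvg_rnorm: h3 => /(_ _ e2) /near_oo2 [N hN]; exists N => n m hn hm.
  have du := subB sD (h1 n) (h1 m).
  by have := hN n m hn hm; rewrite subr0 /= rnormc normc_qf // sn_le // ltW.
- exact/cvgn_rnorm.
- apply/cvg_rnorm => e e0; apply/near_oo2.
  have e2 : 0 < Num.sqrt e by rewrite sqrtr_gt0.
  have [N hN] := h3 _ e2; exists N => n m hn hm /=.
  have du := subB sD (h1 n) (h1 m); rewrite subr0 rnormc normc_qf //.
  by have := hN n m hn hm; rewrite sn_le ?sqrtr_ge0 // sqr_sqrtr // ltW.
Qed.

Lemma closableP : closable D t <->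
  forall us, fcvg us 0 -> forall e : R, 0 < e ->
    exists N, forall n, (N <= n)%N -> sn t (us n) <= e.
Proof.
split=> h us hu.
  move=> e e0; have e2 : 0 < e ^+ 2 by rewrite exprn_gt0.
  have := h us ((form_cvgP _ _).2 hu) => /cvgn_rnorm/(_ _ e2)[N hN].
  exists N => n hn; have [hD _ _] := hu.
  have := hN n hn; rewrite subr0 rnormc normc_qf // => q.
  by rewrite sn_le // ltW.
have hf := (form_cvgP _ _).1 hu; apply/cvgn_rnorm => e e0.
have e2 : 0 < Num.sqrt e by rewrite sqrtr_gt0.
have [N hN] := h us hf _ e2; exists N => n hn; have [hD _ _] := hf.
rewrite subr0 rnormc normc_qf //.
by have := hN n hn; rewrite sn_le ?sqrtr_ge0 // sqr_sqrtr // ltW.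
Qed.

Lemma fcvg_lin a us vs u v : fcvg us u -> fcvg vs v ->
  fcvg (fun n => a *: us n + vs n) (a *: u + v).
Proof.
move=> [u1 u2 u3] [v1 v2 v3]; have a1 : 0 < normc a + 1 by rewrite ltr_wpDl ?normc_ge0.
have small e : 0 < e -> 0 < e / 2 / (normc a + 1) by move=> ?; rewrite !divr_gt0.
have half e : 0 < e -> 0 < e / 2 :> R by move=> ?; rewrite !divr_gt0.
have key (x y e : R) : 0 <= x -> x <= e / 2 / (normc a + 1) -> y <= e / 2 -> normc a * x + y <= e.
  move=> x0; rewrite ler_pdivlMr // => h1 h2.
  have : normc a * x <= x * (normc a + 1) by rewrite mulrC ler_wpM2l // lerDl.
  by lra.
split=> [n|e e0|e e0]; first exact: (sD.2).
  have [N1 h1] := u2 _ (small _ e0); have [N2 h2] := v2 _ (half _ e0).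
  exists (maxn N1 N2) => n; rewrite geq_max => /andP[n1 n2].
  have -> : a *: us n + vs n - (a *: u + v) = a *: (us n - u) + (vs n - v).
    by rewrite scalerBr opprD !addrA; congr (_ - _); rewrite addrAC.
  apply: (le_trans (rnormD _ _)); rewrite rnormZ.
  by apply: key; rewrite ?rnorm_ge0 ?h1 ?h2.
have [N1 h1] := u3 _ (small _ e0); have [N2 h2] := v3 _ (half _ e0).
exists (maxn N1 N2) => n m; rewrite !geq_max => /andP[n1 n2] /andP[m1 m2].
have -> : a *: us n + vs n - (a *: us m + vs m) = a *: (us n - us m) + (vs n - vs m).
  by rewrite scalerBr opprD !addrA; congr (_ - _); rewrite addrAC.
have du : D (us n - us m) by exact: (subB sD).
have dv : D (vs n - vs m) by exact: (subB sD).
apply: (le_trans (snD pt (subZ sD a du) dv)); rewrite (snZ pt) //.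
by apply: key; rewrite ?sn_ge0 ?h1 ?h2.
Qed.

Lemma fcvg_cst u : D u -> fcvg (fun=> u) u.
Proof.
move=> hu; split=> // e e0; exists 0%N => *; rewrite subrr.
  by rewrite rnorm0 ltW.
by rewrite /sn (qf0 pt) sqrtr0 ltW.
Qed.

Lemma fcvg_bounded us u : fcvg us u -> exists2 M : R, 0 < M &
  exists N, forall n, (N <= n)%N -> sn t (us n) <= M.
Proof.
move=> [u1 _ u3]; have [N hN] := u3 1 ltr01.
exists (sn t (us N) + 1); first by rewrite ltr_wpDl ?sn_ge0.
exists N => n hn; rewrite -[us n](subrK (us N)) addrC.
apply: (le_trans (snD pt _ _)) => //; first exact: (subB sD).
by rewrite lerD2l hN.
Qed.

Lemma form_dist u u' v v' (M d : R) : D u -> D u' -> D v -> D v' ->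
  sn t u' <= M -> sn t v <= M -> sn t (u - u') <= d -> sn t (v - v') <= d ->
  normc (t u v - t u' v') <= 2 * M * d.
Proof.
move=> hu hu' hv hv' m1 m2 d1 d2.
have du := subB sD hu hu'; have dv := subB sD hv hv'.
have -> : t u v - t u' v' = t (u - u') v + t u' (v - v').
  by rewrite (psdBl pt) // (psdBr pt) //; ring.
apply: (le_trans (normc_add _ _)).
have c1 := psd_CS pt du hv; have c2 := psd_CS pt hu' dv.
have k1 := ler_pM (sn_ge0 _ _) (sn_ge0 _ _) d1 m2.
have k2 := ler_pM (sn_ge0 _ _) (sn_ge0 _ _) m1 d2.
by lra.
Qed.

Lemma fcvg_bounded2 us vs u v : fcvg us u -> fcvg vs v -> exists2 M : R, 0 < M &
  exists N, forall n, (N <= n)%N -> sn t (us n) <= M /\ sn t (vs n) <= M.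
Proof.
move=> /fcvg_bounded[M M0 [N h]] /fcvg_bounded[M' M'0 [N' h']].
exists (M + M'); first exact: addr_gt0.
exists (maxn N N') => n; rewrite geq_max => /andP[/h k /h' k'].
by split; [apply: (le_trans k); lra|apply: (le_trans k'); lra].
Qed.

Lemma fcvg_form us vs u v : fcvg us u -> fcvg vs v ->
  exists l : R[i]^o, (fun n => t (us n) (vs n)) @ \oo --> l.
Proof.
move=> hu hv; have [M M0 [N1 h1]] := fcvg_bounded2 hu hv.
have [u1 u2 u3] := hu; have [v1 v2 v3] := hv; apply: complex_cauchy => e e0.
have d0 : 0 < e / (2 * M) by rewrite divr_gt0 // mulr_gt0.
have [N2 h2] := u3 _ d0; have [N3 h3] := v3 _ d0.
exists (maxn N1 (maxn N2 N3)) => n m.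
rewrite !geq_max => /andP[a1 /andP[a2 a3]] /andP[b1 /andP[b2 b3]].
have -> : e = 2 * M * (e / (2 * M)) by rewrite mulrC divfK // gt_eqF // mulr_gt0.
by apply: form_dist => //; [case: (h1 m b1)|case: (h1 n a1)|exact: h2|exact: h3].
Qed.

Hypothesis hcl : closable D t.

Lemma fcvg_form_unique us (us' : nat -> H) vs (vs' : nat -> H) u v (l l' : R[i]^o) :
  fcvg us u -> fcvg us' u -> fcvg vs v -> fcvg vs' v ->
  (fun n => t (us n) (vs n)) @ \oo --> l ->
  (fun n => t (us' n) (vs' n)) @ \oo --> l' -> l = l'.
Proof.
move=> hu hu' hv hv' hl hl'.
have z (a_ b_ : nat -> H) c : fcvg a_ c -> fcvg b_ c -> forall e : R, 0 < e ->
    exists N, forall n, (N <= n)%N -> sn t (a_ n - b_ n) <= e.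
  move=> ha hb; apply: (closableP.1 hcl (fun n => a_ n - b_ n)).
  have := fcvg_lin (-1) hb ha; rewrite scaleN1r addNr.
  congr (fcvg _ _).
  by apply/funext => n; rewrite scaleN1r addrC.
suff hd : (fun n => t (us n) (vs n) - t (us' n) (vs' n) : R[i]^o) @ \oo --> (0 : R[i]^o).
  have hd' : (fun n => t (us n) (vs n) - t (us' n) (vs' n) : R[i]^o) @ \oo --> (l - l' : R[i]^o).
    exact: (cvgB hl hl').
  by apply/eqP; rewrite -subr_eq0; apply/eqP; exact: (cvg_unique _ hd' hd).
have [M M0 [N1 h1]] := fcvg_bounded2 hu' hv.
have [u1 _ _] := hu; have [u'1 _ _] := hu'; have [v1 _ _] := hv; have [v'1 _ _] := hv'.
apply/cvgn_rnorm => e e0.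
have d0 : 0 < e / (2 * M) by rewrite divr_gt0 // mulr_gt0.
have [N2 h2] := z _ _ _ hu hu' _ d0; have [N3 h3] := z _ _ _ hv hv' _ d0.
exists (maxn N1 (maxn N2 N3)) => n.
rewrite !geq_max => /andP[a1 /andP[a2 a3]]; rewrite subr0 rnormc.
have -> : e = 2 * M * (e / (2 * M)) by rewrite mulrC divfK // gt_eqF // mulr_gt0.
have [b1 b2] := h1 n a1.
by apply: form_dist => //; [exact: h2|exact: h3].
Qed.

Local Notation E := (energy_space D t).
Local Notation tb := (form_closure D t).

Lemma energyP u : E u <-> exists us, fcvg us u.
Proof. by split=> -[us hu]; exists us; apply/form_cvgP. Qed.

Lemma form_closure_cvg us vs u v : fcvg us u -> fcvg vs v ->
  (fun n => t (us n) (vs n)) @ \oo --> (tb u v : R[i]^o).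
Proof.
move=> hu hv; have [l hl] := fcvg_form hu hv.
pose P := [set l : R[i]^o | exists us vs : nat -> H,
    [/\ form_cvg D t us u, form_cvg D t vs v & (fun n => t (us n) (vs n)) @ \oo --> l]].
have Pl : P l by exists us, vs; split; [exact/form_cvgP|exact/form_cvgP|exact: hl].
have [us' [vs' [/form_cvgP hu' /form_cvgP hv' hl']]] : P (tb u v).
  exact: (@xgetI _ 0 P l Pl).
by rewrite (fcvg_form_unique hu' hu hv' hv hl' hl).
Qed.

Lemma energy_sub u : D u -> E u.
Proof. by move=> hu; apply/energyP; exists (fun=> u); exact: fcvg_cst. Qed.

Lemma form_closureE u v : D u -> D v -> tb u v = t u v.
Proof.
move=> hu hv; have h := form_closure_cvg (fcvg_cst hu) (fcvg_cst hv).
have h2 : (fun n : nat => t u v) @ \oo --> (t u v : R[i]^o) by exact: cvg_cst.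
exact: (cvg_unique _ h h2).
Qed.

Lemma closure_psd : psd E tb.
Proof.
split.
- split; first exact/energy_sub/(sub0 sD).
  move=> a u v /energyP[us hu] /energyP[vs hv]; apply/energyP.
  by exists (fun n => a *: us n + vs n); exact: fcvg_lin.
- move=> a u v w /energyP[us hu] /energyP[vs hv] /energyP[ws hw].
  have h1 := form_closure_cvg (fcvg_lin a hu hv) hw.
  have h2 : (fun n => a * t (us n) (ws n) + t (vs n) (ws n) : R[i]^o) @ \oo -->
      (a * tb u w + tb v w : R[i]^o).
    have hc : (fun n : nat => a : R[i]^o) @ \oo --> (a : R[i]^o) by exact: cvg_cst.
    exact: (cvgD (cvgM hc (form_closure_cvg hu hw)) (form_closure_cvg hv hw)).
  have [u1 _ _] := hu; have [v1 _ _] := hv; have [w1 _ _] := hw.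
  move: h1; have -> : (fun n => t (a *: us n + vs n) (ws n)) =
     (fun n => a * t (us n) (ws n) + t (vs n) (ws n)).
    by apply/funext => n; rewrite (psd_lin pt).
  by move=> h1; exact: (cvg_unique _ h1 h2).
- move=> u v /energyP[us hu] /energyP[vs hv].
  have h1 := form_closure_cvg hv hu; have h2 := form_closure_cvg hu hv.
  have [u1 _ _] := hu; have [v1 _ _] := hv.
  have h3 : (fun n => t (vs n) (us n)) @ \oo --> ((tb u v)^* : R[i]^o).
    have -> : (fun n => t (vs n) (us n)) = (fun n => (t (us n) (vs n))^* : R[i]^o).
      by apply/funext => n; rewrite (psd_herm pt).
    have Rc (x : R[i]) : complex.Re x^* = complex.Re x by case: x.
    have Ic (x : R[i]) : complex.Im x^* = - complex.Im x by case: x.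
    apply: complex_cvg.
      by rewrite Rc; under eq_fun do rewrite Rc; exact: cvg_Re.
    by rewrite Ic; under eq_fun do rewrite Ic; apply: cvgN; exact: cvg_Im.
  exact: (cvg_unique _ h1 h3).
- move=> u /energyP[us hu]; have h := form_closure_cvg hu hu.
  have [u1 _ _] := hu.
  have hR : 0 <= complex.Re (tb u u).
    apply: (ler_cvg_to (cvg_cst 0) (cvg_Re h)); near=> n; exact: (qf_ge0 pt).
  have hI : complex.Im (tb u u) = 0.
    have h2 := cvg_Im h.
    have e0 : (fun n => complex.Im (t (us n) (us n))) = (fun=> 0).
      by apply/funext => n; exact: (ger0_Im (psd_ge0 pt (u1 n))).
    have h3 : (fun n : nat => 0 : R) @ \oo --> (0 : R) by exact: cvg_cst.
    by move: h2; rewrite e0 => h2; exact: (cvg_unique _ h2 h3).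
  by rewrite lecE /= hI eqxx.
Unshelve. all: by end_near. Qed.

Lemma closure_sn us u : fcvg us u -> forall e : R, 0 < e ->
  exists N, forall n, (N <= n)%N -> sn tb (us n - u) <= e.
Proof.
move=> hu e e0; have [u1 _ /(_ e e0)[N hN]] := hu.
exists N => n hn; have Eu : E u by apply/energyP; exists us.
have En : E (us n) := energy_sub (u1 n).
have hnu := subB (psd_sub closure_psd) En Eu.
rewrite -(ler_pXn2r (n := 2)) ?nnegrE ?sn_ge0 ?(ltW e0) // (sn_sqr closure_psd hnu).
have hd := fcvg_lin (-1) hu (fcvg_cst (u1 n)).
have h := cvg_Re (form_closure_cvg hd hd).
rewrite [-1 *: u + us n]addrC scaleN1r in h.
rewrite /qf; apply: (ler_cvg_to h (cvg_cst (e ^+ 2))).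
exists N => // m hm /=; rewrite scaleN1r addrC -/(qf t _).
by rewrite -(sn_le _ (ltW e0)) ?hN //; exact: (subB sD).
Qed.

Lemma closure_sn_lim us u (M : R) : fcvg us u -> 0 <= M ->
  (forall n, sn t (us n) <= M) -> sn tb u <= M.
Proof.
move=> hu M0 hM; have Eu : E u by apply/energyP; exists us.
rewrite -(ler_pXn2r (n := 2)) ?nnegrE ?sn_ge0 // (sn_sqr closure_psd Eu).
have h := cvg_Re (form_closure_cvg hu hu); have [u1 _ _] := hu.
rewrite /qf; apply: (ler_cvg_to h (cvg_cst (M ^+ 2))); near=> n.
by rewrite -/(qf t _) -(sn_le (u1 n) M0).
Unshelve. all: by end_near. Qed.

Lemma closure_dense u (e : R) : E u -> 0 < e ->
  exists2 d, D d & rnorm (d - u) <= e /\ sn tb (d - u) <= e.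
Proof.
move=> /energyP[us hu] e0; have [N1 h1] := closure_sn hu e0.
have [u1 u2 _] := hu; have [N2 h2] := u2 _ e0.
exists (us (maxn N1 N2)) => //; split.
  by apply: h2; rewrite leq_maxr.
by apply: h1; rewrite leq_maxl.
Qed.

(** The energy space is complete: a Cauchy sequence in it is shadowed by one in
    [D]. *)
Lemma closure_complete us u : (forall n, E (us n)) ->
  (forall e : R, 0 < e -> exists N, forall n, (N <= n)%N -> rnorm (us n - u) <= e) ->
  (forall e : R, 0 < e -> exists N, forall n m, (N <= n)%N -> (N <= m)%N ->
      sn tb (us n - us m) <= e) ->
  E u /\ forall e : R, 0 < e -> exists N, forall n, (N <= n)%N -> sn tb (us n - u) <= e.
Proof.
move=> h1 h2 h3; have pc := closure_psd; have sE := psd_sub pc.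
have /choice[d hd] : forall n, exists d, D d /\
    rnorm (d - us n) <= n.+1%:R^-1 /\ sn tb (d - us n) <= n.+1%:R^-1.
  by move=> n; have [|d] := @closure_dense (us n) (n.+1%:R^-1) (h1 n); [rewrite invr_gt0|exists d].
have inv := @harmonic_small R.
have third e : 0 < e -> 0 < e / 3 :> R by move=> ?; rewrite divr_gt0.
have Ed n : E (d n) by apply: energy_sub; have [] := hd n.
have hf : fcvg d u.
  split=> [n|e e0|e e0]; first by have [] := hd n.
    have [N1 k1] := inv _ (third _ e0); have [N2 k2] := h2 _ (third _ e0).
    exists (maxn N1 N2) => n; rewrite geq_max => /andP[n1 n2].
    have -> : d n - u = (d n - us n) + (us n - u) by rewrite addrA subrK.
    apply: (le_trans (rnormD _ _)); have [_ [r1 _]] := hd n.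
    have q1 := le_trans r1 (k1 n n1); have q2 := k2 n n2; clear -q1 q2 e0; lra.
  have [N1 k1] := inv _ (third _ e0); have [N2 k2] := h3 _ (third _ e0).
  exists (maxn N1 N2) => n m; rewrite !geq_max => /andP[n1 n2] /andP[m1 m2].
  have [Dn [_ rn]] := hd n; have [Dm [_ rm]] := hd m.
  have -> : sn t (d n - d m) = sn tb (d n - d m).
    by rewrite /sn /qf form_closureE //; exact: (subB sD).
  have -> : d n - d m = (d n - us n) + ((us n - us m) - (d m - us m)).
    by rewrite opprB addrA addrA [d n - us n + (us n - us m)]addrA !subrK.
  have Enm := subB sE (h1 n) (h1 m).
  apply: (le_trans (snD pc (subB sE (Ed n) (h1 n)) (subB sE Enm (subB sE (Ed m) (h1 m))))).
  have q0 := snB pc Enm (subB sE (Ed m) (h1 m)).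
  have q1 := le_trans rn (k1 n n1); have q2 := le_trans rm (k1 m m1).
  by have q3 := k2 n m n2 m2; clear -q0 q1 q2 q3 e0; lra.
have Eu : E u by apply/energyP; exists d.
split=> // e e0; have e2 : 0 < e / 2 by rewrite divr_gt0.
have [N1 k1] := inv _ e2; have [N2 k2] := closure_sn hf e2.
exists (maxn N1 N2) => n; rewrite geq_max => /andP[n1 n2].
have -> : us n - u = (d n - u) - (d n - us n).
  by rewrite opprB addrCA [d n - u - d n]addrAC subrr add0r.
apply: (le_trans (snB pc (subB sE (Ed n) Eu) (subB sE (Ed n) (h1 n)))).
have [_ [_ r2]] := hd n; have q1 := le_trans r2 (k1 n n1); have q2 := k2 n n2.
by clear -q1 q2 e0; lra.
Qed.

End Closure.

Section BoundedLimit.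
Variables (R : realType) (H : completeNormedModType R[i]).
Variables (D : set H) (t : H -> H -> R[i]^o).
Hypothesis pt : psd D t.
Let sD := psd_sub pt.

(** Lower semicontinuity of the closure.  Among the vectors of [D] close to [u]
    whose form is bounded by [M], those that nearly minimise the form make a
    Cauchy sequence, by the parallelogram law. *)
Lemma bounded_limit (u : H) (M : R) : 0 <= M ->
  (forall e : R, 0 < e -> exists c, [/\ D c, rnorm (c - u) <= e & sn t c <= M]) ->
  exists us, fcvg D t us u /\ forall n, sn t (us n) <= M.
Proof.
move=> M0 hu.
pose K n c := [/\ D c, rnorm (c - u) <= n.+1%:R^-1 & sn t c <= M].
pose A n := [set qf t c | c in K n].
have A0 n : A n !=set0.
  by have [|c hc] := hu (n.+1%:R^-1); [rewrite invr_gt0|exists (qf t c), c].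
have lbA n : lbound (A n) 0 by move=> _ [c [hc _ _] <-]; exact: (qf_ge0 pt).
have infA n : has_inf (A n) by split; [exact: A0|exists 0].
pose m n := inf (A n).
have mle n c : K n c -> m n <= qf t c.
  by move=> hc; apply: ge_inf; [exists 0|exists c].
have Kmono n k : (n <= k)%N -> forall c, K k c -> K n c.
  move=> nk c [h1 h2 h3]; split => //; apply: (le_trans h2).
  by rewrite lef_pV2 ?posrE ?ltr0n // ler_nat ltnS.
have mM n : m n <= M ^+ 2.
  have [_ [c hc _]] := A0 n; apply: (le_trans (mle n c hc)).
  by case: hc => hD _; rewrite (sn_le pt hD M0).
have mmono n k : (n <= k)%N -> m n <= m k.
  by move=> nk; apply: lb_le_inf => // _ [c hc <-]; apply: mle; exact: Kmono hc.
have /choice[c hc] : forall n, exists c, K n c /\ qf t c <= m n + n.+1%:R^-1.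
  move=> n; have e0 : 0 < n.+1%:R^-1 :> R by rewrite invr_gt0.
  have [_ [c hc <-] hlt] := inf_adherent e0 (infA n).
  by exists c; split => //; exact: ltW.
have hcD n : D (c n) by have [[]] := hc n.
have inv := @harmonic_small R.
exists c; split; last by move=> n; have [[]] := hc n.
split => // [e e0|e e0].
  have [N hN] := inv _ e0; exists N => n hn.
  by have [[_ h _] _] := hc n; exact: le_trans h (hN n hn).
have e2 : 0 < e ^+ 2 / 8 by rewrite divr_gt0 ?exprn_gt0.
pose s := sup (range m).
have hs : has_sup (range m).
  by split; [exists (m 0%N), 0%N|exists (M ^+ 2) => _ [n _ <-]].
have [_ [N1 _ <-] hN1] := sup_adherent e2 hs.
have [N2 hN2] := inv _ e2.
exists (maxn N1 N2) => n k hn hk; rewrite (sn_le pt); [|exact: (subB sD)|exact: ltW].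
wlog nk : n k hn hk / (n <= k)%N.
  move=> h; have [/h|/ltnW/h] := leqP n k; first exact.
  by rewrite (qf_distC pt) //; exact.
move: hn hk; rewrite !geq_max => /andP[n1 n2] /andP[k1 k2].
have [Kn qn] := hc n; have [Kk qk] := hc k.
have Dh : D (c n + c k) by exact: (subD sD).
have mid : K n (2^-1 *: (c n + c k)).
  have [_ r1 s1] := Kn; have [_ r2 s2] := Kmono n k nk _ Kk.
  have nh : normc (2^-1 : R[i]) = 2^-1.
    by rewrite normcV -[2 : R[i]](rmorph_nat (real_complex R)) normc_real ger0_norm.
  split; first exact: (subZ sD).
    have -> : 2^-1 *: (c n + c k) - u = 2^-1 *: ((c n - u) + (c k - u)).
      rewrite addrACA -opprD scalerBr; congr (_ - _).
      have -> : u + u = (1 + 1 : R[i]) *: u by rewrite scalerDl scale1r.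
      by rewrite scalerA mulVf ?scale1r // pnatr_eq0.
    rewrite rnormZ nh; have q := rnormD (c n - u) (c k - u).
    by clear -r1 r2 q; move: (n.+1%:R^-1) r1 r2 => a r1 r2; lra.
  rewrite (snZ pt) // nh; have q := snD pt (hcD n) (hcD k).
  by clear -s1 s2 q; lra.
have := mle _ _ mid; rewrite (qfZ pt) //.
have -> : normc (2^-1 : R[i]) ^+ 2 = 4^-1.
  rewrite normcV -[2 : R[i]](rmorph_nat (real_complex R)) normc_real ger0_norm //.
  by rewrite exprVn -natrX.
have par := parallelogram pt (hcD n) (hcD k).
have b1 : m k <= s by apply: ub_le_sup; [exact: hs.2|exists k].
have b2 := mmono _ _ n1; have b3 := hN2 n n2; have b4 := hN2 k k2.
move=> b5; have b6 : m N1 <= m n by exact: mmono.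
rewrite -/s in hN1.
clear -par b1 b3 b4 b5 b6 hN1 qn qk e2.
move: (n.+1%:R^-1) (k.+1%:R^-1) b3 b4 qn qk => x y *; lra.
Qed.

End BoundedLimit.

(** * Comparison of two closable forms *)

Section Compare.
Variables (R : realType) (H : completeNormedModType R[i]).
Implicit Types (t : H -> H -> R[i]) (u v : H).

(** Equivalent to the energy norm, but a sum of two seminorms, and with a
    weight [r] chosen later so as to make the resolvent bounds free of
    constants. *)
Definition wnorm (r : R) t u : R := r * rnorm u + sn t u.

Section Wnorm.
Variables (r : R) (D : set H) (t : H -> H -> R[i]).
Hypotheses (r0 : 0 < r) (pt : psd D t).

Lemma wnorm_ge0 u : 0 <= wnorm r t u.
Proof. by rewrite addr_ge0 ?sn_ge0 // mulr_ge0 ?rnorm_ge0 // ltW. Qed.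

Lemma wnormD u v : D u -> D v -> wnorm r t (u + v) <= wnorm r t u + wnorm r t v.
Proof.
move=> hu hv; have h1 := rnormD u v; have h2 := snD pt hu hv.
have := ler_wpM2l (ltW r0) h1; rewrite /wnorm; lra.
Qed.

Lemma wnormN u : D u -> wnorm r t (- u) = wnorm r t u.
Proof. by move=> hu; rewrite /wnorm rnormN (snN pt). Qed.

Lemma wnormB u v : D u -> D v -> wnorm r t (u - v) <= wnorm r t u + wnorm r t v.
Proof.
move=> hu hv; rewrite -[X in _ <= _ + X](wnormN hv) wnormD //.
by rewrite -scaleN1r; exact: (subZ (psd_sub pt)).
Qed.

Lemma wnorm_distC u v : D u -> D v -> wnorm r t (u - v) = wnorm r t (v - u).
Proof. by move=> hu hv; rewrite /wnorm rnorm_distC (sn_distC pt). Qed.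

Lemma wnorm_tri u v w : D u -> D v -> D w ->
  wnorm r t (u - w) <= wnorm r t (u - v) + wnorm r t (v - w).
Proof.
move=> hu hv hw; have sD := psd_sub pt.
have -> : u - w = (u - v) + (v - w) by rewrite addrA subrK.
by apply: wnormD; exact: (subB sD).
Qed.

Lemma sn_wnorm u : sn t u <= wnorm r t u.
Proof. by rewrite /wnorm lerDr mulr_ge0 ?rnorm_ge0 // ltW. Qed.

Lemma rnorm_wnorm u : r * rnorm u <= wnorm r t u.
Proof. by rewrite /wnorm lerDl sn_ge0. Qed.

End Wnorm.

Variables (D0 D1 : set H) (t0 t1 : H -> H -> R[i]^o) (r : R).
Hypotheses (r0 : 0 < r) (p0 : psd D0 t0) (p1 : psd D1 t1) (cl0 : closable D0 t0).
Local Notation E0 := (energy_space D0 t0).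
Local Notation b0 := (form_closure D0 t0).
Local Notation E1 := (energy_space D1 t1).
Local Notation b1 := (form_closure D1 t1).
Local Notation N0 := (wnorm r b0).
Local Notation N1 := (wnorm r t1).

(** [pair p q] relates [p = B z1 f] to [q = B z f] for a common right-hand side
    [f], where [B] is the resolvent.  As [q - p] has at most half the norm of [p],
    the vectors [q] are dense in the energy space of the first form, like the
    vectors [p]. *)
Variable pair : H -> H -> Prop.
Hypothesis pair_dom : forall p q, pair p q -> D0 p /\ D1 q.
Hypothesis pair_l : forall p, D0 p -> exists q, pair p q.
Hypothesis pair_r : forall q, D1 q -> exists p, pair p q.
Hypothesis pair_E : forall p q, pair p q -> E0 q.
Hypothesis pair_H : forall p q, pair p q -> r * rnorm (q - p) <= 2^-1 * sn t0 p.
Hypothesis pair_near : forall p q, pair p q -> N0 (q - p) <= 2^-1 * N0 p.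
Hypothesis pair_le : forall p q, pair p q -> sn t1 q <= 2 * sn t0 p.
Hypothesis pair_ge : forall p q, pair p q -> sn t0 p <= 2 * sn t1 q.

Let pc0 := closure_psd p0 cl0.
Let sE0 := psd_sub pc0.
Let sD1 := psd_sub p1.

Let snb u : D0 u -> sn b0 u = sn t0 u.
Proof. by move=> hu; rewrite /sn /qf (form_closureE p0 cl0). Qed.

Let D1E q : D1 q -> E0 q.
Proof. by move=> /pair_r[p]; exact: pair_E. Qed.

Let D0E p : D0 p -> E0 p.
Proof. exact: (energy_sub p0). Qed.

Let N01 q : D1 q -> N0 q <= 5 * N1 q.
Proof.
move=> hq; have [p hp] := pair_r hq; have [dp _] := pair_dom hp.
have hE := D1E hq; have hEp := D0E dp.
have h1 := pair_H hp; have h2 := pair_near hp; have h3 := pair_ge hp.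
have h4 : N0 q <= N0 p + N0 (q - p).
  rewrite -{1}(subrK p q) addrC; apply: (wnormD r0 pc0) => //.
  exact: (subB sE0).
have h5 : r * rnorm p <= r * rnorm q + r * rnorm (q - p).
  rewrite -mulrDr ler_wpM2l ?(ltW r0) // -{1}[p](subKr q).
  exact: rnormB.
have h6 := mulr_ge0 (ltW r0) (rnorm_ge0 q); have h7 := sn_ge0 t1 q.
move: h1 h2 h3 h4 h5 h6 h7; rewrite /wnorm (snb dp).
by move: (sn b0 q) (sn b0 (q - p)) (sn t0 p) (sn t1 q) (r * rnorm q) (r * rnorm p)
  (r * rnorm (q - p)) => x1 x2 x3 x4 x5 x6 x7 *; lra.
Qed.

Let N10 q : D1 q -> N1 q <= 5 * N0 q.
Proof.
move=> hq; have [p hp] := pair_r hq; have [dp _] := pair_dom hp.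
have hE := D1E hq; have hEp := D0E dp.
have h2 := pair_near hp; have h3 := pair_le hp.
have h4 : N0 p <= N0 q + N0 (q - p).
  rewrite -{1}[p](subKr q); apply: (wnormB r0 pc0) => //.
  exact: (subB sE0).
have h6 := mulr_ge0 (ltW r0) (rnorm_ge0 p).
have h7 := mulr_ge0 (ltW r0) (rnorm_ge0 q).
have h8 := sn_ge0 b0 q.
move: h2 h3 h4 h6 h7 h8; rewrite /wnorm (snb dp).
by move: (sn b0 q) (sn b0 (q - p)) (sn t0 p) (sn t1 q) (r * rnorm q) (r * rnorm p)
  (r * rnorm (q - p)) => x1 x2 x3 x4 x5 x6 x7 *; lra.
Qed.

(** Each step [u - q], where [q] is paired with a good approximation of [u] in
    [D0], multiplies the distance to [D1] by at most 3/4. *)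
Let pair_step k : forall u, E0 u -> exists2 q, D1 q & N0 (u - q) <= (3 / 4) ^+ k * N0 u.
Proof.
elim: k => [|k IH] u hu.
  by exists 0; [exact: (sub0 sD1)|rewrite subr0 mul1r].
have Nu := wnorm_ge0 b0 r0 u.
move: (Nu); rewrite le_eqVlt => /predU1P[z|Npos].
  exists 0; first exact: (sub0 sD1).
  by rewrite subr0 -z mulr0.
have r1 : 0 < r + 1 by rewrite addr_gt0.
have e0 : 0 < 6^-1 * N0 u / (r + 1) by rewrite divr_gt0 // mulr_gt0.
have [p dp [hp1 hp2]] := closure_dense p0 cl0 hu e0.
have Ep := D0E dp.
have hup : N0 (u - p) <= 6^-1 * N0 u.
  rewrite (wnorm_distC r pc0) // /wnorm.
  have := ler_wpM2l (ltW r0) hp1 => q.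
  apply: (le_trans (lerD q hp2)).
  rewrite -[X in _ + X]mul1r -mulrDl mulrC divfK //.
  by rewrite gt_eqF.
have [q hq] := pair_l dp; have [_ dq] := pair_dom hq; have Eq := pair_E hq.
have huq : N0 (u - q) <= 3 / 4 * N0 u.
  have h1 := wnorm_tri r0 pc0 hu Ep Eq; have h2 := pair_near hq.
  have h3 := wnorm_distC r pc0 Ep Eq.
  have h4 : N0 p <= N0 u + N0 (u - p).
    by rewrite -{1}[p](subKr u); apply: (wnormB r0 pc0) => //; exact: (subB sE0).
  lra.
have [q' dq' hq'] := IH (u - q) (subB sE0 hu Eq).
exists (q + q'); first exact: (subD sD1).
rewrite opprD addrA; apply: (le_trans hq'); rewrite exprSr -mulrA.
by apply: ler_wpM2l huq; rewrite exprn_ge0.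
Qed.

Let approx u (e : R) : E0 u -> 0 < e -> exists2 q, D1 q & N0 (q - u) <= e.
Proof.
move=> hu e0; have h0 : 0 <= 3 / 4 :> R by lra.
have h1 : 3 / 4 < 1 :> R by lra.
have [n /(_ n (leqnn n)) hn] := geometric_small (N0 u) h0 h1 e0.
have [q dq hq] := pair_step n hu; exists q => //.
rewrite (wnorm_distC r pc0 (D1E dq) hu); apply: (le_trans hq).
by rewrite mulrC.
Qed.

Let fcvg_N0 us u : fcvg D1 t1 us u -> E0 u /\
  forall e : R, 0 < e -> exists N, forall n, (N <= n)%N -> N0 (us n - u) <= e.
Proof.
move=> [h1 h2 h3].
have hN e : 0 < e -> 0 < e / r by move=> ?; rewrite divr_gt0.
have half e : 0 < e -> 0 < e / 2 :> R by move=> ?; rewrite divr_gt0.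
have h2r e : 0 < e -> exists N, forall n, (N <= n)%N -> r * rnorm (us n - u) <= e.
  move=> e0; have [N k] := h2 _ (hN _ e0); exists N => n /k.
  by rewrite ler_pdivlMr // mulrC.
have [|||Eu hE] := @closure_complete R H D0 t0 p0 cl0 us u.
- by move=> n; exact/D1E.
- exact: h2.
- move=> e e0; have e10 : 0 < e / 20 by rewrite divr_gt0.
  have [n1 k1] := h2r _ e10; have [n2 k2] := h3 _ e10.
  exists (maxn n1 n2) => n m; rewrite !geq_max => /andP[a1 a2] /andP[b1 b2].
  apply: (le_trans (sn_wnorm b0 r0 _)); apply: (le_trans (N01 (subB sD1 (h1 n) (h1 m)))).
  have q0 : rnorm (us n - us m) <= rnorm (us n - u) + rnorm (us m - u).
    have -> : us n - us m = (us n - u) - (us m - u).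
      by rewrite opprB addrA subrK.
    exact: rnormB.
  have q1 := ler_wpM2l (ltW r0) q0; have q2 := k1 n a1; have q3 := k1 m b1.
  have q4 := k2 n m a2 b2; rewrite /wnorm.
  lra.
split=> // e e0; have [n1 k1] := h2r _ (half _ e0); have [n2 k2] := hE _ (half _ e0).
exists (maxn n1 n2) => n; rewrite geq_max => /andP[a1 a2].
by have := k1 n a1; have := k2 n a2; rewrite /wnorm; lra.
Qed.

(** A sequence of [D1] that is Cauchy for the second form converges in the
    complete space [E0]; if its limit in [H] vanishes, so does its limit in
    [E0], hence its forms tend to 0. *)
Lemma compare_closable : closable D1 t1.
Proof.
apply/(closableP p1) => us hu e e0; have [_ h] := fcvg_N0 hu.
have e5 : 0 < e / 5 by rewrite divr_gt0.
have [N hN] := h _ e5; exists N => n /hN; rewrite subr0 => hn.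
have [u1 _ _] := hu; apply: (le_trans (sn_wnorm t1 r0 _)); apply: (le_trans (N10 (u1 n))).
lra.
Qed.

Let pc1 := closure_psd p1 compare_closable.

Lemma compare_space : E1 = E0.
Proof.
apply/seteqP; split=> u; first by move/(energyP p1) => [us /fcvg_N0[]].
move=> hu; apply/(energyP p1).
have half e : 0 < e -> 0 < e / 10 :> R by move=> ?; rewrite divr_gt0.
have /choice[q hq] : forall n, exists q, D1 q /\ N0 (q - u) <= n.+1%:R^-1.
  by move=> n; have [|q] := @approx u (n.+1%:R^-1) hu; [rewrite invr_gt0|exists q].
have inv := @harmonic_small R.
exists q; split=> [n|e e0|e e0]; first by have [] := hq n.
  have [N hN] := inv _ (mulr_gt0 r0 e0); exists N => n hn; have [_ h] := hq n.
  rewrite -(ler_pM2l r0); apply: (le_trans (rnorm_wnorm r b0 _)).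
  exact: le_trans h (hN n hn).
have [N hN] := inv _ (half _ e0); exists N => n m hn hm.
have [dn kn] := hq n; have [dm km] := hq m.
apply: (le_trans (sn_wnorm t1 r0 _)); apply: (le_trans (N10 (subB sD1 dn dm))).
have q1 := wnorm_tri r0 pc0 (D1E dn) hu (D1E dm).
rewrite [N0 (u - q m)](wnorm_distC r pc0 hu (D1E dm)) in q1.
have q2 := le_trans kn (hN n hn); have q3 := le_trans km (hN m hm).
lra.
Qed.

Let approx2 u (e : R) : E0 u -> 0 < e ->
  exists q, [/\ D1 q, N0 (q - u) <= e & wnorm r b1 (q - u) <= e].
Proof.
move=> hu e0; have := hu; rewrite -compare_space => hu1.
have [us hus] := (energyP p1 _).1 hu1.
have [_ h1] := fcvg_N0 hus; have [n1 k1] := h1 _ e0.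
have e2 : 0 < e / 2 by rewrite divr_gt0.
have [n2 k2] := closure_sn p1 compare_closable hus e2.
have [d1 d2 _] := hus; have er : 0 < e / 2 / r by rewrite divr_gt0.
have [n3 k3] := d2 _ er.
pose n := maxn n1 (maxn n2 n3).
exists (us n); split; [exact: d1|by apply: k1; rewrite leq_maxl|].
have q2 := k2 n; have q3 := k3 n.
rewrite /wnorm; have := q2 (leq_trans (leq_maxl _ _) (leq_maxr _ _)).
have := q3 (leq_trans (leq_maxr _ _) (leq_maxr _ _)).
rewrite ler_pdivlMr // mulrC => a b; lra.
Qed.

Let snb1 u : D1 u -> wnorm r b1 u = N1 u.
Proof. by move=> hu; rewrite /wnorm /sn /qf (form_closureE p1 compare_closable). Qed.

(** Both bounds hold on [D1], which is dense in either space. *)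
Lemma compare_norm u : E0 u -> wnorm r b1 u <= 5 * N0 u /\ N0 u <= 5 * wnorm r b1 u.
Proof.
move=> hu; have hu1 : E1 u by rewrite compare_space.
have key : forall e : R, 0 < e -> e <= 1 ->
   wnorm r b1 u <= 5 * N0 u + 6 * e /\ N0 u <= 5 * wnorm r b1 u + 6 * e.
  move=> e e0 _; have [q [dq h0 h1]] := approx2 hu e0.
  have Eq0 := D1E dq; have Eq1 := energy_sub p1 dq.
  have a0 := N01 dq; have a1 := N10 dq; rewrite -(snb1 dq) in a0 a1.
  have c1 : N0 u <= N0 q + N0 (q - u).
    by rewrite -{1}[u](subKr q); apply: (wnormB r0 pc0) => //; exact: (subB sE0).
  have c2 : N0 q <= N0 (q - u) + N0 u.
    by rewrite -{1}(subrK u q); apply: (wnormD r0 pc0) => //; exact: (subB sE0).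
  have c3 : wnorm r b1 u <= wnorm r b1 q + wnorm r b1 (q - u).
    rewrite -{1}[u](subKr q); apply: (wnormB r0 pc1) => //.
    exact: (subB (psd_sub pc1)).
  have c4 : wnorm r b1 q <= wnorm r b1 (q - u) + wnorm r b1 u.
    rewrite -{1}(subrK u q); apply: (wnormD r0 pc1) => //.
    exact: (subB (psd_sub pc1)).
  split; lra.
by split; apply: (@le_small _ _ _ 6) => e e0 e1; have [] := key e e0 e1.
Qed.

End Compare.

(** * Dissipative operators and their Cayley transforms *)

Section Dissipative.
Variables (R : realType) (H : completeNormedModType R[i]).
Variable ip : {dot H for Num.conj}.
Hypothesis norm_ip : hilbert_norm ip.
Variable T : lin_op H.
Hypothesis disT : dissipative ip (graph T).
Implicit Types (u v f b : H).
Local Notation t := (im_form ip T).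

Lemma lop0 : T 0 = 0.
Proof.
have := lop_linear (-1 : R[i]) (dom_subspace T).1 (dom_subspace T).1.
by rewrite scaler0 addr0 scaleN1r addNr.
Qed.

Lemma im_part (z : R[i]) : (2 * 'i%C)^-1 * (z - z^*) = (complex.Im z)%:C.
Proof.
have i0 : 'i%C != 0 :> R[i] by rewrite eq_complex /= oner_eq0 andbF.
by rewrite subcJ mulrAC mulKf // mulf_neq0 // pnatr_eq0.
Qed.

Lemma im_formE u : t u u = (complex.Im (ip (T u) u))%:C.
Proof. by rewrite /im_form (ipC ip (T u)) im_part. Qed.

Lemma im_form_qf u : qf t u = complex.Im (ip (T u) u).
Proof. by rewrite /qf im_formE. Qed.

Lemma im_form_psd : psd (dom T) t.
Proof.
split; first exact: dom_subspace.
- move=> a u v w hu hv hw; rewrite /im_form (lop_linear _ hu hv).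
  by rewrite !ipDl !ipZl; ring.
- move=> u v hu hv; rewrite /im_form rmorphM rmorphB fmorphV rmorphM /=.
  rewrite -!ipC (rmorph_nat (@conjc R)).
  have -> : ('i%C : R[i])^* = - 'i%C by apply/eqP; rewrite eq_complex /= oppr0 !eqxx.
  by rewrite mulrN invrN mulNr -mulrN opprB.
- move=> u hu; have h := disT (conj hu (erefl (T u)) : graph T (u, T u)).
  by rewrite im_formE ler0c.
Qed.

Variable w : R[i].
Hypothesis w_up : 0 < complex.Im w.
Local Notation eta := (complex.Im w).
Variable B : {linear H -> H}.
Hypothesis hB : forall f u, B f = u <-> (dom T u /\ T u + w *: u = f).

Lemma resolvent_dom f : dom T (B f).
Proof. by have [/(_ erefl)[]] := hB f (B f). Qed.

Lemma resolventK f : T (B f) + w *: B f = f.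
Proof. by have [/(_ erefl)[]] := hB f (B f). Qed.

Lemma resolvent_shift b : dom T b -> B (T b + w *: b) = b.
Proof. by move=> hb; apply/hB. Qed.

(** The Cayley transform (T + conj w) (T + w)^-1. *)
Definition cayley f : H := f - ((2 * eta)%:C * 'i%C) *: B f.

Lemma w_conj : w - (2 * eta)%:C * 'i%C = w^*.
Proof. by case: (w) => x y; apply/eqP; rewrite eq_complex /=; apply/andP; split; apply/eqP; ring. Qed.

Lemma cayley_shift b : dom T b -> cayley (T b + w *: b) = T b + w^* *: b.
Proof.
by move=> hb; rewrite /cayley resolvent_shift // -addrA -scalerBl w_conj.
Qed.

Lemma cayley_linear a u v : cayley (a *: u + v) = a *: cayley u + cayley v.
Proof.
rewrite /cayley linearP scalerDr scalerBr !scalerA mulrC opprD !addrA.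
by congr (_ + _); rewrite addrAC.
Qed.

(** The identity that translates forms into geometry: dissipativity of [T] is
    contractivity of its Cayley transform, and the lack of isometry of the
    latter is the form of [T]. *)
Lemma cayley_defect f :
  rnorm f ^+ 2 - rnorm (cayley f) ^+ 2 = 4 * eta * qf t (B f).
Proof.
have hb := resolvent_dom f; have hf := resolventK f.
set b := B f in hb hf *; rewrite -hf cayley_shift //.
rewrite !(rnorm_sqrD norm_ip) !rnormZ normc_conj !ipZr im_form_qf.
by case: (w) (ip (T b) b) => p q [x y] /=; ring.
Qed.

Lemma cayley_contr f : rnorm (cayley f) <= rnorm f.
Proof.
rewrite -(ler_pXn2r (n := 2)) ?nnegrE ?rnorm_ge0 // -subr_ge0 cayley_defect.
by rewrite !mulr_ge0 ?(qf_ge0 im_form_psd) ?ltW //; exact: resolvent_dom.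
Qed.

Lemma rnorm_cauchy (us : nat -> H) :
  (forall e : R, 0 < e -> exists N, forall n m, (N <= n)%N -> (N <= m)%N ->
     rnorm (us n - us m) <= e) -> exists l : H, us @ \oo --> l.
Proof.
move=> h; apply/cvg_ex/cauchy_cvgP; apply: cauchy_exP => _ /gt0_real[e e0 ->].
have e2 : 0 < e / 2 by rewrite divr_gt0.
have [N hN] := h _ e2; exists (us N); exists N => // m /= hm.
rewrite -ball_normE /= rnormE ltcR.
by rewrite (le_lt_trans (hN _ _ (leqnn N) hm)) // ltr_pdivrMr // ltr_pMr // ltr1n.
Qed.

(** Since the Cayley transform is a contraction, this yields the resolvent at
    [w + i s] for [s >= 0] from the one at [w]. *)
Lemma neumann (r : R) u : 0 <= r -> r < 1 ->
  exists x, x = u + r%:C *: cayley x.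
Proof.
move=> r0 r1; pose xs n := iter n (fun x => u + r%:C *: cayley x) u.
have d0 : 0 < 1 - r by rewrite subr_gt0.
have nr : normc r%:C = r by rewrite normc_real ger0_norm.
have cB x y : cayley x - cayley y = cayley (x - y).
  by rewrite [x - y]addrC -[- y]scaleN1r cayley_linear scaleN1r addrC.
pose K := rnorm (xs 1%N - xs 0%N).
have K0 : 0 <= K := rnorm_ge0 _.
have step n : rnorm (xs n.+1 - xs n) <= r ^+ n * K.
  elim: n => [|n IH]; first by rewrite mul1r.
  have -> : xs n.+2 - xs n.+1 = r%:C *: cayley (xs n.+1 - xs n).
    by rewrite -cB scalerBr /= opprD addrACA subrr add0r.
  rewrite rnormZ nr exprS -mulrA ler_wpM2l // (le_trans (cayley_contr _)) //.
have tail n k : rnorm (xs (n + k)%N - xs n) <= r ^+ n * K / (1 - r).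
  have : rnorm (xs (n + k)%N - xs n) <= r ^+ n * K * ((1 - r ^+ k) / (1 - r)).
    elim: k => [|k IH].
      by rewrite addn0 subrr rnorm0 expr0 subrr mul0r mulr0.
    have -> : xs (n + k.+1)%N - xs n = (xs (n + k).+1 - xs (n + k)%N) + (xs (n + k)%N - xs n).
      by rewrite addrA subrK addnS.
    apply: (le_trans (rnormD _ _)); apply: (le_trans (lerD (step _) IH)).
    rewrite exprD le_eqVlt; apply/orP; left; apply/eqP; rewrite exprS; field.
    by rewrite gt_eqF.
  move/le_trans; apply.
  have q : (1 - r ^+ k) / (1 - r) <= (1 - r)^-1.
    by rewrite ler_piMl ?invr_ge0 ?(ltW d0) // gerBl exprn_ge0.
  have rK : 0 <= r ^+ n * K by rewrite mulr_ge0 ?exprn_ge0.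
  exact: ler_wpM2l rK _ _ q.
have small (e : R) : 0 < e -> exists N, r ^+ N * K / (1 - r) <= e.
  move=> e0; have [N /(_ N (leqnn N)) h] := geometric_small (K / (1 - r)) r0 r1 e0.
  by exists N; rewrite -mulrA mulrC.
have [x hx] : exists l : H, xs @ \oo --> l.
  apply: rnorm_cauchy => e e0; have e2 : 0 < e / 2 by rewrite divr_gt0.
  have [N hN] := small _ e2; exists N => n m hn hm.
  have -> : xs n - xs m = (xs n - xs N) - (xs m - xs N) by rewrite opprB addrA subrK.
  have := tail N (n - N)%N; have := tail N (m - N)%N; rewrite !subnKC // => q1 q2.
  by apply: (le_trans (rnormB _ _)); lra.
exists x; apply/eqP; rewrite -subr_eq0 -rnorm_eq0 eq_le rnorm_ge0 andbT.
apply: (@le_small _ _ _ 2) => e e0 _; rewrite add0r.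
move/cvgn_rnorm: hx => /(_ _ e0)[N hN].
have -> : x - (u + r%:C *: cayley x) = r%:C *: cayley (xs N - x) - (xs N.+1 - x).
  rewrite -cB [xs N.+1]/= -/(xs N); move: (cayley (xs N)) (cayley x) => a' b'.
  rewrite scalerBr; move: (r%:C *: a') (r%:C *: b') => a b.
  rewrite opprB addrCA; congr (_ + _).
  by rewrite [u + a]addrC !opprD [a - b]addrC addrA addrK addrC.
have q1 := hN N (leqnn N); have q2 := hN N.+1 (leqnSn N).
apply: (le_trans (rnormB _ _)); rewrite rnormZ nr.
have q3 := cayley_contr (xs N - x); have q4 := rnorm_ge0 (cayley (xs N - x)).
have q5 : r * rnorm (cayley (xs N - x)) <= 1 * rnorm (cayley (xs N - x)).
  by rewrite ler_wpM2r // ltW.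
lra.
Qed.

(** A vector [u] on which pairing with [(T + conj w) b] is controlled by the
    form is a limit of vectors of the domain with bounded form, namely of
    [i s (T + w + i s)^-1 u] as [s] grows. *)
Lemma regularize u (tau : R) : 0 <= tau -> eta * rnorm u ^+ 2 <= tau ^+ 2 ->
  (forall b, dom T b -> normc (ip u (T b + w^* *: b)) <= 2 * tau * sn t b) ->
  forall e : R, 0 < e -> exists b, [/\ dom T b, rnorm (b - u) <= e & sn t b <= 5 / 2 * tau].
Proof.
move=> tau0 hu hub e e0.
have e20 : 0 < e ^+ 2 by rewrite exprn_gt0.
(* With [x = u - b], [main] below gives [s |x|^2 <= 2 tau^2], hence [|x| <= e]. *)
pose s := 2 * tau ^+ 2 / e ^+ 2 + 1.
have s0 : 0 < s.
  by apply: ltr_wpDl; rewrite // divr_ge0 ?sqr_ge0 // mulr_ge0 ?sqr_ge0.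
have se : 2 * tau ^+ 2 <= s * e ^+ 2.
  by rewrite /s [leRHS]mulrDl divfK ?gt_eqF // mul1r lerDl ltW.
have d0 : 0 < 2 * eta + s by rewrite addr_gt0 // mulr_gt0.
pose r := s / (2 * eta + s).
have r0 : 0 <= r by rewrite divr_ge0 // ltW.
have r1 : r < 1 by rewrite ltr_pdivrMr // mul1r ltrDr mulr_gt0.
have [x hx] := neumann ((1 - r)%:C *: u) r0 r1.
pose b := u - x.
have bE : b = ('i%C * s%:C) *: B x.
  have q1 : (1 - r)%:C *: b = (r * (2 * eta))%:C *: ('i%C *: B x).
    have -> : (1 - r)%:C *: b = r%:C *: (x - cayley x).
      have E : (1 - r)%:C *: x = x - r%:C *: x.
        by rewrite rmorphB scalerBl scale1r.
      have h1 : (1 - r)%:C *: u = x - r%:C *: cayley x by rewrite {1}hx addrK.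
      rewrite /b [LHS]scalerBr E h1; move: (cayley x) => c; rewrite [RHS]scalerBr.
      by rewrite opprB addrC addrA subrK.
    rewrite /cayley opprB addrCA subrr addr0 !scalerA; congr (_ *: _).
    by rewrite !rmorphM /= !mulrA.
  have r10 : (1 - r)%:C != 0 :> R[i].
    by rewrite -(rmorph0 (real_complex R)) (inj_eq (@complexI R)) subr_eq0 gt_eqF.
  apply: (scalerI r10); rewrite q1 !scalerA; congr (_ *: _).
  have -> : r * (2 * eta) = (1 - r) * s by rewrite /r; field; rewrite gt_eqF.
  by rewrite (rmorphM (real_complex R)) /= -mulrA [s%:C * _]mulrC.
have db : dom T b by rewrite bE; apply: (subZ (dom_subspace T)); exact: resolvent_dom.
have hTb : T b + w *: b = ('i%C * s%:C) *: x.
  have dB := resolvent_dom x; have d00 := (dom_subspace T).1.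
  have -> : T b = ('i%C * s%:C) *: T (B x).
    by have := lop_linear ('i%C * s%:C) dB d00; rewrite addr0 -bE lop0 addr0.
  rewrite bE; move: ('i%C * s%:C) => k.
  by rewrite scalerA [w * k]mulrC -scalerA -scalerDr resolventK.
have uE : u = x + b by rewrite /b addrC subrK.
pose X := rnorm x ^+ 2; pose Bn := rnorm b ^+ 2; pose C := complex.Re (ip x b).
have qE : qf t b = s * C - eta * Bn.
  have -> : qf t b = complex.Im (ip (T b + w *: b) b) - eta * Bn.
    rewrite ipDl ipZl (ip_rnorm norm_ip) raddfD /= -im_form_qf.
    by rewrite /Bn; case: (w) => p q /=; ring.
  rewrite hTb ipZl /C; congr (_ - _).
  by case: (ip x b) => p q /=; ring.
have uN : rnorm u ^+ 2 = X + Bn + 2 * C by rewrite uE (rnorm_sqrD norm_ip).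
have pE : complex.Im (ip u (T b + w^* *: b)) = - (s * (X + C)) + 2 * eta * (Bn + C).
  have -> : T b + w^* *: b = ('i%C * s%:C) *: x - ((2 * eta)%:C * 'i%C) *: b.
    by rewrite -hTb -addrA -scalerBl w_conj.
  rewrite ipBr !ipZr.
  have -> : ip u x = X%:C + (ip x b)^*.
    by rewrite uE ipDl (ip_rnorm norm_ip) -ipC.
  have -> : ip u b = Bn%:C + ip x b.
    by rewrite uE ipDl (ip_rnorm norm_ip) addrC.
  rewrite /C; case: (ip x b) => p q /=; ring.
have hS := sn_sqr im_form_psd db; have S0 := sn_ge0 t b.
have := le_trans (normcIm _) (hub b db); rewrite pE ler_norml => /andP[k1 _].
set S := sn t b in hS S0 k1 *.
have X0 : 0 <= X by exact: sqr_ge0.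
(* Add the identity [qE] for the form to the bound on the pairing [pE]; what
   is left over is [eta |u|^2]. *)
have main : S ^+ 2 + s * X <= tau ^+ 2 + 2 * tau * S.
  have k2 : eta * X >= 0 by rewrite mulr_ge0 // ltW.
  have k3 := hu; rewrite uN in k3; rewrite hS qE; nra.
exists b; split => //.
- have -> : b - u = - x by rewrite /b addrC addKr.
  rewrite rnormN -(ler_pXn2r (n := 2)) ?nnegrE ?rnorm_ge0 ?(ltW e0) //.
  rewrite -(ler_pM2l s0); apply: le_trans se.
  have k4 := sqr_ge0 (tau - S); rewrite sqrrB in k4; rewrite -/X; lra.
- have sX : 0 <= s * X by rewrite mulr_ge0 // ltW.
  rewrite leNgt; apply/negP => hS2.
  have k5 : 0 < (S - 5 / 2 * tau) * (S + tau / 2).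
    have S1 : 0 < S by apply: le_lt_trans hS2; rewrite mulr_ge0.
    by apply: mulr_gt0; [rewrite subr_gt0|rewrite ltr_wpDr // divr_ge0].
  by have k6 := sqr_ge0 tau; lra.
Qed.

End Dissipative.

(** * Independence of the energy space of the spectral parameter *)

Section Holomorphic.
Variables (R : realType) (H : completeNormedModType R[i]).
Variable ip : {dot H for Num.conj}.
Hypothesis norm_ip : hilbert_norm ip.
Implicit Types (z a s : R[i]) (u v f g : H).

Lemma cderiv_affine (V : normedModType R[i]) (G : R[i]^o -> V) a s z (d : V) :
  cderiv G (a + s * z) d -> cderiv (fun z : R[i]^o => G (a + s * z)) z (s *: d).
Proof.
move=> hG e e0; have s1 : 0 < normc s + 1 by rewrite ltr_wpDl ?normc_ge0.
have es : 0 < e / (normc s + 1) by rewrite divr_gt0.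
have [r r0 hr] := hG _ es; exists (r / (normc s + 1)); first by rewrite divr_gt0.
move=> h; rewrite ltr_pdivlMr // => hh.
have hs : normc (s * h) <= normc h * (normc s + 1).
  by rewrite normcM mulrC ler_wpM2l ?normc_ge0 // lerDl.
have := hr (s * h) (le_lt_trans hs hh).
have -> : s * h + (a + s * z) = a + s * (h + z) by ring.
rewrite scalerA [h * s]mulrC => /le_trans; apply.
rewrite -mulrA ler_pM2l // mulrC ler_pdivrMr //.
Qed.

Lemma cderiv_ip (G : R[i]^o -> H) z (d g : H) :
  cderiv G z d -> cderiv (fun z => ip (G z) g : R[i]^o) z (ip d g).
Proof.
move=> hG e e0; have g1 : 0 < rnorm g + 1 by rewrite ltr_wpDl ?rnorm_ge0.
have es : 0 < e / (rnorm g + 1) by rewrite divr_gt0.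
have [r r0 hr] := hG _ es; exists r => // h /hr hh; rewrite rnormc.
have -> : ip (G (h + z)) g - ip (G z) g - h *: (ip d g : R[i]^o) =
   ip (G (h + z) - G z - h *: d) g by rewrite !ipBl ipZl.
apply: (le_trans (ip_CS norm_ip _ _)).
apply: (@le_trans _ _ (e / (rnorm g + 1) * normc h * (rnorm g + 1))).
  by apply: ler_pM; rewrite ?rnorm_ge0 // lerDl.
by rewrite mulrAC divfK // gt_eqF.
Qed.

Lemma op_derivable_cderiv (B : R[i]^o -> {linear H -> H}) z f :
  op_derivable B z -> exists d, cderiv (fun z => B z f) z d.
Proof.
case=> B' _ hB; exists (B' f) => e e0.
have f1 : 0 < rnorm f + 1 by rewrite ltr_wpDl ?rnorm_ge0.
have es : 0 < (e / (rnorm f + 1))%:C :> R[i] by rewrite ltcR divr_gt0.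
have := hB _ es => /nbhs_rnorm[r r0 hr]; exists r => // h hh.
have [->|h0] := eqVneq h 0.
  by rewrite add0r subrr scale0r subrr rnorm0 normc0 mulr0.
have := hr h; rewrite subr0 rnormc => /(_ hh h0 f).
rewrite !rnormE -rmorphM lecR => hle.
rewrite -[_ - _ - _](scalerKV (a := h)) // rnormZ mulrC.
rewrite ler_wpM2r ?normc_ge0 // scalerBr scalerK //.
apply: (le_trans hle); rewrite mulrAC ler_pdivrMr //.
by rewrite ler_wpM2l ?(ltW e0) // lerDl.
Qed.

(** With this scaling the disc of radius 3, which [cauchy_series] requires, stays
    in the upper half-plane. *)
Definition chart z1 (l : R[i]) : R[i] := z1 + (complex.Im z1 / 4)%:C * l.

Lemma chart0 z1 : chart z1 0 = z1.
Proof. by rewrite /chart mulr0 addr0. Qed.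

Lemma chart_up z1 l : 0 < complex.Im z1 -> normc l < 3 -> 0 < complex.Im (chart z1 l).
Proof.
move=> y0 hl; have hI := le_lt_trans (normcIm l) hl.
rewrite /chart raddfD /=; case: l hl hI => p q /= _; rewrite ltr_norml => /andP[h1 h2].
rewrite mul0r addr0; nra.
Qed.

Lemma pexp_chart (G : R[i]^o -> H) z1 (g : H) : 0 < complex.Im z1 ->
  (forall z, 0 < complex.Im z -> derivable G z 1) ->
  exists c K, pexp (fun l => ip (G (chart z1 l)) g) c K.
Proof.
move=> y0 hG; have [z hz|c [K [K0 hK]]] := @cauchy_series R
    (fun l => ip (G (chart z1 l)) g); last by exists c, K.
apply/derivable_cderiv.
have /derivable_cderiv[d hd] := hG _ (chart_up y0 hz).
by have := cderiv_ip g (cderiv_affine hd); exists (ip ((complex.Im z1 / 4)%:C *: d) g).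
Qed.

End Holomorphic.

Section Local.
Variables (R : realType) (H : completeNormedModType R[i]).
Variable ip : {dot H for Num.conj}.
Hypothesis norm_ip : hilbert_norm ip.
Variables (F : R[i]^o -> lin_op H) (w : R[i]) (B : R[i]^o -> {linear H -> H}).
Hypothesis w_up : 0 < complex.Im w.
Hypothesis disF : forall z, upper_half_plane R z -> dissipative ip (graph (F z)).
Hypothesis resF : forall z, upper_half_plane R z -> forall f u : H,
  B z f = u <-> (dom (F z) u /\ F z u + w *: u = f).
Hypothesis derF : forall z, upper_half_plane R z -> op_derivable B z.
Local Notation eta := (complex.Im w).
Local Notation Cp := (upper_half_plane R).
Local Notation tt z := (im_form ip (F z)).
Local Notation tc z := (tform_closure ip F z).
Local Notation W z := (wnorm (Num.sqrt eta) (tc z)).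

Lemma pform z : Cp z -> psd (dom (F z)) (tt z).
Proof. by move=> hz; exact: im_form_psd (disF hz). Qed.

Let re0 : 0 < Num.sqrt eta. Proof. by rewrite sqrtr_gt0. Qed.
Let reE : Num.sqrt eta ^+ 2 = eta. Proof. by rewrite sqr_sqrtr // ltW. Qed.

Section AtPoint.
Variable z1 : R[i].
Hypothesis z1_up : Cp z1.

Let C l := cayley w (B (chart z1 l)).

Let up l : normc l <= 1 -> Cp (chart z1 l).
Proof. by move=> h; apply: chart_up => //; apply: le_lt_trans h _; lra. Qed.

Let Clin l a u v : normc l <= 1 -> C l (a *: u + v) = a *: C l u + C l v.
Proof. by move=> _; exact: cayley_linear. Qed.

Let Ccontr l u : normc l <= 1 -> rnorm (C l u) <= rnorm u.
Proof. by move=> /up h; exact: (cayley_contr norm_ip (disF h) w_up (resF h)). Qed.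

Let Cexp f g : exists c K, pexp (fun l => ip (C l f) g) c K.
Proof.
apply: (@pexp_chart R H ip norm_ip (fun z => cayley w (B z) f)) => // z hz.
apply: derivableB; first exact: derivable_cst.
apply: derivableZ; apply/derivable_cderiv; apply: op_derivable_cderiv.
exact: derF.
Qed.

Let C0 f : C 0 f = cayley w (B z1) f.
Proof. by rewrite /C chart0. Qed.

Let defectE f : defect C f = 4 * eta * qf (tt z1) (B z1 f).
Proof. by rewrite /defect C0 (cayley_defect norm_ip (resF z1_up)). Qed.

Let sqrt_defect f : Num.sqrt (defect C f) = 2 * Num.sqrt eta * sn (tt z1) (B z1 f).
Proof.
rewrite defectE /sn sqrtrM ?mulr_ge0 ?(ltW w_up) // sqrtrM //.
have -> : (4 : R) = 2 ^+ 2 by rewrite -natrX.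
by rewrite sqrtr_sqr ger0_norm.
Qed.

Variable l : R[i].
(* Then [kap <= 1/8], small enough for the factors 1/2 and 2 of the comparison. *)
Hypothesis hl : normc l <= 9^-1.

Let l1 : normc l < 1. Proof. by apply: le_lt_trans hl _; lra. Qed.
Let kap := normc l / (1 - normc l).
Let kap0 : 0 <= kap.
Proof. by rewrite divr_ge0 ?normc_ge0 // subr_ge0 ltW. Qed.
Let kap8 : kap <= 8^-1.
Proof.
have h := hl; have d0 : 0 < 1 - normc l by rewrite subr_gt0.
by rewrite /kap ler_pdivrMr //; lra.
Qed.

Let diffE f : C l f - C 0 f = - ((2 * eta)%:C * 'i%C) *: (B (chart z1 l) f - B z1 f).
Proof. by rewrite C0 /C /cayley opprB addrCA addrAC subrr add0r scalerBr !scaleNr opprK addrC. Qed.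

Let norm_coef : normc (- ((2 * eta)%:C * 'i%C)) = 2 * eta.
Proof.
rewrite normc_opp normcM normc_i mulr1 normc_real ger0_norm // mulr_ge0 //.
exact: ltW.
Qed.

(** This and [near_form] are the Schwarz-Pick inequalities, in terms of the
    resolvent and the form. *)
Let near_norm f : Num.sqrt eta * rnorm (B (chart z1 l) f - B z1 f)
  <= kap * sn (tt z1) (B z1 f).
Proof.
have := schwarz_pick_norm norm_ip Clin Ccontr Cexp f l1.
rewrite diffE rnormZ norm_coef sqrt_defect -/kap -{1}reE.
set X := rnorm _; set S := sn _ _; set r := Num.sqrt eta => h.
have r2 : 0 < 2 * r by rewrite mulr_gt0.
by rewrite -(ler_pM2l r2); move: h; rewrite expr2; lra.
Qed.

Let near_form f b : dom (F z1) b ->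
  normc (ip (B (chart z1 l) f - B z1 f) (F z1 b + w^* *: b)) <=
    2 * (kap * sn (tt z1) (B z1 f)) * sn (tt z1) b.
Proof.
move=> hb; have := schwarz_pick_defect norm_ip Clin Ccontr Cexp f (F z1 b + w *: b) l1.
rewrite diffE ipZl normcM norm_coef !sqrt_defect -/kap.
rewrite C0 (cayley_shift (resF z1_up)) // (resolvent_shift (resF z1_up)) //.
set X := normc _; set S := sn _ _; set S' := sn _ b; have := reE.
set r := Num.sqrt eta => hr h.
have r2 : 0 < 2 * eta by rewrite mulr_gt0.
rewrite -(ler_pM2l r2); apply: (le_trans h); rewrite -hr le_eqVlt.
by apply/orP; left; apply/eqP; ring.
Qed.

Let defect_near f : `|qf (tt (chart z1 l)) (B (chart z1 l) f) - qf (tt z1) (B z1 f)|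
   <= (2 * kap + kap ^+ 2) * qf (tt z1) (B z1 f).
Proof.
have hup := up (ltW l1).
have h1 := cayley_defect norm_ip (resF hup) f.
have h0 := cayley_defect norm_ip (resF z1_up) f.
rewrite -/(C l f) in h1; rewrite -C0 in h0.
have hx := schwarz_pick_norm norm_ip Clin Ccontr Cexp f l1.
have hd := schwarz_pick_defect norm_ip Clin Ccontr Cexp f f l1.
have sq : Num.sqrt (defect C f) ^+ 2 = 4 * eta * qf (tt z1) (B z1 f).
  by rewrite sqr_sqrtr defectE // !mulr_ge0 ?(ltW w_up) ?(qf_ge0 (pform z1_up)) //;
     exact: (resolvent_dom (resF z1_up)).
rewrite -expr2 sq -/kap in hd; rewrite -/kap in hx.
set x := C l f - C 0 f in hx hd.
have hx2 : rnorm x ^+ 2 <= 4 * eta * qf (tt z1) (B z1 f) * kap ^+ 2.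
  by rewrite -sq -exprMn ler_pXn2r ?nnegrE ?rnorm_ge0 // mulr_ge0 ?sqrtr_ge0.
have hE : rnorm (C l f) ^+ 2 = rnorm x ^+ 2 + rnorm (C 0 f) ^+ 2 + 2 * complex.Re (ip x (C 0 f)).
  by rewrite -(rnorm_sqrD norm_ip) /x subrK.
have hR := le_trans (normcRe _) hd; rewrite ler_norml in hR.
case/andP: hR => hR1 hR2; have x0 := sqr_ge0 (rnorm x).
have e4 : 0 < 4 * eta by rewrite mulr_gt0.
move: hx2 hE hR1 hR2 x0 h1 h0; move: (rnorm x ^+ 2) (complex.Re _) (rnorm (C l f) ^+ 2)
  (rnorm (C 0 f) ^+ 2) (rnorm f ^+ 2) => X Y A0 A1 A2.
set q1 := qf _ _; set q0 := qf _ _ => hx2 hE hR1 hR2 x0 h1 h0.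
have q10 : 0 <= 4 * eta * q1 * kap ^+ 2 by lra.
by rewrite ler_norml; apply/andP; split; rewrite -(ler_pM2l e4); lra.
Qed.

Hypothesis cl1 : tform_closable ip F z1.

Let pair (p q : H) := exists f, p = B z1 f /\ q = B (chart z1 l) f.

(** By [near_norm] and [near_form], [B z f - B z1 f] satisfies the hypotheses of
    [regularize], so [bounded_limit] puts it in the energy space at [z1] with a
    small norm.  With [defect_near], this makes the pairs [(B z1 f, B z f)] fit
    for the comparison of forms. *)
Lemma local_invariance : let z := chart z1 l in
  [/\ tform_closable ip F z, Hplus ip F z = Hplus ip F z1 &
   forall u, Hplus ip F z1 u -> W z u <= 5 * W z1 u /\ W z1 u <= 5 * W z u].
Proof.
move=> z; have zup : Cp z := up (ltW l1).
have p0 := pform z1_up; have p1 := pform zup.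
have pc := closure_psd p0 cl1.
have dom0 f := resolvent_dom (resF z1_up) f.
have dom1 f := resolvent_dom (resF zup) f.
have key f : Hplus ip F z1 (B z f - B z1 f) /\
    sn (tc z1) (B z f - B z1 f) <= 5 / 2 * (kap * sn (tt z1) (B z1 f)).
  have tau0 : 0 <= kap * sn (tt z1) (B z1 f) by rewrite mulr_ge0 ?sn_ge0.
  have M0 : 0 <= 5 / 2 * (kap * sn (tt z1) (B z1 f)) by rewrite mulr_ge0 // divr_ge0.
  have hE : eta * rnorm (B z f - B z1 f) ^+ 2 <= (kap * sn (tt z1) (B z1 f)) ^+ 2.
    rewrite -{1}reE -exprMn ler_pXn2r ?nnegrE //.
    by rewrite mulr_ge0 ?rnorm_ge0 // ltW.
  have [us [hus hM]] := bounded_limit p0 M0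
    (regularize norm_ip (disF z1_up) w_up (resF z1_up) tau0 hE (@near_form f)).
  split; first by apply/(energyP p0); exists us.
  exact: (closure_sn_lim p0 cl1 hus M0 hM).
have hpd p q : pair p q -> dom (F z1) p /\ dom (F z) q by move=> [f [-> ->]].
have hpl p : dom (F z1) p -> exists q, pair p q.
  move=> hp; exists (B z (F z1 p + w *: p)), (F z1 p + w *: p).
  by rewrite (resolvent_shift (resF z1_up)).
have hpr q : dom (F z) q -> exists p, pair p q.
  move=> hq; exists (B z1 (F z q + w *: q)), (F z q + w *: q).
  by rewrite (resolvent_shift (resF zup)).
have hpE p q : pair p q -> Hplus ip F z1 q.
  move=> [f [_ ->]]; rewrite -/z -[B z f](subrK (B z1 f)).
  apply: (subD (psd_sub pc)); first by have [] := key f.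
  exact: (energy_sub p0).
have hpH p q : pair p q -> Num.sqrt eta * rnorm (q - p) <= 2^-1 * sn (tt z1) p.
  move=> [f [-> ->]]; apply: (le_trans (near_norm f)).
  apply: ler_wpM2r; first exact: sn_ge0.
  by apply: (le_trans kap8); lra.
have snb p : dom (F z1) p -> sn (tc z1) p = sn (tt z1) p.
  by move=> hp; rewrite /sn /qf /tform_closure (form_closureE p0 cl1).
have hpn p q : pair p q -> W z1 (q - p) <= 2^-1 * W z1 p.
  move=> [f [-> ->]]; have [_ h1] := key f; have h2 := near_norm f.
  rewrite /wnorm (snb _ (dom0 f)); rewrite -/z in h2 *.
  have h3 : kap * sn (tt z1) (B z1 f) <= 8^-1 * sn (tt z1) (B z1 f).
    by apply: ler_wpM2r kap8; exact: sn_ge0.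
  have h4 := mulr_ge0 (ltW re0) (rnorm_ge0 (B z1 f)).
  have h5 := sn_ge0 (tt z1) (B z1 f).
  by lra.
have k2 : 2 * kap + kap ^+ 2 <= 3 / 4.
  have : kap ^+ 2 <= 8^-1 * kap by rewrite expr2 ler_wpM2r.
  by move: kap8; lra.
have hple p q : pair p q -> sn (tt z) q <= 2 * sn (tt z1) p /\ sn (tt z1) p <= 2 * sn (tt z) q.
  move=> [f [-> ->]]; have := defect_near f; rewrite -/z ler_norml => /andP[h1 h2].
  have q0 := qf_ge0 p0 (dom0 f); have q1 := qf_ge0 p1 (dom1 f).
  have h3 := ler_wpM2r q0 k2.
  have s4 x : 0 <= x -> 2 * Num.sqrt x = Num.sqrt (4 * x).
    move=> x0; have -> : 4 * x = 2 ^+ 2 * x by ring.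
    by rewrite sqrtrM ?sqr_ge0 // sqrtr_sqr ger0_norm.
  by rewrite /sn !s4 // !ler_sqrt ?mulr_ge0 //; split; lra.
have hle p q (h : pair p q) := (hple p q h).1.
have hge p q (h : pair p q) := (hple p q h).2.
split.
- exact: (compare_closable re0 p0 p1 cl1 hpd hpr hpE hpH hpn hle hge).
- exact: (compare_space re0 p0 p1 cl1 hpd hpl hpr hpE hpH hpn hle hge).
- move=> u hu; exact: (compare_norm re0 p0 p1 cl1 hpd hpl hpr hpE hpH hpn hle hge hu).
Qed.

End AtPoint.

(** A segment of the upper half-plane stays away from the real line, so that
    finitely many steps of fixed relative size lead from one end to the other. *)
Theorem global_invariance z0 z : Cp z0 -> Cp z -> tform_closable ip F z0 ->
  [/\ tform_closable ip F z, Hplus ip F z = Hplus ip F z0 &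
   exists2 c : R, 0 < c & forall u, Hplus ip F z0 u ->
     W z u <= c * W z0 u /\ W z0 u <= c * W z u].
Proof.
move=> h0 hz cl0.
pose m := Num.min (complex.Im z0) (complex.Im z).
have m0 : 0 < m by rewrite lt_min h0 hz.
(* 36 is 9 for the radius of [local_invariance] times 4 for the chart. *)
have [N hN] : exists N, (0 < N)%N /\ normc (z - z0) * 36 <= m * N%:R.
  have [N hN] : exists N : nat, normc (z - z0) * 36 / m <= N%:R.
    by exists (Num.truncn (normc (z - z0) * 36 / m)).+1; exact/ltW/truncnS_gt.
  exists N.+1; split => //; rewrite [m * _]mulrC -ler_pdivrMr //.
  by apply: (le_trans hN); rewrite ler_nat.
case: hN => N0 hN.
pose p k : R[i] := z0 + (k%:R / N%:R) * (z - z0).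
have NR : 0 < N%:R :> R by rewrite ltr0n.
have Imp k : (k <= N)%N -> m <= complex.Im (p k).
  move=> kN; have E : (k%:R / N%:R : R[i]) = (k%:R / N%:R)%:C.
    by rewrite rmorphM fmorphV !rmorph_nat.
  have -> : complex.Im (p k) = complex.Im z0 + k%:R / N%:R * (complex.Im z - complex.Im z0).
    by rewrite /p E raddfD /=; case: (z) (z0) => [? ?] [? ?] /=; rewrite mul0r addr0.
  have h1 : 0 <= k%:R / N%:R :> R by rewrite divr_ge0.
  have h2 : k%:R / N%:R <= 1 :> R by rewrite ler_pdivrMr // mul1r ler_nat.
  have h3 : m <= complex.Im z0 by rewrite ge_min lexx.
  have h4 : m <= complex.Im z by rewrite ge_min lexx orbT.
  move: (k%:R / N%:R) h1 h2 => x h1 h2; nra.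
have main k : (k <= N)%N -> [/\ tform_closable ip F (p k), Hplus ip F (p k) = Hplus ip F z0 &
   exists2 c : R, 0 < c & forall u, Hplus ip F z0 u ->
     W (p k) u <= c * W z0 u /\ W z0 u <= c * W (p k) u].
  elim: k => [_|k IH kN].
    have -> : p 0%N = z0 by rewrite /p mul0r mul0r addr0.
    by split => //; exists 1 => // u _; rewrite mul1r.
  have [c1 e1 [c c0 hc]] := IH (ltnW kN).
  have y0 : 0 < complex.Im (p k) by apply: lt_le_trans m0 (Imp k (ltnW kN)).
  have y40 : (complex.Im (p k) / 4)%:C != 0 :> R[i].
    by rewrite -(rmorph0 (real_complex R)) (inj_eq (@complexI R)) gt_eqF // divr_gt0.
  pose l := (p k.+1 - p k) / (complex.Im (p k) / 4)%:C.
  have hl : normc l <= 9^-1.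
    rewrite /l normcM normcV normc_real gtr0_norm ?divr_gt0 // ler_pdivrMr ?divr_gt0 //.
    have -> : p k.+1 - p k = (z - z0) / N%:R.
      by rewrite /p -natr1; field; rewrite pnatr_eq0 -lt0n.
    rewrite normcM normcV -[N%:R](rmorph_nat (real_complex R)) normc_real gtr0_norm //.
    rewrite ler_pdivrMr //; have := Imp k (ltnW kN) => hk.
    have : m * N%:R <= complex.Im (p k) * N%:R by rewrite ler_wpM2r // ltW.
    by lra.
  have pE : chart (p k) l = p k.+1.
    by rewrite /chart /l mulrC divfK // addrC subrK.
  have [c2 e2 hc2] := local_invariance y0 hl c1; rewrite pE in c2 e2 hc2.
  split=> //; first by rewrite e2.
  exists (5 * c) => [|u hu]; first by rewrite mulr_gt0.
  have hu1 : Hplus ip F (p k) u by rewrite e1.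
  have [a1 a2] := hc u hu; have [b1 b2] := hc2 u hu1; split.
    by apply: (le_trans b1); rewrite -mulrA ler_wpM2l.
  apply: (le_trans a2); rewrite [5 * c]mulrC -mulrA ler_wpM2l //; exact: ltW.
have := main N (leqnn N).
have -> : p N = z by rewrite /p divff ?pnatr_eq0 -?lt0n // mul1r addrC subrK.
by [].
Qed.

End Local.

(** * Real parts of power series are harmonic and real analytic *)

Section PlanePowerSeries.
Variable R : realType.
Implicit Types (a : nat -> R[i]) (g : R * R -> R) (z u : R[i]) (rho M x y : R).

Definition shiftc x y z : R * R := (x + complex.Re z, y + complex.Im z).

(** The bounds record geometric convergence on a disc of radius [rho].  The
    coefficients are controlled at twice that radius, which leaves room for
    differentiating term by term. *)
Definition plane_ps g x y a rho M := [/\ 0 < rho, 0 <= M,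
  forall n, normc (a n) * (2 * rho) ^+ n <= M
  & forall z, normc z <= rho -> forall n,
      `|g (shiftc x y z) - complex.Re (\sum_(i < n) a i * z ^+ i)| <= M / 2 ^+ n].

Lemma coef_le a rho M n : 0 < rho -> normc (a n) * (2 * rho) ^+ n <= M ->
  normc (a n) * rho ^+ n <= M / 2 ^+ n.
Proof. by move=> r0; rewrite exprMn ler_pdivlMr ?exprn_gt0 // -mulrA [rho ^+ n * _]mulrC. Qed.

Lemma plane_ps0 g x y a rho M : plane_ps g x y a rho M -> g (x, y) = complex.Re (a 0%N).
Proof.
move=> [r0 M0 _ hg]; apply/eqP; rewrite -subr_eq0 -normr_eq0 eq_le normr_ge0 andbT.
apply: (@le_pow2 R _ _ M) => m; rewrite add0r.
have := hg 0; rewrite normc0 => /(_ (ltW r0) m.+1); rewrite big_ord_recl expr0 mulr1.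
rewrite big1 ?addr0 => [|i _]; last by rewrite /= exprS mul0r mulr0.
rewrite /shiftc /= !addr0 => /le_trans; apply; rewrite ler_wpM2l // lef_pV2 ?posrE ?exprn_gt0 //.
by rewrite ler_eXn2l // ltr1n.
Qed.

Lemma geom2 n : \sum_(i < n) (2^-1 : R) ^+ i.+1 <= 1.
Proof.
have -> : \sum_(i < n) (2^-1 : R) ^+ i.+1 = 1 - 2^-1 ^+ n.
  elim: n => [|n IH]; first by rewrite big_ord0 expr0 subrr.
  by rewrite big_ord_recr /= IH exprS; field.
by rewrite gerBl exprn_ge0 // invr_ge0.
Qed.

Lemma plane_ps_lipschitz g x y a rho M z : plane_ps g x y a rho M -> normc z <= rho ->
  `|g (shiftc x y z) - g (x, y)| <= M / rho * normc z.
Proof.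
move=> hps hz; have [r0 M0 ha hg] := hps; rewrite (plane_ps0 hps).
apply: (@le_pow2 R _ _ M) => m; have := hg z hz m.+1.
rewrite big_ord_recl expr0 mulr1 raddfD /= opprD addrA.
set S := \sum_(i < m) _ => h.
set G := g _ - complex.Re (a 0%N) in h *.
rewrite -[G](subrK (complex.Re S)); apply: (le_trans (ler_normD _ _)).
rewrite addrC; apply: lerD; last first.
  apply: (le_trans h); rewrite ler_wpM2l // lef_pV2 ?posrE ?exprn_gt0 //.
  by rewrite ler_eXn2l // ltr1n.
apply: (le_trans (normcRe _)); apply: (le_trans (normc_sum _ _ _)).
apply: (@le_trans _ _ (\sum_(i < m) M / rho * normc z * 2^-1 ^+ i.+1)); last first.
  rewrite -mulr_sumr -[leRHS]mulr1 ler_wpM2l ?geom2 //.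
  by rewrite mulr_ge0 ?normc_ge0 // divr_ge0 // ltW.
apply: ler_sum => i _; rewrite /= /bump /= add1n normcM normcX.
have h1 := coef_le r0 (ha i.+1).
have h2 : normc z ^+ i.+1 <= rho ^+ i.+1 / rho * normc z.
  rewrite exprSr [rho ^+ _]exprSr mulfK ?gt_eqF //.
  by rewrite ler_wpM2r ?normc_ge0 // lerXn2r ?nnegrE ?normc_ge0 ?(ltW r0).
apply: (le_trans (ler_wpM2l (normc_ge0 _) h2)); rewrite !mulrA.
rewrite [leRHS]mulrAC ler_wpM2r ?normc_ge0 // [leRHS]mulrAC.
by rewrite ler_wpM2r ?invr_ge0 ?(ltW r0) // exprVn.
Qed.

Lemma plane_ps_continuous g x y a rho M : plane_ps g x y a rho M ->
  {for (x, y), continuous g}.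
Proof.
move=> hps; have [r0 M0 _ _] := hps; apply/cvgrPdist_le => e e0.
have K0 : 0 < M / rho + 1 by rewrite ltr_wpDl // divr_ge0 // ltW.
pose d := Num.min (rho / 2) (e / (M / rho + 1) / 2).
have d0 : 0 < d by rewrite lt_min !divr_gt0.
exists (ball x d, ball y d) => /=; first by split; exact: nbhsx_ballx.
move=> [x' y'] [/=]; rewrite /ball /= => hx hy; rewrite distrC.
have -> : (x', y') = shiftc x y ((x' - x) +i* (y' - y)).
  by rewrite /shiftc /= !(addrC x) !(addrC y) !subrK.
have hz : normc ((x' - x) +i* (y' - y)) <= 2 * d.
  by apply: (le_trans (normc_le _)) => /=; rewrite ![`|_ - x|]distrC [`|_ - y|]distrC; lra.
have d1 : d <= rho / 2 by rewrite ge_min lexx.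
have d2 : d <= e / (M / rho + 1) / 2 by rewrite ge_min lexx orbT.
apply: (le_trans (plane_ps_lipschitz hps _)); first by apply: (le_trans hz); lra.
apply: (@le_trans _ _ ((M / rho + 1) * normc ((x' - x) +i* (y' - y)))).
  by rewrite ler_wpM2r ?normc_ge0 // lerDl.
by rewrite mulrC -ler_pdivlMr // (le_trans hz) //; lra.
Qed.

(** By induction on [n].  The factor [n ^+ 2] is summable against geometrically
    decaying coefficients, which gives termwise differentiation. *)
Lemma monomial_taylor (z h : R[i]) rho n : 0 <= rho -> normc z <= rho ->
  normc (z + h) <= rho ->
  rho ^+ 2 * normc ((z + h) ^+ n - z ^+ n - n%:R * h * z ^+ n.-1)
    <= n%:R ^+ 2 * rho ^+ n * normc h ^+ 2.
Proof.
move=> r0 hz hzh; elim: n => [|n IH].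
  by rewrite !expr0 subrr !mul0r subrr normc0 mulr0 expr0n mul0r mul0r.
set E := _ - _ - _ in IH.
have -> : (z + h) ^+ n.+1 - z ^+ n.+1 - n.+1%:R * h * z ^+ n.+1.-1 =
    (z + h) * E + n%:R * h ^+ 2 * z ^+ n.-1.
  rewrite /E; case: n {IH E} => [|n] /=; first by rewrite !expr1 !expr0; ring.
  by rewrite !exprS -!natr1; ring.
apply: (le_trans (ler_wpM2l (sqr_ge0 _) (normc_add _ _))); rewrite mulrDr.
have h1 : rho ^+ 2 * normc ((z + h) * E) <= rho * (n%:R ^+ 2 * rho ^+ n * normc h ^+ 2).
  rewrite normcM mulrCA; apply: ler_pM; rewrite ?normc_ge0 // mulr_ge0 ?sqr_ge0 //.
  exact: normc_ge0.
have h2 : rho ^+ 2 * normc (n%:R * h ^+ 2 * z ^+ n.-1) <= n%:R * rho ^+ n.+1 * normc h ^+ 2.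
  rewrite !normcM !normcX -(rmorph_nat (real_complex R)) normc_real ger0_norm //.
  case: n {IH E h1} => [|n] /=; first by rewrite !mul0r mulr0.
  have -> : rho ^+ 2 * (n.+1%:R * normc h ^+ 2 * normc z ^+ n)
     = n.+1%:R * normc h ^+ 2 * rho ^+ 2 * normc z ^+ n by ring.
  have -> : n.+1%:R * rho ^+ n.+2 * normc h ^+ 2 = n.+1%:R * normc h ^+ 2 * rho ^+ 2 * rho ^+ n.
    by rewrite !exprS; ring.
  apply: ler_wpM2l.
    by apply: mulr_ge0; [apply: mulr_ge0; [|exact: sqr_ge0]|exact: sqr_ge0].
  by rewrite lerXn2r ?nnegrE ?normc_ge0.
apply: (le_trans (lerD h1 h2)).
have n0 : 0 <= n%:R :> R by [].
have q0 : 0 <= rho ^+ n.+1 * normc h ^+ 2.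
  by apply: mulr_ge0; [exact: exprn_ge0|exact: sqr_ge0].
rewrite -natr1; move: q0; rewrite exprS; set Q := rho * rho ^+ n * normc h ^+ 2 => q0.
have -> : rho * (n%:R ^+ 2 * rho ^+ n * normc h ^+ 2) + n%:R * (rho * rho ^+ n) * normc h ^+ 2
  = (n%:R ^+ 2 + n%:R) * Q by rewrite /Q; ring.
have -> : (n%:R + 1) ^+ 2 * (rho * rho ^+ n) * normc h ^+ 2 = (n%:R + 1) ^+ 2 * Q.
  by rewrite /Q; ring.
by apply: ler_wpM2r => //; rewrite sqrrD expr1n mulr1 -addrA lerD2l; lra.
Qed.

Lemma sum_sqr_geom n : \sum_(i < n) (i%:R ^+ 2 / 2 ^+ i : R) <= 6.
Proof.
have -> : \sum_(i < n) (i%:R ^+ 2 / 2 ^+ i : R) =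
    6 - (2 * n%:R ^+ 2 + 4 * n%:R + 6) / 2 ^+ n.
  elim: n => [|n IH]; first by rewrite big_ord0 expr0 expr0n /= mulr0 mulr0 !add0r divr1 subrr.
  rewrite big_ord_recr /= IH [2 ^+ n.+1]exprS -[n.+1%:R]natr1.
  have : (2 : R) ^+ n != 0 by rewrite expf_neq0.
  by move: (2 ^+ n) n%:R => q m q0; field.
by rewrite gerBl divr_ge0 ?exprn_ge0 // !addr_ge0 ?mulr_ge0 ?sqr_ge0.
Qed.

(** Coefficients of [u] times the derivative of the series, which is its
    derivative in the direction of the plane that [u] represents. *)
Definition dcoef u a n : R[i] := u * (n.+1%:R * a n.+1).

Lemma dcoef_le u a rho M n : normc u = 1 -> 0 < rho ->
  (forall n, normc (a n) * (2 * rho) ^+ n <= M) ->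
  normc (dcoef u a n) * rho ^+ n <= M / rho.
Proof.
move=> hu r0 ha; rewrite /dcoef !normcM hu mul1r.
rewrite -[n.+1%:R](rmorph_nat (real_complex R)) normc_real ger0_norm //.
have h1 : n.+1%:R <= 2 ^+ n.+1 :> R.
  by rewrite -natrX ler_nat ltnW // ltn_expl.
rewrite ler_pdivlMr //; apply: le_trans (ha n.+1).
have -> : n.+1%:R * normc (a n.+1) * rho ^+ n * rho = n.+1%:R * (normc (a n.+1) * rho ^+ n.+1).
  by rewrite exprSr !mulrA.
rewrite exprMn [leRHS]mulrCA; apply: ler_wpM2r h1.
by apply: mulr_ge0; [exact: normc_ge0|apply: exprn_ge0; exact: ltW].
Qed.

(** Being stable under directional derivatives at the cost of halving the
    radius, the class [plane_ps] consists of smooth functions. *)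
Lemma plane_ps_derive g x y a rho M u (v : R * R) : plane_ps g x y a rho M ->
  normc u = 1 -> (forall (t : R) z, t *: v + shiftc x y z = shiftc x y (z + t%:C * u)) ->
  (forall z, normc z <= rho / 2 -> derivable g (shiftc x y z) v) /\
  plane_ps ('D_v g) x y (dcoef u a) (rho / 2) (2 * M / rho).
Proof.
move=> [r0 M0 ha hg] hu hv.
have r20 : 0 < rho / 2 by rewrite divr_gt0.
have rr : 2 * (rho / 2) = rho by field.
have ha' n : normc (dcoef u a n) * rho ^+ n <= M / rho by exact: dcoef_le.
have term z n : normc z <= rho / 2 -> normc (dcoef u a n * z ^+ n) <= M / rho * 2^-1 ^+ n.
  move=> hz; have := ha' n; rewrite -{1}rr exprMn => h.
  rewrite normcM normcX exprVn ler_pdivlMr ?exprn_gt0 //; apply: le_trans h.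
  rewrite -mulrA; apply: ler_wpM2l; first exact: normc_ge0.
  rewrite mulrC; apply: ler_wpM2l; first exact: exprn_ge0.
  by rewrite lerXn2r ?nnegrE ?normc_ge0 ?(ltW r20).
pose S z n := complex.Re (\sum_(i < n) dcoef u a i * z ^+ i).
have tail z n k : normc z <= rho / 2 -> `|S z (n + k)%N - S z n| <= 2 * M / rho / 2 ^+ n.
  move=> hz; rewrite /S big_split_ord /= raddfD /= addrAC subrr add0r.
  apply: (le_trans (normcRe _)); apply: (le_trans (normc_sum _ _ _)).
  apply: (@le_trans _ _ (\sum_(i < k) (2 * M / rho / 2 ^+ n) * 2^-1 ^+ i.+1)).
    apply: ler_sum => i _; apply: (le_trans (term _ _ hz)); rewrite exprD exprS -exprVn.
    by rewrite le_eqVlt; apply/orP; left; apply/eqP; field; rewrite gt_eqF.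
  rewrite -mulr_sumr -[leRHS]mulr1 ler_wpM2l ?geom2 //.
  by rewrite !divr_ge0 ?mulr_ge0 ?exprn_ge0 // ltW.
have lim z : normc z <= rho / 2 -> exists l, forall n, `|l - S z n| <= 2 * M / rho / 2 ^+ n.
  move=> hz; have sm (e : R) : 0 < e -> exists N, 2 * (2 * M / rho / 2 ^+ N) <= e.
    move=> /(half_pow_small (2 * (2 * M / rho)))[N /(_ N (leqnn N)) h].
    by exists N; rewrite mulrA.
  have [l hl] : exists l : R, S z @ \oo --> l.
    apply: real_cauchy => e /sm[N hN]; exists N => n m hn hm.
    have h1 := tail z N (n - N)%N hz; have h2 := tail z N (m - N)%N hz.
    rewrite !subnKC // in h1 h2.
    have -> : S z n - S z m = (S z n - S z N) - (S z m - S z N) by ring.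
    by apply: (le_trans (ler_normB _ _)); lra.
  exists l => n; apply/ler_addgt0Pl => e e0.
  move/cvgrPdist_le: hl => /(_ _ e0)[N _ hN].
  have h1 := hN (n + N)%N (leq_addl _ _); have h2 := tail z n N hz.
  rewrite /= in h1.
  have -> : l - S z n = (l - S z (n + N)%N) + (S z (n + N)%N - S z n) by ring.
  by apply: (le_trans (ler_normD _ _)); lra.
have der z : normc z <= rho / 2 -> exists l, is_derive (shiftc x y z) v g l /\
    forall n, `|l - S z n| <= 2 * M / rho / 2 ^+ n.
  move=> hz; have [l hl] := lim z hz; exists l; split => //.
  have quad (t : R) : `|t| <= rho / 2 ->
      `|g (t *: v + shiftc x y z) - g (shiftc x y z) - t * l| <= 6 * M / rho ^+ 2 * `|t| ^+ 2.
    move=> ht; rewrite hv.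
    have nt : normc (t%:C * u) = `|t| by rewrite normcM hu mulr1 normc_real.
    have hz1 : normc z <= rho by apply: (le_trans hz); lra.
    have hz2 : normc (z + t%:C * u) <= rho.
      by apply: (le_trans (normc_add _ _)); rewrite nt; lra.
    apply: (@le_pow2 R _ _ (2 * M + `|t| * (2 * M / rho))) => n.
    have e1 := hg _ hz1 n.+1; have e2 := hg _ hz2 n.+1; have e3 := hl n.
    set P1 := \sum_(i < n.+1) _ in e1; set P2 := \sum_(i < n.+1) _ in e2.
    have main : `|complex.Re P2 - complex.Re P1 - t * S z n| <= 6 * M / rho ^+ 2 * `|t| ^+ 2.
      have -> : complex.Re P2 - complex.Re P1 - t * S z n = complex.Re
          (\sum_(i < n.+1) a i * ((z + t%:C * u) ^+ i - z ^+ i - i%:R * (t%:C * u) * z ^+ i.-1)).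
        have -> : t * S z n = complex.Re (\sum_(i < n.+1) a i * (i%:R * (t%:C * u) * z ^+ i.-1)).
          rewrite big_ord_recl /= !mul0r mulr0 add0r /S.
          have -> (c : R[i]) : t * complex.Re c = complex.Re (t%:C * c).
            by case: c => p q /=; rewrite mul0r subr0.
          congr (complex.Re _); rewrite mulr_sumr; apply: eq_bigr => i _.
          by rewrite /= /bump /= add1n /dcoef; ring.
        rewrite -!raddfB /= /P1 /P2 -!sumrB; congr (complex.Re _).
        by apply: eq_bigr => i _; ring.
      apply: (le_trans (normcRe _)); apply: (le_trans (normc_sum _ _ _)).
      apply: (@le_trans _ _ (\sum_(i < n.+1) M / rho ^+ 2 * `|t| ^+ 2 * (i%:R ^+ 2 / 2 ^+ i))).
        apply: ler_sum => i _; rewrite normcM.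
        have hm := monomial_taylor i (ltW r0) hz1 hz2; rewrite nt in hm.
        have hc := coef_le r0 (ha i).
        set Q := normc (_ - _ - _) in hm *.
        have rho2 : 0 < rho ^+ 2 by rewrite exprn_gt0.
        rewrite -(ler_pM2l rho2) mulrCA; apply: (le_trans (ler_wpM2l (normc_ge0 _) hm)).
        have -> : normc (a i) * (i%:R ^+ 2 * rho ^+ i * `|t| ^+ 2) =
          normc (a i) * rho ^+ i * (i%:R ^+ 2 * `|t| ^+ 2) by ring.
        have q0 : 0 <= i%:R ^+ 2 * `|t| ^+ 2 by rewrite mulr_ge0 ?sqr_ge0.
        apply: (le_trans (ler_wpM2r q0 hc)); rewrite le_eqVlt; apply/orP; left; apply/eqP.
        by field; rewrite expf_neq0 // gt_eqF.
      rewrite -mulr_sumr; have q0 : 0 <= M / rho ^+ 2 * `|t| ^+ 2.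
        by rewrite mulr_ge0 ?sqr_ge0 // divr_ge0 ?sqr_ge0.
      apply: (le_trans (ler_wpM2l q0 (sum_sqr_geom _))).
      by rewrite le_eqVlt; apply/orP; left; apply/eqP; ring.
    have e4 : `|t * (S z n - l)| <= `|t| * (2 * M / rho) / 2 ^+ n.
      by rewrite normrM distrC -mulrA ler_wpM2l.
    have hn : (2 : R) ^- n.+1 <= 2 ^- n.
      by rewrite lef_pV2 ?posrE ?exprn_gt0 // ler_weXn2l // ler1n.
    have e5 : M / 2 ^+ n.+1 <= M / 2 ^+ n by rewrite ler_wpM2l.
    set G1 := g (shiftc x y z) in e1 *; set G2 := g _ in e2 *.
    have -> : G2 - G1 - t * l = (complex.Re P2 - complex.Re P1 - t * S z n)
       + ((G2 - complex.Re P2) - (G1 - complex.Re P1) + t * (S z n - l)) by ring.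
    apply: (le_trans (ler_normD _ _)); apply: lerD => //.
    apply: (le_trans (ler_normD _ _)); rewrite mulrDl; apply: lerD => //.
    apply: (le_trans (ler_normB _ _)).
    have -> : 2 * M / 2 ^+ n = M / 2 ^+ n + M / 2 ^+ n by ring.
    by apply: lerD; [exact: le_trans e2 e5|exact: le_trans e1 e5].
  apply: is_derive_dir => e e0.
  have K0 : 0 <= 6 * M / rho ^+ 2.
    by apply: divr_ge0; [exact: mulr_ge0|exact: sqr_ge0].
  have K1 : 0 < 6 * M / rho ^+ 2 + 1 by rewrite ltr_wpDl.
  exists (Num.min (rho / 2) (e / (6 * M / rho ^+ 2 + 1))).
    by rewrite lt_min r20 divr_gt0.
  move=> t; rewrite lt_min => /andP[/ltW t1 t2]; apply: (le_trans (quad t t1)).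
  rewrite expr2 mulrA ler_wpM2r //; move: t2; rewrite ltr_pdivlMr // => /ltW; apply: le_trans.
  by rewrite mulrC ler_wpM2l // lerDl.
split=> [z hz|]; first by have [l [[]]] := der z hz.
split => //; first by rewrite divr_ge0 ?mulr_ge0 // ltW.
  move=> n; rewrite rr; apply: (le_trans (ha' n)).
  have : 0 <= M / rho by rewrite divr_ge0 // ltW.
  by rewrite -mulrA; lra.
by move=> z hz n; have [l [[_ ->] h]] := der z hz; exact: h.
Qed.

Lemma ex_shift x y (t : R) z : t *: ex R + shiftc x y z = shiftc x y (z + t%:C * 1).
Proof.
rewrite /shiftc /ex mulr1; case: z => p q /=; congr (_, _); rewrite /= -?[_ *: _]/(_ * _).
  by ring.
by ring.
Qed.

Lemma ey_shift x y (t : R) z : t *: ey R + shiftc x y z = shiftc x y (z + t%:C * 'i%C).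
Proof.
rewrite /shiftc /ey; case: z => p q /=; congr (_, _); rewrite /= -?[_ *: _]/(_ * _).
  by ring.
by ring.
Qed.

Lemma shiftc0 x y : shiftc x y 0 = (x, y).
Proof. by rewrite /shiftc /= !addr0. Qed.

Lemma direction (v : R * R) : [set ex R; ey R] v -> exists2 u, normc u = 1 &
  forall x y (t : R) z, t *: v + shiftc x y z = shiftc x y (z + t%:C * u).
Proof.
case=> ->; first by exists 1; [exact: normc1|exact: ex_shift].
by exists 'i%C; [exact: normc_i|exact: ey_shift].
Qed.

Lemma plane_ps_C2 g x y a rho M : plane_ps g x y a rho M -> C2_at g (x, y).
Proof.
move=> hg; split; first exact: plane_ps_continuous hg.
move=> v /direction[u hu hv]; have [d1 p1] := plane_ps_derive hg hu (hv x y).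
have [r0 _ _ _] := hg.
have n0 r : 0 < r -> normc (0 : R[i]) <= r / 2 by move=> ?; rewrite normc0 divr_ge0 // ltW.
split; first by have := d1 0 (n0 _ r0); rewrite shiftc0.
  exact: plane_ps_continuous p1.
move=> w /direction[u' hu' hv']; have [d2 p2] := plane_ps_derive p1 hu' (hv' x y).
have [r1 _ _ _] := p1; split; last exact: plane_ps_continuous p2.
by have := d2 0 (n0 _ r1); rewrite shiftc0.
Qed.

(** The second derivatives along 1 and [i] of a holomorphic function cancel,
    since [1 + i^2 = 0]. *)
Lemma plane_ps_laplacian g x y a rho M : plane_ps g x y a rho M -> laplacian g (x, y) = 0.
Proof.
move=> hg; rewrite /laplacian.
have [_ p1] := plane_ps_derive hg (@normc1 R) (ex_shift x y).
have [_ q1] := plane_ps_derive p1 (@normc1 R) (ex_shift x y).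
have [_ p2] := plane_ps_derive hg (@normc_i R) (ey_shift x y).
have [_ q2] := plane_ps_derive p2 (@normc_i R) (ey_shift x y).
rewrite (plane_ps0 q1) (plane_ps0 q2) -raddfD /=.
have -> : dcoef 1 (dcoef 1 a) 0 + dcoef 'i%C (dcoef 'i%C a) 0 = 0 :> R[i].
  have := sqr_i R; rewrite /dcoef; set j := 'i%C => hj.
  have -> : 1 * (1%:R * (1 * (2%:R * a 2%N))) + j * (1%:R * (j * (2%:R * a 2%N)))
    = (1 + j ^+ 2) * (2%:R * a 2%N) by ring.
  by rewrite hj subrr mul0r.
by [].
Qed.

(** Expanding [(h + i k)^n] by the binomial formula; on half the radius the
    absolute values still sum to at most [|a_n| rho^n]. *)
Lemma plane_ps_analytic (f : R[i] -> R) x y a rho M :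
  plane_ps (fun_of_plane f) x y a rho M ->
  exists (r : R) (c : nat -> nat -> R), 0 < r /\
      forall h k : R, `|h| < r -> `|k| < r ->
        cvgn (series (fun n : nat =>
          \sum_(i < n.+1) `|c i (n - i)%N * h ^+ i * k ^+ (n - i)|)) /\
        series (fun n : nat =>
          \sum_(i < n.+1) c i (n - i)%N * h ^+ i * k ^+ (n - i)) @ \oo
            --> f ((x + h) +i* (y + k)).
Proof.
move=> [r0 M0 ha hg].
pose c i j : R := complex.Re (a (i + j)%N * 'C(i + j, i)%:R * 'i%C ^+ j).
exists (rho / 2), c; split; first by rewrite divr_gt0.
move=> h k hh hk.
have hk' : normc (h +i* k) <= rho.
  by apply: (le_trans (normc_le _)) => /=; lra.
have term n : \sum_(i < n.+1) c i (n - i)%N * h ^+ i * k ^+ (n - i) =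
    complex.Re (a n * (h +i* k) ^+ n).
  have -> : h +i* k = 'i%C * k%:C + h%:C.
    by apply/eqP; rewrite eq_complex /=; apply/andP; split; apply/eqP; ring.
  rewrite exprDn mulr_sumr raddf_sum /=; apply: eq_bigr => i _.
  have iN : (i + (n - i))%N = n by rewrite subnKC // -ltnS.
  rewrite /c iN exprMn -!(rmorphXn (real_complex R)) -mulr_natr.
  have ReM (w : R[i]) (s t : R) : complex.Re w * s * t = complex.Re (w * s%:C * t%:C).
    by case: w => p q /=; ring.
  by rewrite ReM; congr (complex.Re _); ring.
have abs n : \sum_(i < n.+1) `|c i (n - i)%N * h ^+ i * k ^+ (n - i)| <= M * 2^-1 ^+ n.
  apply: (@le_trans _ _ (normc (a n) * (`|k| + `|h|) ^+ n)).
    rewrite exprDn mulr_sumr; apply: ler_sum => i _.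
    have iN : (i + (n - i))%N = n by rewrite subnKC // -ltnS.
    rewrite !normrM !normrX -mulr_natr.
    have hc : `|c i (n - i)%N| <= normc (a n) * 'C(n, i)%:R.
      rewrite /c iN; apply: (le_trans (normcRe _)).
      rewrite !normcM normcX normc_i expr1n mulr1.
      by rewrite -['C(n, i)%:R](rmorph_nat (real_complex R)) normc_real ger0_norm.
    have q0 : 0 <= `|h| ^+ i * `|k| ^+ (n - i) by rewrite mulr_ge0 ?exprn_ge0.
    rewrite -mulrA; apply: (le_trans (ler_wpM2r q0 hc)).
    by rewrite le_eqVlt; apply/orP; left; apply/eqP; ring.
  have h1 := coef_le r0 (ha n); rewrite -exprVn in h1.
  apply: le_trans h1; apply: ler_wpM2l; first exact: normc_ge0.
  by apply: lerXn2r; rewrite ?nnegrE ?addr_ge0 ?(ltW r0) //; lra.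
split.
  apply: (@series_le_cvg _ _ (fun n => M * 2^-1 ^+ n)) => //.
  - by move=> n; apply: sumr_ge0.
  - by move=> n; rewrite mulr_ge0 // exprn_ge0.
  - apply: is_cvg_geometric_series.
    by rewrite ger0_norm // invf_lt1 // ltr1n.
apply/cvgrPdist_le => e e0.
have [N hN] := half_pow_small M e0; exists N => // n /hN hM /=.
have -> : series (fun n => \sum_(i < n.+1) c i (n - i)%N * h ^+ i * k ^+ (n - i)) n =
    complex.Re (\sum_(i < n) a i * (h +i* k) ^+ i).
  rewrite /series /= raddf_sum /= big_mkord; apply: eq_bigr => i _; exact: term.
have := hg _ hk' n; rewrite /shiftc /fun_of_plane /= => /le_trans; apply.
exact: hM.
Qed.

End PlanePowerSeries.

(** * Uniform limits of real parts of power series *)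

Section HarmonicLimit.
Variable R : realType.
Implicit Types (p q : R[i] -> R[i]) (c d a : nat -> R[i]) (l z : R[i]) (K B e : R).

Lemma eq_pexp p q c K : (forall z, normc z <= 1 -> p z = q z) -> pexp p c K -> pexp q c K.
Proof. by move=> h [K0 hp]; split=> // z hz n; rewrite -h //; exact: hp. Qed.

Lemma pexpD p q c d K B : pexp p c K -> pexp q d B ->
  pexp (fun z => p z + q z) (fun n => c n + d n) (K + B).
Proof.
move=> [K0 hp] [B0 hq]; split=> [|z hz n]; first exact: addr_ge0.
have -> : \sum_(i < n) (c i + d i) * z ^+ i = \sum_(i < n) c i * z ^+ i + \sum_(i < n) d i * z ^+ i.
  by rewrite -big_split; apply: eq_bigr => i _; rewrite mulrDl.
rewrite opprD addrACA mulrDl; apply: (le_trans (normc_add _ _)).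
by apply: lerD; [exact: hp|exact: hq].
Qed.

Lemma pexpB p q c d K B : pexp p c K -> pexp q d B ->
  pexp (fun z => p z - q z) (fun n => c n - d n) (K + B).
Proof.
move=> hp hq; have := pexpD hp (pexpZ (-1) hq).
rewrite normc_opp normc1 mul1r.
have -> : (fun n => c n + -1 * d n) = (fun n => c n - d n).
  by apply/funext => n; rewrite mulN1r.
by apply: eq_pexp => z _; rewrite mulN1r.
Qed.

Lemma pexp_scale (s : R) p c K : 0 <= s -> s <= 1 -> pexp p c K ->
  pexp (fun z => p (s%:C * z)) (fun n => c n * s%:C ^+ n) K.
Proof.
move=> s0 s1 [K0 hp]; split=> // z hz n.
have hsz : normc (s%:C * z) <= 1.
  by rewrite normcM normc_real ger0_norm //; apply: mulr_ile1 => //; exact: normc_ge0.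
have := hp _ hsz n; congr (normc (_ - _) <= _); apply: eq_bigr => i _.
by rewrite exprMn mulrA.
Qed.

(** The real part on the unit circle controls the coefficients: averaging [2 Re p = p + p^*] against [z^* ^+ n] singles out
    the n-th one. *)
Lemma pexp_re_bound p c K B n : pexp p c K ->
  (forall z, normc z <= 1 -> `|complex.Re (p z)| <= B) -> (0 < n)%N ->
  normc (c n) <= 2 * B.
Proof.
move=> hp hB n0; have [K0 _] := hp.
apply: (@le_pow2 R _ _ (2 * K)) => m; pose N := (m.+1 + n)%N.
have nN : (n < N)%N by rewrite /N addSn ltnS leq_addl.
have N0 : (0 < N)%N by rewrite (leq_ltn_trans _ nN).
have h1 := mean_coef hp nN; have h2 := mean_shift hp n0 nN.
have h3 : normc (mean N (fun z => ((2 * complex.Re (p z))%:C * z^* ^+ n))) <= 2 * B.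
  apply: mean_bound => // z hz; rewrite normcM normcX normc_conj hz expr1n mulr1 normc_real.
  by rewrite normrM ger0_norm // ler_wpM2l // hB // hz.
have e1 : mean N (fun z => ((2 * complex.Re (p z))%:C * z^* ^+ n)) =
    mean N (fun z => p z * z^* ^+ n) + (mean N (fun z => p z * z ^+ n))^*.
  rewrite -mean_conj -meanD; congr mean; apply/funext => z.
  rewrite (rmorphM (@conjc R)) (rmorphXn (@conjc R)) -mulrDl; congr (_ * _).
  by case: (p z) => x y; apply/eqP; rewrite eq_complex /= subrr; apply/andP; split => //;
    apply/eqP; ring.
set M1 := mean N _ in h1 e1; set M2 := mean N _ in h2 e1; set M3 := mean N _ in h3 e1.
have -> : c n = (M3 - M2^*) - (M1 - c n) by rewrite e1; ring.
apply: (le_trans (normc_sub _ _)).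
have h4 : normc (M3 - M2^*) <= 2 * B + K / 2 ^+ (N - n).
  by apply: (le_trans (normc_sub _ _)); rewrite normc_conj lerD.
have mono (i : nat) : (m <= i)%N -> K / 2 ^+ i <= K / 2 ^+ m.
  move=> mi; rewrite ler_wpM2l // lef_pV2 ?posrE ?exprn_gt0 //.
  by rewrite ler_weXn2l // ler1n.
have h5 : K / 2 ^+ (N - n) <= K / 2 ^+ m by apply: mono; rewrite /N addnK.
have h6 : K / 2 ^+ N <= K / 2 ^+ m by apply: mono; rewrite /N addSn leqW // leq_addr.
have -> : 2 * K / 2 ^+ m = K / 2 ^+ m + K / 2 ^+ m by ring.
by lra.
Qed.

(** Only the real part of the constant coefficient is determined by the real
    part of a series. *)
Definition real_const c n : R[i] := if n is 0 then (complex.Re (c 0%N))%:C else c n.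

Lemma re_real_const c l n : complex.Re (\sum_(i < n) real_const c i * l ^+ i) =
  complex.Re (\sum_(i < n) c i * l ^+ i).
Proof.
case: n => [|n]; first by rewrite !big_ord0.
by rewrite !big_ord_recl /= !expr0 !mulr1 !raddfD.
Qed.

Lemma real_const_bound p q c d K K' B n : pexp p c K -> pexp q d K' ->
  (forall z, normc z <= 1 -> `|complex.Re (p z - q z)| <= B) ->
  normc (real_const c n - real_const d n) <= 2 * B.
Proof.
move=> hp hq hB; have hpq := pexpB hp hq.
case: n => [|n]; last exact: (pexp_re_bound hpq hB).
have -> : real_const c 0 - real_const d 0 = (complex.Re (c 0%N - d 0%N))%:C.
  by rewrite /real_const !raddfB.
rewrite normc_real.
have := hB 0; rewrite normc0 => /(_ ler01).
rewrite (pexp0 hp) (pexp0 hq) => h; apply: (le_trans h).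
by have := le_trans (normr_ge0 _) h; lra.
Qed.

Lemma geom_half n k : \sum_(i < k) (2^-1 : R) ^+ (n + i) <= 2 / 2 ^+ n.
Proof.
have -> : \sum_(i < k) (2^-1 : R) ^+ (n + i) = (2 - 2 * 2^-1 ^+ k) / 2 ^+ n.
  elim: k => [|k IH]; first by rewrite big_ord0 expr0 mulr1 subrr mul0r.
  rewrite big_ord_recr /= IH exprD [2^-1 ^+ k.+1]exprS [2^-1 ^+ n]exprVn; move: (2^-1 ^+ k) (2 ^+ n)^-1 => x y.
  by field.
by rewrite ler_wpM2r ?invr_ge0 ?exprn_ge0 // gerBl mulr_ge0 // exprn_ge0 // invr_ge0.
Qed.

(** By [real_const_bound] the coefficients of a uniformly convergent sequence
    converge at the same rate, uniformly in [n], and are bounded, so the series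
    of the limits represents [f] on the disc of radius 1/2. *)
Lemma harmonic_limit (f : R[i] -> R) :
  (forall e, 0 < e -> exists p c K, pexp p c K /\
     forall l, normc l <= 1 -> `|f l - complex.Re (p l)| <= e) ->
  exists a M, [/\ 0 <= M, forall n, normc (a n) <= M
    & forall l, normc l <= 2^-1 -> forall n,
        `|f l - complex.Re (\sum_(i < n) a i * l ^+ i)| <= M / 2 ^+ n].
Proof.
move=> hf; pose ee (j : nat) : R := 2^-1 ^+ j.
have ee0 j : 0 < ee j by rewrite exprn_gt0 // invr_gt0.
have /choice[P hP] : forall j, exists s : (R[i] -> R[i]) * (nat -> R[i]) * R,
    pexp s.1.1 s.1.2 s.2 /\
    forall l, normc l <= 1 -> `|f l - complex.Re (s.1.1 l)| <= ee j.
  by move=> j; have [p [c [K h]]] := hf _ (ee0 j); exists (p, c, K).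
pose p j := (P j).1.1; pose c j := (P j).1.2; pose K j := (P j).2.
have hp j : pexp (p j) (c j) (K j) by case: (hP j).
have hfp j l : normc l <= 1 -> `|f l - complex.Re (p j l)| <= ee j.
  by move=> hl; case: (hP j) => _; exact.
pose d j n := real_const (c j) n.
have ddist j k n : normc (d j n - d k n) <= 2 * (ee j + ee k).
  apply: (real_const_bound _ (hp j) (hp k)) => z hz; rewrite raddfB /=.
  have -> : complex.Re (p j z) - complex.Re (p k z) =
    (f z - complex.Re (p k z)) - (f z - complex.Re (p j z)) by ring.
  by apply: (le_trans (ler_normB _ _)); rewrite addrC lerD ?hfp.
have small e : 0 < e -> exists j, forall k, (j <= k)%N -> ee k <= e.
  move=> /(half_pow_small 1)[N hN]; exists N => k /hN.
  by rewrite mul1r /ee exprVn.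
have /choice[a ha] : forall n, exists l : R[i], forall j, normc (d j n - l) <= 2 * ee j.
  move=> n; have [l hl] : exists l : R[i]^o, (fun j => d j n : R[i]^o) @ \oo --> l.
    apply: complex_cauchy => e e0; have e4 : 0 < e / 4 by rewrite divr_gt0.
    have [N hN] := small _ e4; exists N => i k /hN hi /hN hk.
    by apply: (le_trans (ddist _ _ _)); lra.
  exists l => j; apply/ler_addgt0Pl => e e0; have e3 : 0 < e / 3 by rewrite divr_gt0.
  have [N hN] := small _ e3; have [N' hN'] := (cvgn_rnorm _ _).1 hl _ e3.
  pose k := (N + N')%N; have h1 := hN k (leq_addr _ _); have h2 := hN' k (leq_addl _ _).
  rewrite rnormc in h2.
  have -> : d j n - l = (d j n - d k n) + (d k n - l) by ring.
  by apply: (le_trans (normc_add _ _)); have := ddist j k n; lra.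
have [K0 hK] := hp 0%N.
have d0 n : normc (d 0%N n) <= 2 * K 0%N.
  have hz : pexp (fun=> 0) (fun=> 0) (0 : R).
    split=> // z _ m; rewrite big1 ?subrr ?normc0 ?mul0r // => i _; exact: mul0r.
  have := real_const_bound n (hp 0%N) hz (_ : forall z, normc z <= 1 -> _ <= K 0%N).
  have -> : real_const (fun=> 0) n = 0 :> R[i] by case: n.
  rewrite subr0; apply=> z hz1; rewrite subr0; apply: (le_trans (normcRe _)).
  by have := hK _ hz1 0%N; rewrite big_ord0 subr0 expr0 divr1.
have ee00 : ee 0%N = 1 by rewrite /ee expr0.
pose La := 2 * K 0%N + 2.
have aLa n : normc (a n) <= La.
  have -> : a n = d 0%N n - (d 0%N n - a n) by ring.
  apply: (le_trans (normc_sub _ _)); apply: lerD; first exact: d0.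
  by have := ha n 0%N; rewrite ee00 mulr1.
have ee1 j : ee j <= 1 by rewrite /ee exprn_ile1 ?invr_ge0 // invf_le1 // ler1n.
have dLa j n : normc (d j n) <= La + 2.
  have -> : d j n = (d j n - a n) + a n by ring.
  apply: (le_trans (normc_add _ _)); rewrite addrC; apply: lerD => //.
  by have := ha n j; have := ee1 j; lra.
have La0 : 0 <= La by rewrite addr_ge0 // mulr_ge0.
exists a, (2 * (La + 2)); split=> [|n|l hl n].
- by rewrite mulr_ge0 // addr_ge0.
- by apply: (le_trans (aLa n)); lra.
have hl1 : normc l <= 1 by apply: (le_trans hl); lra.
have lX (i : nat) : normc (l ^+ i) <= 2^-1 ^+ i.
  by rewrite normcX lerXn2r ?nnegrE ?normc_ge0 ?invr_ge0.
(* The index [j] of the approximation and the truncation order [n + m] go to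
   infinity in turn. *)
apply: (@le_pow2 R _ _ 5) => j; apply: (@le_pow2 R _ _ (K j)) => m.
have [Kj hKj] := hp j.
have h1 := hfp j l hl1; have h2 := hKj l hl1 (n + m)%N.
have h3 : K j / 2 ^+ (n + m) <= K j / 2 ^+ m.
  rewrite ler_wpM2l // lef_pV2 ?posrE ?exprn_gt0 //.
  by rewrite ler_weXn2l ?ler1n // leq_addl.
have h4 : normc (\sum_(i < m) d j (n + i)%N * l ^+ (n + i)) <= 2 * (La + 2) / 2 ^+ n.
  apply: (le_trans (normc_sum _ _ _)).
  apply: (@le_trans _ _ (\sum_(i < m) (La + 2) * 2^-1 ^+ (n + i))).
    by apply: ler_sum => i _; rewrite normcM; apply: ler_pM; rewrite ?normc_ge0.
  rewrite -mulr_sumr [2 * _]mulrC -mulrA ler_wpM2l ?geom_half //; exact: addr_ge0.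
have h5 : normc (\sum_(i < n) (d j i - a i) * l ^+ i) <= 4 / 2 ^+ j.
  apply: (le_trans (normc_sum _ _ _)).
  apply: (@le_trans _ _ (\sum_(i < n) (2 * ee j) * 2^-1 ^+ (0 + i))).
    by apply: ler_sum => i _; rewrite normcM; apply: ler_pM; rewrite ?normc_ge0.
  rewrite -mulr_sumr; apply: (@le_trans _ _ ((2 * ee j) * (2 / 2 ^+ 0))).
    by rewrite ler_wpM2l ?geom_half // mulr_ge0 // ltW.
  by rewrite /ee exprVn expr0 divr1 mulrAC; lra.
set S := \sum_(i < n) a i * _.
have -> : f l - complex.Re S = (f l - complex.Re (p j l))
    + (complex.Re (p j l - \sum_(i < n + m) c j i * l ^+ i)
    + (complex.Re (\sum_(i < m) d j (n + i)%N * l ^+ (n + i))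
    + complex.Re (\sum_(i < n) (d j i - a i) * l ^+ i))).
  rewrite [in RHS](raddfB (@complex.Re R)) /= -(re_real_const (c j)) big_split_ord /=.
  have -> : \sum_(i < n) (d j i - a i) * l ^+ i =
      \sum_(i < n) real_const (c j) i * l ^+ i - S.
    by rewrite -sumrB; apply: eq_bigr => i _; rewrite mulrBl.
  by rewrite (raddfD (@complex.Re R)) (raddfB (@complex.Re R)) /=; ring.
apply: (le_trans (ler_normD _ _)).
have := le_trans (normcRe _) h2; have := le_trans (normcRe _) h4.
have := le_trans (normcRe _) h5; move: h1; rewrite /ee exprVn => h1.
set X := `|complex.Re _| => hX; set Y := `|complex.Re _| => hY.
set Z := `|complex.Re _| => hZ.
have hT : `|complex.Re (p j l - \sum_(i < n + m) c j i * l ^+ i)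
    + (complex.Re (\sum_(i < m) d j (n + i)%N * l ^+ (n + i))
    + complex.Re (\sum_(i < n) (d j i - a i) * l ^+ i))| <= Z + (Y + X).
  by apply: (le_trans (ler_normD _ _)); rewrite lerD2l; exact: ler_normD.
have -> : 5 / 2 ^+ j = 4 / 2 ^+ j + (2 ^+ j)^-1 :> R by ring.
move: hT; set T := `|_ + _| => hT; lra.
Qed.

End HarmonicLimit.

(** * The energy norm *)

Section EnergyNorm.
Variables (R : realType) (H : completeNormedModType R[i]).
Variable ip : {dot H for Num.conj}.
Hypothesis norm_ip : hilbert_norm ip.
Implicit Types (u v : H) (r c x : R) (e : R[i]).

Section OneForm.
Variables (D : set H) (t : H -> H -> R[i]^o).
Hypotheses (pt : psd D t) (cl : closable D t).
Local Notation E := (energy_space D t).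
Local Notation tb := (form_closure D t).

Definition enorm u : R := Num.sqrt (rnorm u ^+ 2 + qf tb u).

Lemma energy_normE u : E u -> energy_norm ip D t u = (enorm u)%:C.
Proof.
move=> Eu; have pc := closure_psd pt cl; have q0 := qf_ge0 pc Eu.
have s0 : 0 <= rnorm u ^+ 2 + qf tb u by apply: addr_ge0 => //; exact: sqr_ge0.
rewrite /energy_norm /energy_ip (ip_rnorm norm_ip) (qfE pc Eu).
rewrite -(rmorphD (real_complex R)) -[in LHS](sqr_sqrtr s0) (rmorphXn (real_complex R)).
by rewrite sqrCK // lecR sqrtr_ge0.
Qed.

Lemma wnorm_enorm r u : 0 <= r -> E u -> wnorm r tb u <= (r + 1) * enorm u.
Proof.
move=> r0 Eu; have q0 := qf_ge0 (closure_psd pt cl) Eu.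
rewrite /wnorm mulrDl mul1r; apply: lerD.
  apply: ler_wpM2l => //; rewrite -[leLHS]ger0_norm ?rnorm_ge0 // -sqrtr_sqr.
  by apply: ler_wsqrtr; rewrite lerDl.
by apply: ler_wsqrtr; rewrite lerDr; exact: sqr_ge0.
Qed.

Lemma enorm_wnorm r u : 0 < r -> E u -> enorm u <= (r^-1 + 1) * wnorm r tb u.
Proof.
move=> r0 Eu; have pc := closure_psd pt cl; have q0 := qf_ge0 pc Eu.
have n0 := rnorm_ge0 u; have s0 := sn_ge0 tb u.
apply: (@le_trans _ _ (rnorm u + sn tb u)).
  rewrite -[leRHS]ger0_norm ?addr_ge0 // -sqrtr_sqr; apply: ler_wsqrtr.
  by rewrite -(sn_sqr pc Eu) sqrrD lerD2r lerDl mulrn_wge0 // mulr_ge0.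
have i0 : 0 < r^-1 by rewrite invr_gt0.
rewrite /wnorm mulrDl mul1r mulrDr mulrA mulVf ?gt_eqF // mul1r.
have h1 : 0 <= r^-1 * sn tb u by rewrite mulr_ge0 // ltW.
have h2 : 0 <= r * rnorm u by rewrite mulr_ge0 // ltW.
by lra.
Qed.

End OneForm.

Variables (D0 D1 : set H) (t0 t1 : H -> H -> R[i]^o) (r c : R).
Hypotheses (r0 : 0 < r) (c0 : 0 < c) (p0 : psd D0 t0) (p1 : psd D1 t1).
Hypotheses (cl0 : closable D0 t0) (cl1 : closable D1 t1).
Local Notation E0 := (energy_space D0 t0).
Local Notation E1 := (energy_space D1 t1).
Hypothesis sameE : E1 = E0.
Hypothesis compare : forall u, E0 u ->
  wnorm r (form_closure D1 t1) u <= c * wnorm r (form_closure D0 t0) u.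

Lemma enorm_compare : exists2 k : R, 0 < k & forall u, E0 u -> enorm D1 t1 u <= k * enorm D0 t0 u.
Proof.
exists ((r^-1 + 1) * (c * (r + 1))).
  by apply: mulr_gt0; [rewrite ltr_wpDl // invr_ge0 ltW|apply: mulr_gt0 => //; rewrite ltr_wpDl // ltW].
move=> u Eu; have Eu1 : E1 u by rewrite sameE.
apply: (le_trans (enorm_wnorm p1 cl1 r0 Eu1)); rewrite -mulrA; apply: ler_wpM2l.
  by rewrite addr_ge0 // invr_ge0 ltW.
apply: (le_trans (compare Eu)); rewrite -mulrA; apply: ler_wpM2l; first exact: ltW.
by apply: (wnorm_enorm p0 cl0) => //; exact: ltW.
Qed.

(** Closeness in the energy norm only changes by a constant factor. *)
Lemma core_compare C : is_core ip D0 t0 C -> is_core ip D1 t1 C.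
Proof.
have [k k0 hk] := enorm_compare; have sE := psd_sub (closure_psd p0 cl0).
move=> [CE hC]; split=> [u /CE|u]; first by rewrite sameE.
rewrite sameE => Eu e /gt0_real[x x0 ->].
have [|v Cv] := hC u Eu (x / k)%:C; first by rewrite ltcR divr_gt0.
have Ed : E0 (v - u) by apply: (subB sE) => //; exact: CE.
rewrite (energy_normE p0 cl0 Ed) ltcR => h; exists v => //.
rewrite (energy_normE p1 cl1) ?sameE // ltcR; apply: (le_lt_trans (hk _ Ed)).
by move: h; rewrite ltr_pdivlMr // mulrC.
Qed.

Lemma open_compare A : energy_open ip D1 t1 A -> energy_open ip D0 t0 A.
Proof.
have [k k0 hk] := enorm_compare; have sE := psd_sub (closure_psd p0 cl0).
move=> [AE hA]; split=> [u /AE|u Au]; first by rewrite sameE.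
have Eu : E0 u by have := AE _ Au; rewrite sameE.
have [e /gt0_real[x x0 ->] hx] := hA u Au.
exists (x / k)%:C; first by rewrite ltcR divr_gt0.
move=> v Ev; have Ed : E0 (v - u) by exact: (subB sE).
rewrite (energy_normE p0 cl0 Ed) ltcR => h; apply: hx; first by rewrite sameE.
rewrite (energy_normE p1 cl1) ?sameE // ltcR; apply: (le_lt_trans (hk _ Ed)).
by move: h; rewrite ltr_pdivlMr // mulrC.
Qed.

End EnergyNorm.

(** * The forms of a strongly holomorphic function *)

Section FormFunction.
Variables (R : realType) (H : completeNormedModType R[i]).
Variable ip : {dot H for Num.conj}.
Hypothesis norm_ip : hilbert_norm ip.
Variables (F : R[i]^o -> lin_op H) (w : R[i]) (B : R[i]^o -> {linear H -> H}).
Hypothesis w_up : 0 < complex.Im w.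
Hypothesis disF : forall z, upper_half_plane R z -> dissipative ip (graph (F z)).
Hypothesis resF : forall z, upper_half_plane R z -> forall f u : H,
  B z f = u <-> (dom (F z) u /\ F z u + w *: u = f).
Hypothesis derF : forall z, upper_half_plane R z -> op_derivable B z.
Hypothesis sF : strongly_holomorphic F.
Local Notation Cp := (upper_half_plane R).
Local Notation tt z := (im_form ip (F z)).
Local Notation tc z := (tform_closure ip F z).
Local Notation W z := (wnorm (Num.sqrt (complex.Im w)) (tc z)).
Implicit Types (a b u v : H) (e : R).

Let pf z (hz : Cp z) := pform disF hz.

Lemma im_form_parts (T : lin_op H) a b : im_form ip T a b =
  ((complex.Im (ip (T a) b) + complex.Im (ip (T b) a)) / 2) +i*
  ((complex.Re (ip (T b) a) - complex.Re (ip (T a) b)) / 2).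
Proof.
rewrite /im_form (ipC ip (T b) a).
have -> : (2 * 'i%C)^-1 = 0 +i* (- 2^-1) :> R[i].
  apply: (mulfI (_ : 2 * 'i%C != 0 :> R[i])).
    by rewrite mulf_eq0 pnatr_eq0 /= eq_complex /= oner_eq0 andbF.
  rewrite divff; last by rewrite mulf_eq0 pnatr_eq0 /= eq_complex /= oner_eq0 andbF.
  by apply/eqP; rewrite eq_complex /=; apply/andP; split; apply/eqP; field.
case: (ip (T a) b) => x y; case: (ip (T b) a) => x' y' /=.
by apply/eqP; rewrite eq_complex /=; apply/andP; split; apply/eqP; field.
Qed.

(** The holomorphic functions behind the real and imaginary parts of
    [t(z)[a, b]], in a chart around [z1]. *)
Lemma pexp_op (z1 : R[i]) a b : Cp z1 -> common_domain F a -> exists p c K, pexp p c K /\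
  forall l, normc l <= 1 -> p l = ip (F (chart z1 ((9^-1)%:C * l)) a) b.
Proof.
move=> z1_up Da; have [_ /(_ a Da)[Om [_ _ hOm _ [g hg gF]]]] := sF.
have [|c [K hc]] := @pexp_chart R H ip norm_ip g z1 b z1_up.
  by move=> z hz; exact/hg/hOm.
have h0 : 0 <= 9^-1 :> R by rewrite invr_ge0.
have h1 : 9^-1 <= 1 :> R by rewrite invf_le1 // ler1n.
have := pexp_scale h0 h1 hc; set p := fun z : R[i] => _ => hp.
exists p, (fun n => c n * (9^-1)%:C ^+ n), K; split=> // l hl.
rewrite /p gF //; apply: chart_up => //; rewrite normcM normc_real ger0_norm //.
by have := normc_ge0 l; lra.
Qed.

(** What [Re] and [Im] have in common, so that both are treated at once. *)
Definition is_part (part : R[i] -> R) := [/\ forall z s, part (z - s) = part z - part s,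
  forall z, `|part z| <= normc z
  & forall (z1 : R[i]) a b, Cp z1 -> common_domain F a -> common_domain F b ->
      exists p c K, pexp p c K /\ forall l, normc l <= 1 ->
        part (tt (chart z1 ((9^-1)%:C * l)) a b) = complex.Re (p l)].

Lemma Re_part : is_part (@complex.Re R).
Proof.
split=> [z s|z|z1 a b hz Da Db]; [exact: raddfB|exact: normcRe|].
have [p [c [K [hp pE]]]] := pexp_op b hz Da; have [q [d [K' [hq qE]]]] := pexp_op a hz Db.
have := pexpZ (0 -i* 2^-1) (pexpD hp hq); set f := fun z : R[i] => _ * _ => hf.
exists f, (fun n => (0 -i* 2^-1) * (c n + d n)), (normc (0 -i* 2^-1) * (K + K')).
split=> // l hl; rewrite im_form_parts /f pE // qE //.
by move: (ip _ b) (ip _ a) => [x y] [x' y'] /=; field.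
Qed.

Lemma Im_part : is_part (@complex.Im R).
Proof.
split=> [z s|z|z1 a b hz Da Db]; [exact: raddfB|exact: normcIm|].
have [p [c [K [hp pE]]]] := pexp_op b hz Da; have [q [d [K' [hq qE]]]] := pexp_op a hz Db.
have := pexpZ (2^-1)%:C (pexpB hq hp); set f := fun z : R[i] => _ * _ => hf.
exists f, (fun n => (2^-1)%:C * (d n - c n)), (normc (2^-1)%:C * (K' + K)).
split=> // l hl; rewrite im_form_parts /f pE // qE //.
by move: (ip _ b) (ip _ a) => [x y] [x' y'] /=; field.
Qed.

Section Near.
Variable z1 : R[i].
Hypotheses (z1_up : Cp z1) (cl1 : tform_closable ip F z1).
Hypothesis core1 : tform_core ip F (common_domain F) z1.

Let r0 : 0 < Num.sqrt (complex.Im w). Proof. by rewrite sqrtr_gt0. Qed.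

Let near_core u e : Hplus ip F z1 u -> 0 < e ->
  exists2 a, common_domain F a & W z1 (u - a) <= e.
Proof.
move=> Eu e0; have [hC /(_ u Eu)] := core1; set r := Num.sqrt _.
have r1 : 0 < r + 1 by rewrite ltr_wpDl // ltW.
have sE := psd_sub (closure_psd (pf z1_up) cl1).
move=> /(_ (e / (r + 1))%:C)[|a Da]; first by rewrite ltcR divr_gt0.
have Ed : Hplus ip F z1 (a - u) by apply: (subB sE) => //; exact: hC.
rewrite (energy_normE norm_ip (pf z1_up) cl1 Ed) ltcR ltr_pdivlMr // mulrC => /ltW h.
exists a => //; rewrite (wnorm_distC r (closure_psd (pf z1_up) cl1) Eu); last exact: hC.
exact: le_trans (wnorm_enorm (pf z1_up) cl1 (ltW r0) Ed) h.
Qed.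

(** The norms of [H_+(z)] are uniformly equivalent near [z1] and [D(F)] is a
    core at [z1], so the closed form is near [z1] a uniform limit of values of
    [t(z)] on [D(F)]. *)
Lemma closure_part_limit part u v : is_part part -> Hplus ip F z1 u -> Hplus ip F z1 v ->
  forall e, 0 < e -> exists p c K, pexp p c K /\ forall l, normc l <= 1 ->
    `|part (tc (chart z1 ((9^-1)%:C * l)) u v) - complex.Re (p l)| <= e.
Proof.
move=> [partB part_le hpart] Eu Ev e e0; have pc1 := closure_psd (pf z1_up) cl1.
have sE := psd_sub pc1; have u0 := wnorm_ge0 (tc z1) r0 u; have v0 := wnorm_ge0 (tc z1) r0 v.
(* 25 is the square of the factor 5 in [local_invariance]. *)
pose S := 25 * (W z1 u + W z1 v + 1); pose d := Num.min 1 (e / S).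
have S0 : 0 < S by rewrite mulr_gt0 // ltr_wpDl // addr_ge0.
have d0 : 0 < d by rewrite lt_min ltr01 divr_gt0.
have d1 : d <= 1 by rewrite ge_min lexx.
have dS : d * S <= e by rewrite -ler_pdivlMr // ge_min lexx orbT.
have [a Da ha] := near_core Eu d0; have [b Db hb] := near_core Ev d0.
have [p [c [K [hp pE]]]] := hpart z1 a b z1_up Da Db.
have [Ea Eb] : Hplus ip F z1 a /\ Hplus ip F z1 b.
  by have [hC _] := core1; split; exact: hC.
exists p, c, K; split=> // l hl; rewrite -pE // -partB; apply: (le_trans (part_le _)).
have hl9 : normc ((9^-1)%:C * l) <= 9^-1.
  by rewrite normcM normc_real ger0_norm ?invr_ge0 //; have := normc_ge0 l; lra.
have [clz sameE hW] := local_invariance norm_ip w_up disF resF derF z1_up hl9 cl1.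
set z := chart z1 _ in clz sameE hW *.
have z_up : Cp z by apply: chart_up => //; apply: le_lt_trans hl9 _; lra.
have pcz : psd (Hplus ip F z) (tc z) := closure_psd (pf z_up) clz.
have inE x : Hplus ip F z1 x -> Hplus ip F z x by rewrite sameE.
have Eua : Hplus ip F z1 (u - a) by exact: (subB sE).
have Evb : Hplus ip F z1 (v - b) by exact: (subB sE).
have <- : tc z a b = tt z a b.
  by apply: (form_closureE (pf z_up) clz); [exact: Da|exact: Db].
have -> : tc z u v - tc z a b = tc z (u - a) v + tc z a (v - b).
  by rewrite (psdBl pcz) ?(psdBr pcz) //; try exact: inE; ring.
have hsn x : Hplus ip F z1 x -> sn (tc z) x <= 5 * W z1 x.
  by move=> Ex; apply: le_trans (hW x Ex).1; exact: sn_wnorm.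
have Wa : W z1 a <= W z1 u + d.
  have -> : a = u - (u - a) by rewrite subKr.
  by apply: (le_trans (wnormB r0 pc1 Eu Eua)); rewrite lerD2l.
have CS x y : Hplus ip F z1 x -> Hplus ip F z1 y ->
    normc (tc z x y) <= 25 * (W z1 x * W z1 y).
  move=> Ex Ey; apply: (le_trans (psd_CS pcz (inE _ Ex) (inE _ Ey))).
  have -> : 25 * (W z1 x * W z1 y) = (5 * W z1 x) * (5 * W z1 y) by ring.
  by apply: ler_pM; [exact: sn_ge0|exact: sn_ge0|exact: hsn|exact: hsn].
apply: (le_trans (normc_add _ _)); apply: le_trans dS.
have h1 := CS _ _ Eua Ev; have h2 := CS _ _ Ea Evb.
have h3 : W z1 (u - a) * W z1 v <= d * W z1 v by rewrite ler_wpM2r.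
have h4 : W z1 a * W z1 (v - b) <= (W z1 u + 1) * d.
  apply: ler_pM; [exact: (wnorm_ge0 (tc z1) r0)|exact: (wnorm_ge0 (tc z1) r0)| |exact: hb].
  by apply: (le_trans Wa); rewrite lerD2l.
rewrite /S; lra.
Qed.

Lemma closure_part_ps part u v : is_part part -> Hplus ip F z1 u -> Hplus ip F z1 v ->
  exists (c : nat -> R[i]) rho M, plane_ps (fun_of_plane (fun z => part (tc z u v)))
    (complex.Re z1) (complex.Im z1) c rho M.
Proof.
move=> hpart Eu Ev; have := harmonic_limit (closure_part_limit hpart Eu Ev).
move=> [a [M [M0 ha hf]]]; pose s := complex.Im z1 / 36.
have s0 : 0 < s by rewrite divr_gt0.
have sN : s != 0 by rewrite gt_eqF.
exists (fun n => a n * (s^-1)%:C ^+ n), (s / 2), M; split=> //.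
- by rewrite divr_gt0.
- move=> n; rewrite normcM normcX normc_real ger0_norm ?invr_ge0 ?(ltW s0) //.
  have -> : 2 * (s / 2) = s by field.
  by rewrite -mulrA -exprMn mulVf // expr1n mulr1.
move=> z hz n; have hl : normc ((s^-1)%:C * z) <= 2^-1.
  rewrite normcM normc_real ger0_norm ?invr_ge0 ?(ltW s0) // mulrC.
  by rewrite ler_pdivrMr // mulrC.
have := hf _ hl n; rewrite /fun_of_plane /shiftc /=.
have -> : chart z1 ((9^-1)%:C * ((s^-1)%:C * z)) =
    (complex.Re z1 + complex.Re z) +i* (complex.Im z1 + complex.Im z).
  rewrite /chart !mulrA -!(rmorphM (real_complex R)).
  have -> : complex.Im z1 / 4 * 9^-1 * s^-1 = 1.
    by rewrite /s; field; rewrite gt_eqF.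
  by rewrite mul1r; case: (z1) => ? ?; case: (z).
congr (`|_ - complex.Re _| <= _); apply: eq_bigr => i _.
by rewrite exprMn mulrA.
Qed.

End Near.
End FormFunction.

Theorem proposition4p6 (R : realType) (H : completeNormedModType R[i])
    (ip : {dot H for Num.conj}) (F : R[i]^o -> lin_op H) (z0 : R[i]^o)
    (norm_ip : hilbert_norm ip)
    (sepH : separable H)
    (RF : class_R ip F)
    (sF : strongly_holomorphic F)
    (z0_up : upper_half_plane R z0)
    (z0_closable : tform_closable ip F z0)
    (z0_core : tform_core ip F (common_domain F) z0) :
  (forall z, upper_half_plane R z -> tform_closable ip F z) /\
  ((forall z, upper_half_plane R z ->
      tform_core ip F (common_domain F) z) /\
   (forall z, upper_half_plane R z ->
      Hplus ip F z = Hplus ip F z0 /\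
      forall A : set H, Hplus_open ip F z A <-> Hplus_open ip F z0 A) /\
   form_domain ip F = Hplus ip F z0) /\
  (forall u v, form_domain ip F u -> form_domain ip F v ->
    charmonic_on (upper_half_plane R) (fun z => tform_closure ip F z u v) /\
    creal_analytic_on (upper_half_plane R)
      (fun z => tform_closure ip F z u v)).
Proof.
have [_ maxF _ _ [[w w_up [B [_ resF derF]]] _]] := RF.
have disF z : upper_half_plane R z -> dissipative ip (graph (F z)).
  by move=> /maxF[].
have pf z (hz : upper_half_plane R z) := pform disF hz.
have r0 : 0 < Num.sqrt (complex.Im w) by rewrite sqrtr_gt0.
have inv z (hz : upper_half_plane R z) :=
  global_invariance norm_ip w_up disF resF derF z0_up hz z0_closable.
have cl z : upper_half_plane R z -> tform_closable ip F z by move=> /inv[].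
have same z : upper_half_plane R z -> Hplus ip F z = Hplus ip F z0 by move=> /inv[].
have core z : upper_half_plane R z -> tform_core ip F (common_domain F) z.
  move=> hz; have [clz sz [c c0 hc]] := inv z hz.
  have cmp u : Hplus ip F z0 u -> _ := fun Eu => (hc u Eu).1.
  exact: (core_compare norm_ip r0 c0 (pf _ z0_up) (pf _ hz) z0_closable clz sz cmp z0_core).
have dom_eq : form_domain ip F = Hplus ip F z0.
  apply/seteqP; split=> [u|u Eu z hz]; first exact.
  by rewrite same.
split=> //; split; first split=> //.
  split=> // z hz; split=> [|A]; first exact: same.
  have [clz sz [c c0 hc]] := inv z hz; split.
    apply: (open_compare norm_ip r0 c0 (pf _ z0_up) (pf _ hz) z0_closable clz sz).
    by move=> u /hc[].
  apply: (open_compare norm_ip r0 c0 (pf _ hz) (pf _ z0_up) clz z0_closable).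
    by rewrite -[LHS]/(Hplus ip F z0) -sz.
  by rewrite -[energy_space _ _]/(Hplus ip F z) sz => u /hc[].
rewrite dom_eq => u v Eu Ev.
have ps part : is_part ip F part -> forall x y, upper_half_plane R (x +i* y) ->
    exists a rho M, plane_ps (fun_of_plane (fun z => part (tform_closure ip F z u v))) x y a rho M.
  move=> hpart x y hxy; have [Eu1 Ev1] : Hplus ip F (x +i* y) u /\ Hplus ip F (x +i* y) v.
    by rewrite same.
  exact: (closure_part_ps norm_ip w_up disF resF derF hxy (cl _ hxy) (core _ hxy) hpart Eu1 Ev1).
have harm part : is_part ip F part ->
    harmonic_on (upper_half_plane R) (fun z => part (tform_closure ip F z u v)).
  move=> /ps h x y /h[a [rho [M hp]]].
  by split; [exact: plane_ps_C2 hp|exact: plane_ps_laplacian hp].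
have ana part : is_part ip F part ->
    real_analytic_on (upper_half_plane R) (fun z => part (tform_closure ip F z u v)).
  by move=> /ps h x y /h[a [rho [M hp]]]; exact: plane_ps_analytic hp.
have [hRe hIm] := (Re_part norm_ip sF, Im_part norm_ip sF).
by split; split; [exact: harm|exact: harm|exact: ana|exact: ana].
Qed.
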